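(* Let $b\in L^\infty(\mathbb{D})$ be a real valued symbol whose support is contained in $\mathbb{D}_R=\{z\in\mathbb{C}:|z|<R\}$ for some $R<1$. Denote by $\Sigma=\{0\}\cup\bigcup_{n=1}^\infty\{\lambda_n\}$ the spectrum of the (compact, self-adjoint) Toeplitz operator $T_b:A^2(\mathbb{D})\to A^2(\mathbb{D})$, where the eigenvalues $\lambda_n$ are indexed such that $|\lambda_1|\ge|\lambda_2|\ge|\lambda_3|\ge\cdots$ and such that any $\lambda_n$ appears as many times as its multiplicity is. If $N\in\mathbb{N}$ and $\delta>0$ are arbitrary numbers such that $|\lambda_N|>|\lambda_{N+1}|+2\delta$, then for every small enough $\varepsilon>0$ there exist a simply connected periodic domain $\Pi\subset\mathbb{C}$ (as described in the context) and a bounded Toeplitz operator $T_{\mathsf a}:A^2(\Pi)\to A^2(\Pi)$, with symbol $\mathsf a\in L^\infty(\Pi)$, such that $$\sigma_{\rm ess}(T_{\mathsf a})\cap B(\lambda_n,\varepsilon)\neq\emptyset\quad\text{for all } n\le N,$$ and $$\mathrm{dist}\big(\sigma_{\rm ess}(T_{\mathsf a})\cap G_\varepsilon,\ \sigma_{\rm ess}(T_{\mathsf a})\setminus G_\varepsilon\big)\ge\delta,\qquad\text{where } G_\varepsilon=\bigcup_{n\le N}B(\lambda_n,\varepsilon).$$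
   Context: For a domain $\Omega\subset\mathbb{C}$, $A^2(\Omega)$ is the Bergman space, i.e. the closed subspace of analytic functions in $L^2(\Omega)$ (area measure), $P_\Omega$ is the orthogonal projection of $L^2(\Omega)$ onto $A^2(\Omega)$, and for $a\in L^\infty(\Omega)$ the Toeplitz operator is $T_a f=P_\Omega(af)$, $f\in A^2(\Omega)$. $\mathbb{D}$ is the open unit disc. In the enumeration $(\lambda_n)$, the nonzero eigenvalues of $T_b$ are listed according to multiplicity in order of nonincreasing modulus (followed by zeros if there are only finitely many of them). Periodic domain: the periodic cell $\varpi$ is a domain with $\varpi\subset(0,1)\times(-M,M)\subset\mathbb{C}$ for some $M>0$ (up to a horizontal translation of the picture), whose boundary $\partial\varpi$ is a Lipschitz curve such that the intersection of $\partial\varpi$ with the lines $\{\mathrm{Re}\,z=0\}$ and $\{\mathrm{Re}\,z=1\}$ is $\{0\}\times[\alpha,\beta]$ and $\{1\}\times[\alpha,\beta]$, respectively, for some real numbers $\alpha<\beta$; it is assumed that $\varpi$ is a Carathéodory domain (so polynomials are dense in $A^2(\varpi)$). The periodic domain $\Pi$ is the interior of $\bigcup_{m\in\mathbb{Z}}\mathrm{cl}(\varpi+m)$. $B(x,r)$ is the Euclidean disc in $\mathbb{C}$ with center $x$ and radius $r$. $\sigma_{\rm ess}(T)$ denotes the essential spectrum of a bounded operator $T$ (the set of $\lambda\in\mathbb{C}$ such that $T-\lambda I$ is not Fredholm). $\mathrm{dist}(A,B)=\inf\{|s-t|:s\in A,\ t\in B\}$. *)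

(* Defs.v *)
From HB Require Import structures.
From mathcomp Require Import all_boot all_order all_algebra.
From mathcomp Require Import complex.
From mathcomp Require Import all_classical all_reals all_analysis.

Set Implicit Arguments.
Unset Strict Implicit.
Unset Printing Implicit Defensive.

Import Order.TTheory GRing.Theory Num.Theory.
Import numFieldNormedType.Exports.
Import ComplexField.Normc.

Local Open Scope classical_set_scope.
Local Open Scope complex_scope.
Local Open Scope ring_scope.

(* Gives the complex plane R[i] the topology and the normed-module structure
   (over itself) that come from its modulus, so that [derivable f z 1] is
   complex differentiability.  The library norm [`|z|] takes its values in
   R[i]; the real-valued modulus is [normc]. *)
HB.instance Definition _ (R : realType) := NormedModule.copy R[i] R[i]^o.

(** * Plane sets *)

Definition disc (R : realType) (c : R[i]) (r : R) : set R[i] :=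
  [set z | normc (z - c) < r].

Definition frontier (R : realType) (A : set R[i]) : set R[i] :=
  closure A `\` interior A.

Definition domain (R : realType) (Omega : set R[i]) : Prop :=
  [/\ Omega !=set0, open Omega & connected Omega].

Definition loop_in (R : realType) (Omega : set R[i]) (g : R -> R[i]) : Prop :=
  [/\ {within `[0, 1], continuous g},
      forall t, `[0, 1]%classic t -> Omega (g t) & g 0 = g 1].

(* H is a homotopy inside Omega, with fixed base point, from the loop g to the
   constant loop at g 0; its first variable is the homotopy parameter. *)
Definition contraction_of_loop (R : realType) (Omega : set R[i])
    (g : R -> R[i]) (H : R * R -> R[i]) : Prop :=
  [/\ {within `[0, 1]%classic `*` `[0, 1]%classic, continuous H},
      forall s t, `[0, 1]%classic s -> `[0, 1]%classic t -> Omega (H (s, t)),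
      forall t, `[0, 1]%classic t -> H (0, t) = g t,
      forall t, `[0, 1]%classic t -> H (1, t) = g 0
    & forall s, `[0, 1]%classic s -> H (s, 0) = g 0 /\ H (s, 1) = g 0].

Definition simply_connected (R : realType) (Omega : set R[i]) : Prop :=
  connected Omega /\
  forall g, loop_in Omega g -> exists H, contraction_of_loop Omega g H.

Definition jordan_curve (R : realType) (Gamma : set R[i]) : Prop :=
  exists g : R -> R[i],
    [/\ {within `[0, 1], continuous g}, g 0 = g 1,
        {in `[0, 1[ &, injective g} & Gamma = g @` `[0, 1]].

(* Near each of its points p the set is the graph of a Lipschitz function, in
   the orthonormal coordinates (s, t) centred at p with axes u and 'i * u. *)
Definition locally_lipschitz_graph (R : realType) (Gamma : set R[i]) : Prop :=
  forall p, Gamma p ->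
    exists (u : R[i]) (phi : R -> R) (d h : R),
      [/\ normc u = 1, lipschitz phi, 0 < d, 0 < h &
          forall s t, `|s| < d -> `|t| < h ->
            Gamma (p + u * (s +i* t)) <-> t = phi s].

Definition lipschitz_curve (R : realType) (Gamma : set R[i]) : Prop :=
  jordan_curve Gamma /\ locally_lipschitz_graph Gamma.

(* For bounded Omega this is the unique unbounded component of the complement
   of the closure; [connected_component A z] is empty when z is not in A. *)
Definition outer_component (R : realType) (Omega : set R[i]) : set R[i] :=
  [set z | ~ bounded_set (connected_component (~` closure Omega) z)].

Definition caratheodory_domain (R : realType) (Omega : set R[i]) : Prop :=
  [/\ domain Omega, bounded_set Omega &
      frontier Omega = frontier (outer_component Omega)].

(** * Periodic domains *)

(* The cell lies over the interval (c, c + 1); the shift c is the freedom of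
   translating the picture horizontally. *)
Definition periodic_cell (R : realType) (cell : set R[i]) : Prop :=
  [/\ domain cell, lipschitz_curve (frontier cell), caratheodory_domain cell &
      exists c M alpha beta : R,
        [/\ 0 < M,
            cell `<=` [set z | c < complex.Re z < c + 1 /\
                               - M < complex.Im z < M],
            alpha < beta,
            frontier cell `&` [set z | complex.Re z = c] =
              [set c +i* y | y in `[alpha, beta]]
          & frontier cell `&` [set z | complex.Re z = c + 1] =
              [set (c + 1) +i* y | y in `[alpha, beta]]]].

Definition periodic_domain (R : realType) (Pi : set R[i]) : Prop :=
  exists2 cell : set R[i], periodic_cell cell &
    Pi = interior (\bigcup_(m in [set: int]) closure [set z + m%:~R | z in cell]).

(** * Function spaces *)

(* The area measure lives on R * R, whose points are read as complex numbers
   through [cplx]. *)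
Definition cplx (R : realType)
  (p : measurableTypeR R * measurableTypeR R) : R[i] := p.1 +i* p.2.

Definition area (R : realType) :
    {measure set (measurableTypeR R * measurableTypeR R) -> \bar R} :=
  (@lebesgue_measure R \x @lebesgue_measure R)%E.

Definition cmeasurable (R : realType) (Omega : set R[i]) (f : R[i] -> R[i]) :
    Prop :=
  measurable_fun (@cplx R @^-1` Omega) (fun p => complex.Re (f (cplx p))) /\
  measurable_fun (@cplx R @^-1` Omega) (fun p => complex.Im (f (cplx p))).

Definition Linfty (R : realType) (Omega : set R[i]) (a : R[i] -> R[i]) : Prop :=
  cmeasurable Omega a /\
  exists M : R,
    {ae @area R, forall p, Omega (cplx p) -> normc (a (cplx p)) <= M}.

(* Support of the class of b in L^infty(Omega): the points of Omega having no
   neighbourhood in which b vanishes almost everywhere. *)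
Definition ess_support (R : realType) (Omega : set R[i]) (b : R[i] -> R[i]) :
    set R[i] :=
  [set z | Omega z /\
     forall U, open_nbhs z U ->
       ~ (@area R).-negligible
           (@cplx R @^-1` (Omega `&` U `&` [set w | b w != 0]))].

Definition L2normsq (R : realType) (Omega : set R[i]) (f : R[i] -> R[i]) :
    \bar R :=
  (\int[@area R]_(p in @cplx R @^-1` Omega) (normc (f (cplx p)) ^+ 2)%:E)%E.

Definition L2norm (R : realType) (Omega : set R[i]) (f : R[i] -> R[i]) : R :=
  Num.sqrt (fine (L2normsq Omega f)).

Definition L2 (R : realType) (Omega : set R[i]) : set (R[i] -> R[i]) :=
  [set f | cmeasurable Omega f /\ (L2normsq Omega f < +oo)%E].

Definition L2inner (R : realType) (Omega : set R[i]) (f g : R[i] -> R[i]) :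
    R[i] :=
  (\int[@area R]_(p in @cplx R @^-1` Omega)
      complex.Re (f (cplx p) * (g (cplx p))^*)) +i*
  (\int[@area R]_(p in @cplx R @^-1` Omega)
      complex.Im (f (cplx p) * (g (cplx p))^*)).

Definition analytic_on (R : realType) (Omega : set R[i]) (f : R[i] -> R[i]) :
    Prop :=
  forall z, Omega z -> derivable f z 1.

(* A function on Omega is represented by its extension by 0, so that two
   elements of the Bergman space are equal iff they agree on Omega. *)
Definition bergman (R : realType) (Omega : set R[i]) : set (R[i] -> R[i]) :=
  [set f | [/\ analytic_on Omega f, L2 Omega f &
               forall z, ~ Omega z -> f z = 0]].

(* Orthogonal projection of L^2(Omega) onto the closed subspace [bergman Omega].
   For open Omega and g in L^2(Omega) the set below is a singleton, so the
   default value 0 of [xget] is not used. *)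
Definition bergman_proj (R : realType) (Omega : set R[i]) (g : R[i] -> R[i]) :
    R[i] -> R[i] :=
  xget 0 [set h | bergman Omega h /\
                  forall k, bergman Omega k -> L2inner Omega (g - h) k = 0].

Definition toeplitz (R : realType) (Omega : set R[i]) (a f : R[i] -> R[i]) :
    R[i] -> R[i] :=
  bergman_proj Omega (a \* f).

(** * Operators *)

(* An operator is a map T : V -> V considered on the subspace H of V, and nrm
   is the norm of H. *)

Definition bounded_operator (R : realType) (V : lmodType R[i]) (H : set V)
    (nrm : V -> R) (T : V -> V) : Prop :=
  [/\ forall f, H f -> H (T f),
      forall (c : R[i]) f g, H f -> H g -> T (c *: f + g) = c *: T f + T g
    & exists M : R, forall f, H f -> nrm (T f) <= M * nrm f].

Definition has_dim (R : realType) (V : lmodType R[i]) (S : set V) (k : nat) :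
    Prop :=
  exists e : 'I_k -> V,
    [/\ forall i, S (e i),
        forall c : 'I_k -> R[i], \sum_i c i *: e i = 0 -> forall i, c i = 0
      & forall v, S v -> exists c : 'I_k -> R[i], v = \sum_i c i *: e i].

Definition eigenspace_of (R : realType) (V : lmodType R[i]) (H : set V)
    (T : V -> V) (mu : R[i]) : set V :=
  [set f | H f /\ T f = mu *: f].

Definition fredholm (R : realType) (V : lmodType R[i]) (H : set V)
    (nrm : V -> R) (T : V -> V) : Prop :=
  [/\ exists k, has_dim [set f | H f /\ T f = 0] k,
      forall g, H g ->
        (forall e : R, 0 < e -> exists2 f, H f & nrm (T f - g) < e) ->
        exists2 f, H f & T f = g
    & exists (k : nat) (e : 'I_k -> V),
        (forall i, H (e i)) /\
        forall h, H h -> exists (f : V) (c : 'I_k -> R[i]),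
          H f /\ h = T f + \sum_i c i *: e i].

Definition ess_spectrum (R : realType) (V : lmodType R[i]) (H : set V)
    (nrm : V -> R) (T : V -> V) : set R[i] :=
  [set mu | ~ fredholm H nrm (fun f => T f - mu *: f)].

(* lam 0, lam 1, ... lists the nonzero eigenvalues of T, each repeated according
   to its multiplicity, with nonincreasing modulus; by monotonicity all terms
   after the last nonzero one are 0. *)
Definition eigenvalue_enumeration (R : realType) (V : lmodType R[i])
    (H : set V) (T : V -> V) (lam : nat -> R[i]) : Prop :=
  (forall m n, (m <= n)%N -> normc (lam n) <= normc (lam m)) /\
  forall mu, mu != 0 -> exists k,
    has_dim (eigenspace_of H T mu) k /\ ([set n | lam n = mu] #= `I_k)%card.

Definition toeplitz_ess_spectrum (R : realType) (Omega : set R[i])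
    (a : R[i] -> R[i]) : set R[i] :=
  ess_spectrum (bergman Omega) (L2norm Omega) (toeplitz Omega a).

(* Equal to +oo when A or B is empty. *)
Definition set_dist (R : realType) (A B : set R[i]) : \bar R :=
  ereal_inf [set (normc (st.1 - st.2))%:E | st in A `*` B].

(* Main.v *)
Require Import Defs.
From HB Require Import structures.
From mathcomp Require Import all_boot all_order all_algebra.
From mathcomp Require Import complex.
From mathcomp Require Import all_classical all_reals all_analysis.
From mathcomp Require Import measurable_realfun.
From mathcomp Require Import ring lra.

Set Implicit Arguments.
Unset Strict Implicit.
Unset Printing Implicit Defensive.

Import Order.TTheory GRing.Theory Num.Theory.
Import numFieldNormedType.Exports.
Import ComplexField.Normc.

Local Open Scope classical_set_scope.
Local Open Scope complex_scope.
Local Open Scope ring_scope.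

(** Take for [Pi] the strip [|Im z| < 1/2] and for the symbol a sum of constants
    [c_m] on small congruent squares [K_m] centred at points [x_m] far apart on
    the real axis.  Let [S] be the supremum of [int_K |f|^2] over the unit ball
    of the Bergman space, and let [w_m] be a near-maximiser translated to [x_m].
    Since [S <f, g> - <f, g>_K] is a positive form that almost vanishes at its
    near-maximiser, [w_m] is an approximate eigenvector of the Toeplitz operator
    with eigenvalue [S c_m].  With [S c_m = lam (m mod N)] every [lam n], [n < N],
    occurs infinitely often along an almost orthogonal sequence, so it lies in
    the essential spectrum: a gliding hump argument excludes a range of finite
    codimension.  Conversely, on a small square an analytic function is almost
    constant, hence [|<T f, f>|] is at most a multiple of [sum |<f, w_m>|^2] plus
    a small multiple of [|f|^2].  This bounds [T - mu] and its adjoint from below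
    when [|mu| > delta / 2] has distance at least [e] from the [lam n], so the
    essential spectrum outside the discs lies in [|mu| <= delta / 2], whereas
    [|lam n| > 2 delta].  The bounds of [f] and of its increments by the
    local L^2 norm come from Cauchy's formula on rectangles. *)

(** * Complex moduli and complex-valued integrals *)

(** Two scales compete. For small [rho] the number [S] lies between [c ^+ 2] and [2 ^+ 16] times the
    area [4 * rho ^+ 2] of the square, where [c], half the value at 0 of a fixed normalised
    function, is independent of [rho]. The constants [lam / S] blow up like [rho ^- 2], but constant
    times area stays bounded, and replacing an analytic function by its central value costs a
    further [rho ^+ 2]. So [rho] is made small before anything that depends on [S] is chosen; only
    then are the defects [th m] of the near-maximisers taken square summable with a small enough
    sum. The strip is chosen for its horizontal translations: they carry one extremal problem to
    every [x_m], so a single [S] normalises all constants, and the squares can be put as far apart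
    as the tails require. The supremum is only approached: Cauchy-Schwarz for the positive form
    turns a defect [S * th m ^+ 2] into an error [S * th m]. The adjoint of an array operator is the
    array operator of the conjugate constants, so one lower bound serves both. *)

Section complex_modulus.
Variable R : realType.
Implicit Types (z w : R[i]) (x : R).

Lemma normC_normc z : `|z| = (normc z)%:C.
Proof. by []. Qed.

Lemma normc_ge0 z : 0 <= normc z.
Proof. by case: z => a b; exact: sqrtr_ge0. Qed.

Lemma sqr_normc z : normc z ^+ 2 = complex.Re z ^+ 2 + complex.Im z ^+ 2.
Proof. by case: z => a b /=; rewrite sqr_sqrtr// addr_ge0// sqr_ge0. Qed.

Lemma normc_real x : normc x%:C = `|x|.
Proof. by rewrite /= expr0n addr0 sqrtr_sqr. Qed.

Lemma normc_conj z : normc z^* = normc z.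
Proof. by case: z => a b /=; rewrite sqrrN. Qed.

Lemma normc_eq0 z : (normc z == 0) = (z == 0).
Proof. by apply/eqP/eqP => [/eq0_normc//|->]; rewrite normc0. Qed.

Lemma normc_gt0 z : (0 < normc z) = (z != 0).
Proof. by rewrite lt_neqAle normc_ge0 andbT eq_sym normc_eq0. Qed.

Lemma normcB z w : normc (z - w) = normc (w - z).
Proof. by rewrite -normcN opprB. Qed.

Lemma le_normcB z w : normc (z - w) <= normc z + normc w.
Proof. by rewrite -(normcN w); exact: le_normcD. Qed.

Lemma le_normc_dist z w : normc z - normc w <= normc (z - w).
Proof. by rewrite lerBlDr (le_trans _ (le_normcD _ _)) ?subrK. Qed.

Lemma le_normr_Re z : `|complex.Re z| <= normc z.
Proof.
by rewrite -(@ler_pXn2r _ 2) ?nnegrE ?normc_ge0// sqr_normc real_normK ?num_real// lerDl sqr_ge0.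
Qed.

Lemma le_normr_Im z : `|complex.Im z| <= normc z.
Proof.
by rewrite -(@ler_pXn2r _ 2) ?nnegrE ?normc_ge0// sqr_normc real_normK ?num_real// lerDr sqr_ge0.
Qed.

Lemma le_normc_ReIm z : normc z <= `|complex.Re z| + `|complex.Im z|.
Proof.
rewrite -(@ler_pXn2r _ 2) ?nnegrE ?normc_ge0 ?addr_ge0//.
by rewrite sqr_normc sqrrD !real_normK ?num_real// lerD2r lerDl mulrn_wge0// mulr_ge0.
Qed.

Lemma mulcJ z : z * z^* = (normc z ^+ 2)%:C.
Proof. by rewrite sqr_normc; case: z => a b; simpc; congr (_ +i* _); ring. Qed.

Lemma cReD z w : complex.Re (z + w) = complex.Re z + complex.Re w.
Proof. by case: z; case: w. Qed.
Lemma cImD z w : complex.Im (z + w) = complex.Im z + complex.Im w.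
Proof. by case: z; case: w. Qed.
Lemma cReN z : complex.Re (- z) = - complex.Re z.
Proof. by case: z. Qed.
Lemma cImN z : complex.Im (- z) = - complex.Im z.
Proof. by case: z. Qed.
Lemma cReM z w : complex.Re (z * w) =
  complex.Re z * complex.Re w - complex.Im z * complex.Im w.
Proof. by case: z; case: w. Qed.
Lemma cImM z w : complex.Im (z * w) =
  complex.Re z * complex.Im w + complex.Im z * complex.Re w.
Proof. by case: z; case: w. Qed.
Lemma cReJ z : complex.Re z^* = complex.Re z.
Proof. by case: z. Qed.
Lemma cImJ z : complex.Im z^* = - complex.Im z.
Proof. by case: z. Qed.

Lemma complex_eta z : complex.Re z +i* complex.Im z = z.
Proof. by case: z. Qed.

Lemma le_Re_normc z : complex.Re z <= normc z.
Proof. exact: le_trans (ler_norm _) (le_normr_Re _). Qed.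

End complex_modulus.

Section cint.
Context d (T : measurableType d) (R : realType) (mu : {measure set T -> \bar R}).
Implicit Types (D : set T) (F G : T -> R[i]) (c : R[i]).

Definition cint D F : R[i] :=
  (\int[mu]_(x in D) complex.Re (F x)) +i* (\int[mu]_(x in D) complex.Im (F x)).

Definition cmeas D F :=
  measurable_fun D (fun x => complex.Re (F x)) /\
  measurable_fun D (fun x => complex.Im (F x)).

Definition cintegrable D F :=
  mu.-integrable D (EFin \o (fun x => complex.Re (F x))) /\
  mu.-integrable D (EFin \o (fun x => complex.Im (F x))).

Lemma cintegrable_meas D F : cintegrable D F -> cmeas D F.
Proof. by move=> [/measurable_int/measurable_EFinP ? /measurable_int/measurable_EFinP ?]. Qed.

Lemma measurable_normc D F : cmeas D F ->
  measurable_fun D (fun x => normc (F x)).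
Proof.
move=> [mR mI].
rewrite (_ : (fun _ => _) = Num.sqrt \o (fun x => complex.Re (F x) ^+ 2 + complex.Im (F x) ^+ 2)).
  apply: (@measurable_comp _ _ _ _ _ _ setT) => //.
    by apply: continuous_measurable_fun; exact: sqrt_continuous.
  by apply: measurable_funD; exact: measurable_funX.
by apply/funext => x /=; case: (F x).
Qed.

Lemma cmeasD D F G : cmeas D F -> cmeas D G -> cmeas D (fun x => F x + G x).
Proof.
move=> [FR FI] [GR GI]; split.
  by under eq_fun do rewrite cReD; exact: measurable_funD.
by under eq_fun do rewrite cImD; exact: measurable_funD.
Qed.

Lemma cmeasN D F : cmeas D F -> cmeas D (fun x => - F x).
Proof.
move=> [FR FI]; split.
  by under eq_fun do rewrite cReN; exact: measurableT_comp.
by under eq_fun do rewrite cImN; exact: measurableT_comp.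
Qed.

Lemma cmeasB D F G : cmeas D F -> cmeas D G -> cmeas D (fun x => F x - G x).
Proof. by move=> mF mG; apply: cmeasD => //; exact: cmeasN. Qed.

Lemma cmeasM D F G : cmeas D F -> cmeas D G -> cmeas D (fun x => F x * G x).
Proof.
move=> [FR FI] [GR GI]; split.
  by under eq_fun do rewrite cReM; apply: measurable_funB; exact: measurable_funM.
by under eq_fun do rewrite cImM; apply: measurable_funD; exact: measurable_funM.
Qed.

Lemma cmeasJ D F : cmeas D F -> cmeas D (fun x => (F x)^*).
Proof.
move=> [FR FI]; split.
  by under eq_fun do rewrite cReJ.
by under eq_fun do rewrite cImJ; exact: measurableT_comp.
Qed.

Lemma cmeas_cst D c : cmeas D (fun=> c).
Proof. by split; exact: measurable_cst. Qed.

Lemma cmeasS D E F : measurable E -> D `<=` E -> cmeas E F -> cmeas D F.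
Proof. by move=> mE DE [FR FI]; split; exact: (measurable_funS mE). Qed.

Lemma cintegrable_norm D F : measurable D -> cintegrable D F ->
  mu.-integrable D (EFin \o (fun x => normc (F x))).
Proof.
move=> mD iF; have [mR mI] := cintegrable_meas iF.
have [iR iI] := iF.
apply: (@le_integrable _ _ _ _ _ mD _ (fun x => `|complex.Re (F x)|%:E + `|complex.Im (F x)|%:E)%E) => //.
- exact/measurable_EFinP/measurable_normc.
- move=> x Dx /=; rewrite lee_fin ger0_norm ?normc_ge0// ger0_norm ?addr_ge0//.
  exact: le_normc_ReIm.
- by apply: integrableD => //; exact: integrable_norm.
Qed.

Lemma cintegrable_le D F (g : T -> R) : measurable D -> cmeas D F ->
  mu.-integrable D (EFin \o g) -> (forall x, D x -> normc (F x) <= g x) ->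
  cintegrable D F.
Proof.
move=> mD [mR mI] ig Fg; split.
- apply: le_integrable ig => //; first exact/measurable_EFinP.
  move=> x Dx /=; rewrite lee_fin (le_trans (le_normr_Re _))//.
  by rewrite (le_trans (Fg _ Dx))// ler_norm.
- apply: le_integrable ig => //; first exact/measurable_EFinP.
  move=> x Dx /=; rewrite lee_fin (le_trans (le_normr_Im _))//.
  by rewrite (le_trans (Fg _ Dx))// ler_norm.
Qed.

Lemma cintegrableD D F G : measurable D -> cintegrable D F -> cintegrable D G ->
  cintegrable D (fun x => F x + G x).
Proof.
move=> mD [FR FI] [GR GI]; split.
  by apply: eq_integrable (integrableD mD FR GR) => // x _ /=; rewrite cReD.
by apply: eq_integrable (integrableD mD FI GI) => // x _ /=; rewrite cImD.
Qed.

Lemma cintegrableZ D c F : measurable D -> cintegrable D F ->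
  cintegrable D (fun x => c * F x).
Proof.
move=> mD iF.
have iN := cintegrable_norm mD iF.
apply: (@cintegrable_le _ _ (fun x => normc c * normc (F x))) => //.
- by apply: cmeasM; [exact: cmeas_cst|exact: cintegrable_meas].
- by have := integrableZl mD (normc c) iN; apply: eq_integrable.
- by move=> x _; rewrite normcM.
Qed.

Lemma eq_cint D F G : (forall x, D x -> F x = G x) -> cint D F = cint D G.
Proof.
by move=> FG; congr (_ +i* _); apply: eq_Rintegral => x /set_mem Dx; rewrite FG.
Qed.

Lemma eq_cintegrable D F G : measurable D -> (forall x, D x -> F x = G x) ->
  cintegrable D F -> cintegrable D G.
Proof.
move=> mD FG [FR FI]; split.
  by apply: eq_integrable FR => // x /set_mem Dx /=; rewrite FG.
by apply: eq_integrable FI => // x /set_mem Dx /=; rewrite FG.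
Qed.

Lemma cintD D F G : measurable D -> cintegrable D F -> cintegrable D G ->
  cint D (fun x => F x + G x) = cint D F + cint D G.
Proof.
move=> mD [FR FI] [GR GI]; rewrite /cint; simpc; congr (_ +i* _).
  by under eq_Rintegral do rewrite cReD; rewrite RintegralD.
by under eq_Rintegral do rewrite cImD; rewrite RintegralD.
Qed.

Lemma cintZ D c F : measurable D -> cintegrable D F ->
  cint D (fun x => c * F x) = c * cint D F.
Proof.
move=> mD [FR FI]; case: c => a b; rewrite /cint; simpc; congr (_ +i* _).
  under eq_Rintegral do rewrite cReM/=.
  rewrite RintegralB ?RintegralZl//.
    by apply: eq_integrable (integrableZl mD a FR) => //.
  by apply: eq_integrable (integrableZl mD b FI) => //.
under eq_Rintegral do rewrite cImM/=.
rewrite RintegralD ?RintegralZl//.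
  by apply: eq_integrable (integrableZl mD a FI) => //.
by apply: eq_integrable (integrableZl mD b FR) => //.
Qed.

Lemma cintegrableN D F : measurable D -> cintegrable D F ->
  cintegrable D (fun x => - F x).
Proof.
move=> mD iF; apply: eq_cintegrable (cintegrableZ (-1) mD iF) => // x _.
by rewrite mulN1r.
Qed.

Lemma cintN D F : measurable D -> cintegrable D F ->
  cint D (fun x => - F x) = - cint D F.
Proof.
move=> mD iF; rewrite -[RHS]mulN1r -cintZ//.
by apply: eq_cint => x _; rewrite mulN1r.
Qed.

Lemma cintegrableB D F G : measurable D -> cintegrable D F -> cintegrable D G ->
  cintegrable D (fun x => F x - G x).
Proof. by move=> mD iF iG; apply: cintegrableD => //; exact: cintegrableN. Qed.

Lemma cintB D F G : measurable D -> cintegrable D F -> cintegrable D G ->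
  cint D (fun x => F x - G x) = cint D F - cint D G.
Proof. by move=> mD iF iG; rewrite cintD ?cintN//; exact: cintegrableN. Qed.

Lemma cintJ D F : measurable D -> cintegrable D F ->
  cint D (fun x => (F x)^*) = (cint D F)^*.
Proof.
move=> mD [FR FI]; rewrite /cint/=; congr (_ +i* _).
  by apply: eq_Rintegral => x _; rewrite cReJ.
under eq_Rintegral do rewrite cImJ -mulN1r.
by rewrite RintegralZl// mulN1r.
Qed.

Lemma cint_setU A B F : measurable A -> measurable B -> cintegrable (A `|` B) F ->
  [disjoint A & B] -> cint (A `|` B) F = cint A F + cint B F.
Proof.
by move=> mA mB [FR FI] AB; rewrite /cint; simpc; rewrite !Rintegral_setU.
Qed.

(* Rotating by a unit complex number reduces the bound to the real part. *)
Lemma normc_cint D F : measurable D -> cintegrable D F ->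
  normc (cint D F) <= \int[mu]_(x in D) normc (F x).
Proof.
move=> mD iF; have iN := cintegrable_norm mD iF.
have [->|I0] := eqVneq (cint D F) 0.
  by rewrite normc0; apply: Rintegral_ge0 => x _; exact: normc_ge0.
set w := cint D F in I0 *; have n0 : normc w != 0 by rewrite normc_eq0.
pose u : R[i] := w^* * (normc w)^-1%:C.
have u1 : normc u = 1.
  by rewrite normcM normc_conj normc_real ger0_norm ?invr_ge0 ?normc_ge0// divff.
have -> : normc w = complex.Re (u * w).
  by rewrite /u mulrAC [w^* * w]mulrC mulcJ -rmorphM/= expr2 mulfK.
rewrite -cintZ//=; apply: le_Rintegral => //.
  by have [] := cintegrableZ u mD iF.
by move=> x _; rewrite (le_trans (le_Re_normc _))// normcM u1 mul1r.
Qed.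

End cint.

(** * Cauchy's formula on rectangles *)

Section complex_derivative.
Variable R : realType.
Implicit Types (f g : R[i] -> R[i]) (z w L : R[i]).

(** The library norm of [R[i]] is complex-valued, so continuity and differentiability are restated
    with real [e] and [d]. In [hasder] the quotient is multiplied out: [w = z] is no exception, and
    remainder estimates pass easily to pointwise limits. *)
Definition ccont f z := forall e : R, 0 < e -> exists2 d : R, 0 < d &
  forall w, normc (w - z) < d -> normc (f w - f z) < e.

Definition hasder f z L := forall e : R, 0 < e -> exists2 d : R, 0 < d &
  forall w, normc (w - z) < d -> normc (f w - f z - L * (w - z)) <= e * normc (w - z).

(** The order of [R[i]] compares only numbers with equal imaginary part, so a positive element is a
    positive real; this turns every library epsilon into a real one. *)
Lemma gt0_complexE (e : R[i]) : 0 < e -> exists2 x : R, 0 < x & e = x%:C.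
Proof.
case: e => a b; rewrite ltcE/= => /andP[/eqP -> a0]; by exists a.
Qed.

Lemma nbhs_complexP z (A : set R[i]) : nbhs z A <->
  exists2 d : R, 0 < d & forall w, normc (w - z) < d -> A w.
Proof.
split.
  move=> /nbhs_ballP[e /= /gt0_complexE[x x0 ->]] H; exists x => // w wz.
  by apply: H; rewrite -ball_normE /= normC_normc ltcR normcB.
move=> [d d0 H]; apply/nbhs_ballP; exists d%:C; first by rewrite /= ltcR.
move=> w; rewrite -ball_normE /= normC_normc ltcR normcB; exact: H.
Qed.

Lemma dnbhs0_complexP (A : set R[i]) : (\forall h \near (0 : R[i])^', A h) <->
  exists2 d : R, 0 < d & forall h, h != 0 -> normc h < d -> A h.
Proof.
split.
  move=> /nbhs_complexP[d d0 H]; exists d => // h h0 hd.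
  by apply: H => //; rewrite subr0.
move=> [d d0 H]; apply/nbhs_complexP; exists d => // h; rewrite subr0 => hd h0.
exact: H.
Qed.

Lemma cvg_complexP (T : Type) (F : set_system T) (FF : Filter F) (u : T -> R[i]) L :
  (u @ F --> L) <-> (forall e : R, 0 < e -> \forall t \near F, normc (u t - L) < e).
Proof.
split.
  move=> /cvgrPdist_lt H e e0.
  have := H e%:C; rewrite ltcR => /(_ e0); apply: filterS => t.
  by rewrite normC_normc ltcR normcB.
move=> H; apply/cvgrPdist_lt => e /gt0_complexE[x x0 ->].
by apply: filterS (H _ x0) => t; rewrite normC_normc ltcR normcB.
Qed.

Lemma derivableE f z : derivable f z 1 <-> exists L, hasder f z L.
Proof.
split.
  move=> /cvg_ex[L /cvg_complexP H]; exists L => e e0.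
  have /dnbhs0_complexP[d d0 {}H] := H _ e0; exists d => // w wz.
  have [->|wz0] := eqVneq w z; first by rewrite !subrr mulr0 subrr normc0 mulr0.
  have h0 : w - z != 0 by rewrite subr_eq0.
  have := H _ h0 wz; rewrite /= scaler1 subrK => /ltW.
  have -> : (w - z)^-1 *: (f w - f z) - L = (f w - f z - L * (w - z)) / (w - z).
    by rewrite mulrBl mulfK// mulrC.
  by rewrite normcM normcV ler_pdivrMr// normc_gt0.
move=> [L H]; apply/cvg_ex; exists L; apply/cvg_complexP => e e0.
have e20 : 0 < e / 2 by rewrite divr_gt0.
have [d d0 {}H] := H _ e20.
apply/dnbhs0_complexP; exists d => // h h0 hd; rewrite /= scaler1.
have := H (h + z); rewrite addrK => /(_ hd) Hh.
have -> : h^-1 *: (f (h + z) - f z) - L = (f (h + z) - f z - L * h) / h.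
  by rewrite mulrBl mulfK// mulrC.
rewrite normcM normcV ltr_pdivrMr ?normc_gt0// (le_lt_trans Hh)//.
by rewrite ltr_pM2r ?normc_gt0// ltr_pdivrMr// mulr_natr mulr2n ltrDl.
Qed.

Lemma hasder_ccont f z L : hasder f z L -> ccont f z.
Proof.
move=> H e e0; have [d d0 {}H] := H _ ltr01.
have K0 : 0 < 1 + normc L by rewrite ltr_pwDl// normc_ge0.
exists (Num.min d (e / (1 + normc L))); first by rewrite lt_min d0 divr_gt0.
move=> w; rewrite lt_min => /andP[wd we].
have -> : f w - f z = (f w - f z - L * (w - z)) + L * (w - z) by rewrite subrK.
rewrite (le_lt_trans (le_normcD _ _))//.
rewrite (le_lt_trans (lerD (H _ wd) (lexx _)))// normcM -mulrDl.
by rewrite mulrC -ltr_pdivlMr.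
Qed.

Lemma derivable_ccont f z : derivable f z 1 -> ccont f z.
Proof. by move=> /derivableE[L /hasder_ccont]. Qed.

Lemma hasder_unique f z L L' : hasder f z L -> hasder f z L' -> L = L'.
Proof.
move=> H H'; apply/eqP; rewrite -subr_eq0 -normc_eq0; apply/negPn/negP => n0.
have e0 : 0 < normc (L - L') / 4 by rewrite divr_gt0// lt_neqAle eq_sym n0 normc_ge0.
have [d d0 {}H] := H _ e0; have [d' d'0 {}H'] := H' _ e0.
set t := Num.min d d' / 2.
have t0 : 0 < t by rewrite divr_gt0// lt_min d0.
have nt : normc (z + t%:C - z) = t by rewrite addrC addKr normc_real gtr0_norm.
have td : t < d by rewrite ltr_pdivrMr// (@le_lt_trans _ _ d) ?ge_min ?lexx// ltr_pMr// ltr1n.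
have td' : t < d' by rewrite ltr_pdivrMr// (@le_lt_trans _ _ d') ?ge_min ?lexx ?orbT// ltr_pMr// ltr1n.
have := H (z + t%:C); have := H' (z + t%:C); rewrite nt => /(_ td') A /(_ td) B.
have : normc ((L - L') * (z + t%:C - z)) <= normc (L - L') / 4 * t + normc (L - L') / 4 * t.
  have -> : (L - L') * (z + t%:C - z) =
    (f (z + t%:C) - f z - L' * (z + t%:C - z)) - (f (z + t%:C) - f z - L * (z + t%:C - z)).
    by ring.
  by rewrite (le_trans (le_normcB _ _))// lerD.
rewrite normcM nt -mulrDl ler_pM2r// -mulrDr.
have -> : (4^-1 + 4^-1 = 2^-1 :> R) by lra.
rewrite leNgt gtr_pMr ?invf_lt1 ?ltr1n//.
by rewrite lt_neqAle eq_sym n0 normc_ge0.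
Qed.

End complex_derivative.

(** * Integrals along segments and around rectangles *)

Section line_integral.
Variable R : realType.
Notation mu := (@lebesgue_measure R).
Implicit Types (F G : R -> R[i]) (a b m x : R).

Definition lcont F x := forall e : R, 0 < e -> exists2 d : R, 0 < d &
  forall y, `|y - x| < d -> normc (F y - F x) < e.

Lemma lcont_cintegrable a b F : (forall x, a <= x <= b -> lcont F x) ->
  cintegrable mu `[a, b]%classic F.
Proof.
move=> cF.
have H (h : R[i] -> R) : (forall z w, `|h z - h w| <= normc (z - w)) ->
    mu.-integrable `[a, b]%classic (EFin \o (fun x => h (F x))).
  move=> hL; apply: continuous_compact_integrable; first exact: segment_compact.
  apply: continuous_in_subspaceT => x; rewrite inE/= in_itv/= => xab.
  apply/cvgrPdist_lt => e e0; have [d d0 H] := cF x xab e e0.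
  near=> y; rewrite (le_lt_trans (hL _ _))// normcB; apply: H.
  rewrite distrC; near: y; exact: cvgr_dist_lt.
by split; apply: H => z w; rewrite -?cReN -?cReD -?cImN -?cImD ?le_normr_Re ?le_normr_Im.
Unshelve. all: by end_near. Qed.

Lemma cint_split a m b F : a <= m -> m <= b -> cintegrable mu `[a, b]%classic F ->
  cint mu `[a, b]%classic F = cint mu `[a, m]%classic F + cint mu `[m, b]%classic F.
Proof.
move=> am mb [FR FI].
have H (h : R -> R) : mu.-integrable `[a, b]%classic (EFin \o h) ->
  \int[mu]_(x in `[a, b]%classic) h x =
  \int[mu]_(x in `[a, m]%classic) h x + \int[mu]_(x in `[m, b]%classic) h x.
  move=> ih; apply/eqP; rewrite addrC -subr_eq; apply/eqP.
  rewrite Rintegral_itvB ?bnd_simp//.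
  rewrite Rintegral_itv_obnd_cbnd//.
  apply: integrableS ih => //; apply: subset_itv; rewrite bnd_simp//.
by rewrite /cint; simpc; rewrite !H.
Qed.

Lemma fine_lebesgue_itv a b : a <= b -> fine (mu `[a, b]%classic) = b - a.
Proof.
move=> ab; rewrite lebesgue_measure_itv/= lte_fin.
rewrite le_eqVlt in ab; case/predU1P : ab => [->|ab]; last by rewrite ab.
by rewrite ltxx/= subrr.
Qed.

Lemma integrable_cst_itv a b (K : R) : mu.-integrable `[a, b]%classic (EFin \o (fun=> K)).
Proof.
apply: continuous_compact_integrable; first exact: segment_compact.
by apply: continuous_subspaceT => x; exact: cvg_cst.
Qed.

Lemma cint_cst a b (k : R[i]) : a <= b -> cint mu `[a, b]%classic (fun=> k) = k * (b - a)%:C.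
Proof.
move=> ab; rewrite /cint !Rintegral_cst//=; rewrite fine_lebesgue_itv//.
by case: k => u v; simpc.
Qed.

Lemma normc_cint_cst a b F (M : R) : a <= b -> cintegrable mu `[a, b]%classic F ->
  (forall x, a <= x <= b -> normc (F x) <= M) ->
  normc (cint mu `[a, b]%classic F) <= M * (b - a).
Proof.
move=> ab iF FM; rewrite (le_trans (normc_cint _ iF))//.
rewrite -[X in _ <= _ * X](fine_lebesgue_itv ab) -Rintegral_cst//.
apply: le_Rintegral => //; first exact: cintegrable_norm.
exact: integrable_cst_itv.
Qed.

End line_integral.

Section rectangle_integral.
Variable R : realType.
Notation mu := (@lebesgue_measure R).
Implicit Types (f g : R[i] -> R[i]) (a b c d x y m : R) (z w L : R[i]).

Definition hint f a b y := cint mu `[a, b]%classic (fun x => f (x +i* y)).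
Definition vint f c d x := cint mu `[c, d]%classic (fun y => f (x +i* y)).

(** The anticlockwise contour integral around the rectangle: [dz] is [dx] on the horizontal sides
    and ['i * dy] on the vertical ones. *)
Definition rint f a b c d :=
  hint f a b c - hint f a b d + 'i * (vint f c d b - vint f c d a).

Definition on_rect (P : R[i] -> Prop) a b c d :=
  forall x y, a <= x <= b -> c <= y <= d -> P (x +i* y).

Definition hline f a b y := forall x, a <= x <= b -> lcont (fun x => f (x +i* y)) x.
Definition vline f c d x := forall y, c <= y <= d -> lcont (fun y => f (x +i* y)) y.

Lemma complexB (x x' y y' : R) : (x +i* y) - (x' +i* y') = (x - x') +i* (y - y').
Proof. by []. Qed.

Lemma normc_imag y : normc (0 +i* y) = `|y|.
Proof. by rewrite /= expr0n add0r sqrtr_sqr. Qed.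

Lemma ccont_lconth f x y : ccont f (x +i* y) -> lcont (fun x => f (x +i* y)) x.
Proof.
move=> cf e e0; have [d d0 H] := cf e e0; exists d => // x' xd; apply: H.
by rewrite complexB subrr complexr0 normc_real.
Qed.

Lemma ccont_lcontv f x y : ccont f (x +i* y) -> lcont (fun y => f (x +i* y)) y.
Proof.
move=> cf e e0; have [d d0 H] := cf e e0; exists d => // x' xd; apply: H.
by rewrite complexB subrr normc_imag.
Qed.

Definition bdry_cont f a b c d :=
  [/\ hline f a b c, hline f a b d, vline f c d a & vline f c d b].

Lemma on_rect_bdry f a b c d : a <= b -> c <= d -> on_rect (ccont f) a b c d ->
  bdry_cont f a b c d.
Proof.
move=> ab cd H; split => x xab.
- by apply: ccont_lconth; apply: H; rewrite ?lexx.
- by apply: ccont_lconth; apply: H; rewrite ?lexx ?cd.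
- by apply: ccont_lcontv; apply: H; rewrite ?lexx.
- by apply: ccont_lcontv; apply: H; rewrite ?lexx ?ab.
Qed.

Lemma rint_cutx f a m b c d : a <= m -> m <= b -> hline f a b c -> hline f a b d ->
  rint f a b c d = rint f a m c d + rint f m b c d.
Proof.
move=> am mb hc hd; rewrite /rint /hint (cint_split am mb); last exact: lcont_cintegrable.
rewrite (cint_split am mb (F := fun x => f (x +i* d))); last exact: lcont_cintegrable.
by ring.
Qed.

Lemma rint_cuty f a b c m d : c <= m -> m <= d -> vline f c d a -> vline f c d b ->
  rint f a b c d = rint f a b c m + rint f a b m d.
Proof.
move=> am mb hc hd; rewrite /rint /vint (cint_split am mb); last exact: lcont_cintegrable.
rewrite (cint_split am mb (F := fun y => f (a +i* y))); last exact: lcont_cintegrable.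
by ring.
Qed.

Lemma normc_i : normc ('i : R[i]) = 1.
Proof. by rewrite normc_imag normr1. Qed.

Lemma normc_rint_cst f a b c d M : a <= b -> c <= d -> bdry_cont f a b c d ->
  on_rect (fun z => normc (f z) <= M) a b c d ->
  normc (rint f a b c d) <= M * (2 * (b - a + (d - c))).
Proof.
move=> ab cd [hc hd va vb] H.
rewrite (le_trans (le_normcD _ _))// normcM normc_i mul1r.
have -> : M * (2 * (b - a + (d - c))) =
  (M * (b - a) + M * (b - a)) + (M * (d - c) + M * (d - c)) by ring.
apply: lerD; rewrite (le_trans (le_normcB _ _))// lerD// normc_cint_cst//;
  try exact: lcont_cintegrable.
all: by move=> t tab; apply: H; rewrite ?lexx ?ab ?cd.
Qed.

Lemma bdry_contB f g a b c d : bdry_cont f a b c d -> bdry_cont g a b c d ->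
  bdry_cont (fun z => f z - g z) a b c d.
Proof.
have H (F G : R -> R[i]) x : lcont F x -> lcont G x -> lcont (fun t => F t - G t) x.
  move=> cF cG e e0.
  have e20 : 0 < e / 2 by rewrite divr_gt0.
  have [d1 d10 H1] := cF _ e20; have [d2 d20 H2] := cG _ e20.
  exists (Num.min d1 d2); first by rewrite lt_min d10.
  move=> t; rewrite lt_min => /andP[t1 t2].
  have -> : F t - G t - (F x - G x) = (F t - F x) - (G t - G x) by ring.
  rewrite (le_lt_trans (le_normcB _ _))// [ltRHS]splitr ltrD//; [exact: H1|exact: H2].
by move=> [f1 f2 f3 f4] [g1 g2 g3 g4]; split => x xab; apply: H; auto.
Qed.

Lemma rintB f g a b c d : bdry_cont f a b c d -> bdry_cont g a b c d ->
  rint (fun z => f z - g z) a b c d = rint f a b c d - rint g a b c d.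
Proof.
move=> [f1 f2 f3 f4] [g1 g2 g3 g4].
rewrite /rint /hint /vint !cintB//; first by ring.
all: exact: lcont_cintegrable.
Qed.

Lemma rintZ (k : R[i]) f a b c d : bdry_cont f a b c d ->
  rint (fun z => k * f z) a b c d = k * rint f a b c d.
Proof.
move=> [f1 f2 f3 f4].
rewrite /rint /hint /vint !cintZ//; first by ring.
all: exact: lcont_cintegrable.
Qed.

Lemma eq_rint f g a b c d : a <= b -> c <= d ->
  (forall x y, a <= x <= b -> c <= y <= d ->
     [|| x == a, x == b, y == c | y == d] -> f (x +i* y) = g (x +i* y)) ->
  rint f a b c d = rint g a b c d.
Proof.
move=> ab cd H; rewrite /rint /hint /vint.
congr (_ - _ + 'i * (_ - _)); apply: eq_cint => t /=; rewrite in_itv/= => tab;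
  by apply: H; rewrite ?lexx ?ab ?cd ?eqxx ?orbT.
Qed.

Lemma ccont_affine (al be z0 : R[i]) z : ccont (fun w => al + be * (w - z0)) z.
Proof.
move=> e e0.
have K0 : 0 < 1 + normc be by rewrite ltr_pwDl// normc_ge0.
exists (e / (1 + normc be)); first by rewrite divr_gt0.
move=> w wz; have -> : al + be * (w - z0) - (al + be * (z - z0)) = be * (w - z) by ring.
rewrite normcM; move: wz; rewrite ltr_pdivlMr// mulrC => /le_lt_trans; apply.
by rewrite mulrC [leRHS]mulrC ler_wpM2r ?normc_ge0// lerDr.
Qed.

(** An affine function differs by a constant between opposite sides; the horizontal pair gives
    [- 'i * be] times the area, the vertical pair ['i * be] times the area. *)
Lemma rint_affine (al be z0 : R[i]) a b c d : a <= b -> c <= d ->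
  rint (fun w => al + be * (w - z0)) a b c d = 0.
Proof.
move=> ab cd; rewrite /rint /hint /vint.
have ih y : cintegrable mu `[a, b]%classic (fun x => al + be * (x +i* y - z0)).
  by apply: lcont_cintegrable => x _; apply: (ccont_lconth (f := fun w => al + be * (w - z0))); exact: ccont_affine.
have iv x : cintegrable mu `[c, d]%classic (fun y => al + be * (x +i* y - z0)).
  by apply: lcont_cintegrable => y _; apply: (ccont_lcontv (f := fun w => al + be * (w - z0))); exact: ccont_affine.
rewrite -!cintB//.
rewrite (eq_cint mu (G := fun=> be * (0 +i* (c - d)))); last first.
  by move=> x _; rewrite (_ : 0 +i* (c - d) = x +i* c - x +i* d); [ring|rewrite complexB subrr].
rewrite [X in _ + 'i * X](eq_cint mu (G := fun=> be * ((b - a) +i* 0))); last first.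
  by move=> x _; rewrite (_ : (b - a) +i* 0 = b +i* x - a +i* x); [ring|rewrite complexB subrr].
rewrite !cint_cst//; case: be {ih iv} => u v; simpc; apply/eqP; rewrite eq_complex/=.
by apply/andP; split; apply/eqP; ring.
Qed.

End rectangle_integral.

(** * Goursat's theorem on rectangles *)

Section goursat.
Variable R : realType.
Implicit Types (f g : R[i] -> R[i]) (a b c d x y e : R) (z w p L : R[i]).

Lemma small_half_pow (P d : R) : 0 < d -> exists n, P / 2 ^+ n < d.
Proof.
move=> d0; exists (Num.bound (P / d)); rewrite ltr_pdivrMr ?exprn_gt0// mulrC -ltr_pdivrMr//.
have [/lt_le_trans|P0] := ltP (P / d) 0; first by apply; rewrite exprn_ge0.
by rewrite (lt_trans (archi_boundP P0))// -natrX ltr_nat ltn_expl.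
Qed.

Definition subrect (a' b' c' d' a b c d : R) :=
  [/\ a <= a', a' <= b', b' <= b & [/\ c <= c', c' <= d' & d' <= d]].

Lemma subrect_trans (a' b' c' d' a b c d a'' b'' c'' d'' : R) :
  subrect a'' b'' c'' d'' a' b' c' d' -> subrect a' b' c' d' a b c d ->
  subrect a'' b'' c'' d'' a b c d.
Proof. by move=> [? ? ? [? ? ?]] [? ? ? [? ? ?]]; split; last split; lra. Qed.

Lemma subrect_refl a b c d : a <= b -> c <= d -> subrect a b c d a b c d.
Proof. by move=> ab cd; split=> //; split. Qed.

Lemma on_rectS (P : R[i] -> Prop) a' b' c' d' a b c d :
  subrect a' b' c' d' a b c d -> on_rect P a b c d -> on_rect P a' b' c' d'.
Proof.
move=> [? ? ? [? ? ?]] H x y /andP[? ?] /andP[? ?].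
by apply: H; apply/andP; split; lra.
Qed.

Lemma normcD4_lt (u1 u2 u3 u4 : R[i]) (x : R) : normc u1 < x / 4 -> normc u2 < x / 4 ->
  normc u3 < x / 4 -> normc u4 < x / 4 -> normc ((u1 + u2) + (u3 + u4)) < x.
Proof.
have := le_normcD (u1 + u2) (u3 + u4); have := le_normcD u1 u2; have := le_normcD u3 u4; lra.
Qed.

(** Cutting at both midpoints writes the integral as a sum of four; if each had modulus below a
    quarter of the whole, [normcD4_lt] would make the whole smaller than itself. *)
Lemma quarter_rect f a b c d : a <= b -> c <= d -> on_rect (ccont f) a b c d ->
  exists r : (R * R) * (R * R),
    [/\ subrect r.1.1 r.1.2 r.2.1 r.2.2 a b c d,
      r.1.2 - r.1.1 + (r.2.2 - r.2.1) = (b - a + (d - c)) / 2 &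
      normc (rint f a b c d) <= 4 * normc (rint f r.1.1 r.1.2 r.2.1 r.2.2)].
Proof.
move=> ab cd H.
set m := (a + b) / 2; set k := (c + d) / 2.
have [am mb] : a <= m /\ m <= b by rewrite /m; split; lra.
have [ck kd] : c <= k /\ k <= d by rewrite /k; split; lra.
have [h1 h2 _ _] := on_rect_bdry ab cd H.
have s1 : subrect a m c d a b c d by split=> //; split.
have s2 : subrect m b c d a b c d by split=> //; split.
have [_ _ v1 v2] := on_rect_bdry am cd (on_rectS s1 H).
have [_ _ v3 v4] := on_rect_bdry mb cd (on_rectS s2 H).
have E : rint f a b c d = (rint f a m c k + rint f a m k d) + (rint f m b c k + rint f m b k d).
  by rewrite (rint_cutx am mb)// (rint_cuty ck kd)// (rint_cuty ck kd v3).
apply: contrapT => N.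
have {}N a' b' c' d' : subrect a' b' c' d' a b c d ->
    b' - a' + (d' - c') = (b - a + (d - c)) / 2 ->
    normc (rint f a' b' c' d') < normc (rint f a b c d) / 4.
  move=> s e; rewrite ltNge; apply/negP => h; apply: N.
  exists ((a', b'), (c', d')); split => //=.
  by rewrite -ler_pdivrMl// mulrC.
have n0 : normc (rint f a m c k) < normc (rint f a b c d) / 4.
  by apply: N; [split=> //; split|rewrite /m /k; field].
have n1 : normc (rint f a m k d) < normc (rint f a b c d) / 4.
  by apply: N; [split=> //; split|rewrite /m /k; field].
have n2 : normc (rint f m b c k) < normc (rint f a b c d) / 4.
  by apply: N; [split=> //; split|rewrite /m /k; field].
have n3 : normc (rint f m b k d) < normc (rint f a b c d) / 4.
  by apply: N; [split=> //; split|rewrite /m /k; field].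
by have := normcD4_lt n0 n1 n2 n3; rewrite -E ltxx.
Qed.

(** Nested quartering: after [n] steps a rectangle of size of order [2 ^- n] keeps a share [4 ^- n]
    of the integral. Near the common point the integrand is affine up to a small multiple of the
    distance, and that error costs only diameter times perimeter, again of order [4 ^- n]. *)
Theorem goursat f a b c d : a <= b -> c <= d ->
  on_rect (fun z => derivable f z 1) a b c d -> rint f a b c d = 0.
Proof.
move=> ab cd H.
have Hc : on_rect (ccont f) a b c d by move=> x y hx hy; exact/derivable_ccont/H.
pose A (r : (R * R) * (R * R)) := r.1.1; pose B (r : (R * R) * (R * R)) := r.1.2.
pose C (r : (R * R) * (R * R)) := r.2.1; pose D (r : (R * R) * (R * R)) := r.2.2.
have /choice[g Hg] : forall r : (R * R) * (R * R), exists r' : (R * R) * (R * R),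
   subrect (A r) (B r) (C r) (D r) a b c d ->
    [/\ subrect (A r') (B r') (C r') (D r') (A r) (B r) (C r) (D r),
      B r' - A r' + (D r' - C r') = (B r - A r + (D r - C r)) / 2 &
      normc (rint f (A r) (B r) (C r) (D r)) <= 4 * normc (rint f (A r') (B r') (C r') (D r'))].
  move=> r; have [s|ns] := pselect (subrect (A r) (B r) (C r) (D r) a b c d); last by exists r.
  have [_ abr _ [_ cdr _]] := s.
  by have [r' Hr'] := quarter_rect abr cdr (on_rectS s Hc); exists r'.
pose r n := iter n g ((a, b), (c, d)).
pose P := b - a + (d - c).
have I n : [/\ subrect (A (r n)) (B (r n)) (C (r n)) (D (r n)) a b c d,
    B (r n) - A (r n) + (D (r n) - C (r n)) = P / 2 ^+ n &
    normc (rint f a b c d) <= 4 ^+ n * normc (rint f (A (r n)) (B (r n)) (C (r n)) (D (r n)))].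
  elim: n => [|n [s e i]].
    split; first exact: subrect_refl.
      by rewrite expr0 divr1.
    by rewrite expr0 mul1r.
  have [s' e' i'] := Hg _ s; split.
  - exact: subrect_trans s' s.
  - by rewrite /r iterS e' -/(r n) e exprS invfM mulrA mulrAC.
  - by rewrite (le_trans i)// exprSr -mulrA ler_wpM2l ?exprn_ge0.
have S n m : (n <= m)%N -> subrect (A (r m)) (B (r m)) (C (r m)) (D (r m))
    (A (r n)) (B (r n)) (C (r n)) (D (r n)).
  elim: m => [|m IH]; first by rewrite leqn0 => /eqP ->; have [[? ? ? [? ? ?]] _ _] := I 0%N; split=> //; split.
  rewrite leq_eqVlt => /predU1P[->|]; first by have [[_ ? _ [_ ? _]] _ _] := I m.+1; exact: subrect_refl.
  rewrite ltnS => /IH h; have [s _ _] := I m; have [s' _ _] := Hg _ s.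
  exact: subrect_trans s' h.
have AB n m : A (r n) <= B (r m).
  have [nm|/ltnW mn] := leqP n m; first by have [? ? _ _] := S _ _ nm; lra.
  by have [_ ? ? _] := S _ _ mn; lra.
have CD n m : C (r n) <= D (r m).
  have [nm|/ltnW mn] := leqP n m; first by have [_ _ _ [? ? _]] := S _ _ nm; lra.
  by have [_ _ _ [_ ? ?]] := S _ _ mn; lra.
(* Every lower end lies below every upper end, so the supremum of the lower ends lies in all the
   intervals; this yields the common point of the rectangles. *)
have sups (u v : nat -> R) : (forall n m, u n <= v m) ->
    exists q : R, forall n, u n <= q <= v n.
  move=> uv; exists (sup (range u)) => n; apply/andP; split.
    apply: ub_le_sup; last by exists n.
    by exists (v 0%N) => _ [m _ <-].
  by apply: ge_sup; [exists (u 0%N); exists 0%N|move=> _ [m _ <-]].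
have [px Hpx] := sups _ _ AB; have [py Hpy] := sups _ _ CD.
have Hp : derivable f (px +i* py) 1 by apply: H; [exact: (Hpx 0%N)|exact: (Hpy 0%N)].
have [L HL] : exists L, hasder f (px +i* py) L by exact/derivableE.
have P0 : 0 <= P by rewrite /P; lra.
apply/eqP; rewrite -normc_eq0; apply/eqP/le_anti; rewrite normc_ge0 andbT.
apply/ler_addgt0Pr => e e0; rewrite add0r.
(* With this constant the final bound becomes [e * (P ^+ 2 / (P ^+ 2 + 1))], at most [e]; the [+ 1]
   covers a rectangle reduced to a point. *)
have e'0 : 0 < e / (2 * (P ^+ 2 + 1)) by rewrite divr_gt0// mulr_gt0// ltr_wpDl// exprn_ge0.
have [dd dd0 Hd] := HL _ e'0.
have [n nd] := small_half_pow P dd0.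
have [s eP i] := I n.
have [_ ab' _ [_ cd' _]] := s.
rewrite (le_trans i)//.
set an := A _ in s eP i ab' *; set bn := B _ in s eP i ab' *.
set cn := C _ in s eP i cd' *; set dn := D _ in s eP i cd' *.
(* The affine part of [f] at the common point has zero contour integral and may be subtracted. *)
pose h z := f z - (f (px +i* py) + L * (z - (px +i* py))).
have cf := on_rect_bdry ab' cd' (on_rectS s Hc).
have ca : bdry_cont (fun z => f (px +i* py) + L * (z - (px +i* py))) an bn cn dn.
  by apply: on_rect_bdry => // x y _ _; exact: ccont_affine.
have -> : rint f an bn cn dn = rint h an bn cn dn.
  by rewrite /h rintB// rint_affine// subr0.
have hb : on_rect (fun z => normc (h z) <= e / (2 * (P ^+ 2 + 1)) * (P / 2 ^+ n)) an bn cn dn.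
  move=> x y hx hy.
  have dist : normc (x +i* y - (px +i* py)) <= P / 2 ^+ n.
    rewrite complexB (le_trans (le_normc_ReIm _))//= -eP.
    have := Hpx n; have := Hpy n; rewrite -/an -/bn -/cn -/dn => /andP[? ?] /andP[? ?].
    move: hx hy => /andP[? ?] /andP[? ?].
    by rewrite lerD// ler_norml; apply/andP; split; lra.
  rewrite /h opprD addrA (le_trans (Hd _ _))//; first exact: le_lt_trans nd.
  by rewrite ler_wpM2l// ltW.
have := normc_rint_cst ab' cd' (bdry_contB cf ca) hb; rewrite -/h eP => h1.
rewrite (le_trans (ler_wpM2l _ h1)) ?exprn_ge0//.
have -> : 4 ^+ n * (e / (2 * (P ^+ 2 + 1)) * (P / 2 ^+ n) * (2 * (P / 2 ^+ n))) =
  e * (P ^+ 2 / (P ^+ 2 + 1)).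
  rewrite (_ : 4 = 2 * 2 :> R); last by ring.
  rewrite exprMn; field; rewrite expf_neq0 ?pnatr_eq0//= gt_eqF// ltr_wpDl// exprn_ge0//.
by rewrite ler_piMr ?(ltW e0)// ler_pdivrMr ?mul1r ?lerDl// ltr_wpDl// exprn_ge0.
Qed.

End goursat.

(** * Cauchy's formula: isolating the singularity and integrating the kernel *)

Section cauchy_formula.
Variable R : realType.
Implicit Types (f g : R[i] -> R[i]) (a b c d x y e : R) (z w p L : R[i]).
Notation mu := (@lebesgue_measure R).

(** [z] keeps the margin [rho] from all four sides; on the boundary the kernel [(w - z)^-1] is then
    bounded by [rho^-1]. *)
Definition in_rect (rho : R) z a b c d :=
  [/\ a + rho <= complex.Re z, complex.Re z <= b - rho,
      c + rho <= complex.Im z & complex.Im z <= d - rho].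

Lemma derivable_inv_sub z w : w != z -> derivable (fun w => (w - z)^-1) w 1.
Proof.
move=> wz; apply: (@derivableV _ _ (fun w => w - z)); first by rewrite subr_eq0.
apply: derivableB; [exact: derivable_id|exact: derivable_cst].
Qed.

(** Two vertical and two horizontal cuts around the square of half-side [rho] leave four outer
    rectangles free of [z], where Goursat's theorem applies. *)
Lemma rint_shrink f z rho a b c d : 0 < rho -> in_rect rho z a b c d ->
  on_rect (fun w => w != z -> derivable f w 1) a b c d ->
  rint f a b c d = rint f (complex.Re z - rho) (complex.Re z + rho)
                          (complex.Im z - rho) (complex.Im z + rho).
Proof.
case: z => zx zy rho0 [/= z1 z2 z3 z4] H.
have H' x y : a <= x <= b -> c <= y <= d -> (x != zx) || (y != zy) ->
    derivable f (x +i* y) 1.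
  by move=> hx hy hxy; apply: H => //; rewrite eq_complex/= negb_and.
have Hc x y : a <= x <= b -> c <= y <= d -> (x != zx) || (y != zy) -> ccont f (x +i* y).
  by move=> ? ? ?; apply: derivable_ccont; exact: H'.
have hl a' b' y : a <= a' -> b' <= b -> c <= y <= d -> y != zy -> hline f a' b' y.
  move=> aa bb hy yz x /andP[? ?]; apply: ccont_lconth; apply: Hc; rewrite ?yz ?orbT//.
  by apply/andP; split; lra.
have vl c' d' x : c <= c' -> d' <= d -> a <= x <= b -> x != zx -> vline f c' d' x.
  move=> aa bb hy yz y /andP[? ?]; apply: ccont_lcontv; apply: Hc; rewrite ?yz//.
  by apply/andP; split; lra.
have G a' b' c' d' : a <= a' -> a' <= b' -> b' <= b -> c <= c' -> c' <= d' -> d' <= d ->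
    [|| b' < zx, zx < a', d' < zy | zy < c'] -> rint f a' b' c' d' = 0.
  move=> ? ? ? ? ? ? Hn; apply: goursat => // x y /andP[? ?] /andP[? ?]; apply: H';
    try by apply/andP; split; lra.
  by rewrite -negb_and; apply/negP => /andP[/eqP ? /eqP ?]; case/or4P : Hn => ?; lra.
have [e1 e2 e3] : [/\ a <= zx - rho, zx - rho <= zx + rho & zx + rho <= b] by split; lra.
have [e4 e5 e6] : [/\ c <= zy - rho, zy - rho <= zy + rho & zy + rho <= d] by split; lra.
have [cd1 cd2] : c <= c <= d /\ c <= d <= d by split; apply/andP; split; lra.
have [x1 x2] : a <= zx - rho <= b /\ a <= zx + rho <= b by split; apply/andP; split; lra.
have [n1 n2] : c != zy /\ d != zy by rewrite lt_eqF ?gt_eqF; [|lra|lra].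
have [n3 n4] : zx - rho != zx /\ zx + rho != zx by rewrite lt_eqF ?gt_eqF; [|lra|lra].
rewrite (rint_cutx e1 (le_trans e2 e3)) ?(rint_cutx e2 e3); try exact: hl.
rewrite (@rint_cuty _ f (zx - rho) (zx + rho) _ _ _ e4 (le_trans e5 e6)); try exact: vl.
rewrite (@rint_cuty _ f (zx - rho) (zx + rho) _ _ _ e5 e6); try exact: vl.
have Z1 : rint f a (zx - rho) c d = 0 by apply: G; try lra; rewrite (_ : zx - rho < zx)//; lra.
have Z2 : rint f (zx + rho) b c d = 0 by apply: G; try lra; rewrite (_ : zx < zx + rho) ?orbT//; lra.
have Z3 : rint f (zx - rho) (zx + rho) c (zy - rho) = 0.
  by apply: G; try lra; rewrite (_ : zy - rho < zy) ?orbT//; lra.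
have Z4 : rint f (zx - rho) (zx + rho) (zy + rho) d = 0.
  by apply: G; try lra; rewrite (_ : zy < zy + rho) ?orbT//; lra.
by rewrite Z1 Z2 Z3 Z4 !addr0 !add0r.
Qed.

(** After shrinking to a small square of half-side [s] around [z], the integrand is bounded by
    [normc (f z) + 1] and the perimeter is [8 * s], so the integral is as small as desired. *)
Lemma rint_removable f z a b c d : a < complex.Re z < b -> c < complex.Im z < d ->
  on_rect (ccont f) a b c d ->
  on_rect (fun w => w != z -> derivable f w 1) a b c d -> rint f a b c d = 0.
Proof.
move=> /andP[z1 z2] /andP[z3 z4] Hc H.
pose t := Num.min (Num.min (complex.Re z - a) (b - complex.Re z))
                  (Num.min (complex.Im z - c) (d - complex.Im z)).
have t0 : 0 < t by rewrite !lt_min !subr_gt0 z1 z2 z3 z4.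
have [t1 t2 t3 t4] : [/\ t <= complex.Re z - a, t <= b - complex.Re z,
    t <= complex.Im z - c & t <= d - complex.Im z].
  by split; rewrite !ge_min lexx ?orbT.
clearbody t.
have cz : ccont f z.
  by rewrite -(complex_eta z); apply: Hc; rewrite ?(ltW z1) ?(ltW z2) ?(ltW z3) ?(ltW z4).
have [r r0 Hr] := cz _ ltr01.
have K0 : 0 < 8 * (normc (f z) + 1) by rewrite mulr_gt0// ltr_wpDl// normc_ge0.
apply/eqP; rewrite -normc_eq0; apply/eqP/le_anti; rewrite normc_ge0 andbT.
apply/ler_addgt0Pr => e e0; rewrite add0r.
pose s := Num.min (Num.min t (r / 4)) (e / (8 * (normc (f z) + 1))).
have s0 : 0 < s by rewrite !lt_min t0 !divr_gt0.
have [st sr se] : [/\ s <= t, s <= r / 4 & s <= e / (8 * (normc (f z) + 1))].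
  by split; rewrite !ge_min lexx ?orbT.
clearbody s.
rewrite (@rint_shrink f z s)//; last by split; lra.
set a' := _ - s; set b' := _ + s; set c' := _ - s; set d' := _ + s.
have ab' : a' <= b' by rewrite /a' /b'; lra.
have cd' : c' <= d' by rewrite /c' /d'; lra.
have S : subrect a' b' c' d' a b c d by rewrite /a' /b' /c' /d'; split; last split; lra.
apply: (@le_trans _ _ ((normc (f z) + 1) * (2 * (b' - a' + (d' - c'))))).
  apply: normc_rint_cst => //; first exact/on_rect_bdry/(on_rectS S Hc).
  rewrite /a' /b' /c' /d' => x y /andP[? ?] /andP[? ?].
  rewrite -lerBlDl (le_trans (le_normc_dist _ _))//; apply/ltW/Hr.
  rewrite -[X in _ - X]complex_eta complexB (le_lt_trans (le_normc_ReIm _))//=.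
  have h1 : `|x - complex.Re z| <= s by rewrite ler_norml; apply/andP; split; lra.
  have h2 : `|y - complex.Im z| <= s by rewrite ler_norml; apply/andP; split; lra.
  by lra.
move: se; rewrite ler_pdivlMr// => se; apply: le_trans se.
by rewrite /a' /b' /c' /d'; lra.
Qed.

(** The primitive [atan ((x - x0) / s)] runs from [- pi / 4] to [pi / 4]. Up to a constant factor,
    this is the contribution of a pair of opposite sides of a square to the contour integral of the
    Cauchy kernel. *)
Lemma integral_atan (x0 s : R) : 0 < s ->
  \int[mu]_(x in `[x0 - s, x0 + s]%classic) (s / ((x - x0) ^+ 2 + s ^+ 2)) = pi / 2.
Proof.
move=> s0.
have p x : 0 < (x - x0) ^+ 2 + s ^+ 2 by rewrite ltr_wpDl ?sqr_ge0// exprn_gt0.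
have D x : is_derive x (1:R) (fun x => atan ((x - x0) / s)) (s / ((x - x0) ^+ 2 + s ^+ 2)).
  have -> : s / ((x - x0) ^+ 2 + s ^+ 2) = (1 + ((x - x0) / s) ^+ 2)^-1 * s^-1.
    have pn := p x; have s1 : s != 0 by rewrite gt_eqF.
    have -> : 1 + ((x - x0) / s) ^+ 2 = ((x - x0) ^+ 2 + s ^+ 2) / s ^+ 2 by field.
    rewrite invfM invrK; move: (_ + s ^+ 2) pn => P /gt_eqF Pn.
    by field; rewrite ?s1 ?Pn.
  have D1 : is_derive x (1:R) (fun x => (x - x0) / s) s^-1.
    have -> : (fun x => (x - x0) / s) = (fun x : R => s^-1 *: (x - x0)).
      by apply/funext => t /=; rewrite mulrC.
    have := is_deriveZ s^-1 (is_deriveB (is_derive_id x 1) (is_derive_cst x0 x 1)).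
    by rewrite subr0 /GRing.scale/= mulr1.
  exact: (@is_derive1_comp _ atan (fun x => (x - x0) / s)).
rewrite /Rintegral (@continuous_FTC2 _ _ (fun x => atan ((x - x0) / s))) //=.
- rewrite addrAC subrr add0r addrAC subrr add0r mulNr divff ?gt_eqF// atanN atan1; lra.
- lra.
- apply: continuous_in_subspaceT => x _.
  apply: cvgM; first exact: cvg_cst.
  apply: cvgV; first by rewrite gt_eqF.
  apply: cvgD; last exact: cvg_cst.
  by rewrite expr2; apply: cvgM; apply: cvgB; [exact: cvg_id|exact: cvg_cst| exact: cvg_id|exact: cvg_cst].
- split.
  + by move=> x _; have [] := D x.
  + apply: cvg_at_right_filter; apply: differentiable_continuous; apply/derivable1_diffP; by have [] := D (x0 - s).
  + apply: cvg_at_left_filter; apply: differentiable_continuous; apply/derivable1_diffP; by have [] := D (x0 + s).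
- by move=> x _; rewrite derive1E; have [] := D x.
Qed.
End cauchy_formula.

Section cauchy_estimates.
Variable R : realType.
Implicit Types (f g : R[i] -> R[i]) (a b c d x y e rho : R) (z w p L : R[i]).
Notation mu := (@lebesgue_measure R).

Definition on_bdry (P : R[i] -> Prop) a b c d :=
  forall x y, a <= x <= b -> c <= y <= d ->
    [|| x == a, x == b, y == c | y == d] -> P (x +i* y).

Lemma on_rect_on_bdry (P : R[i] -> Prop) a b c d : on_rect P a b c d -> on_bdry P a b c d.
Proof. by move=> H x y hx hy _; exact: H. Qed.

Lemma on_bdry_cont f a b c d : a <= b -> c <= d -> on_bdry (ccont f) a b c d ->
  bdry_cont f a b c d.
Proof.
move=> ab cd H; split => x xab.
- by apply: ccont_lconth; apply: H; rewrite ?lexx ?eqxx ?orbT.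
- by apply: ccont_lconth; apply: H; rewrite ?lexx ?cd ?eqxx ?orbT.
- by apply: ccont_lcontv; apply: H; rewrite ?lexx ?eqxx ?orbT.
- by apply: ccont_lcontv; apply: H; rewrite ?lexx ?ab ?eqxx ?orbT.
Qed.

Lemma on_bdry_derivable f a b c d : a <= b -> c <= d ->
  on_bdry (fun z => derivable f z 1) a b c d -> bdry_cont f a b c d.
Proof.
move=> ab cd H; apply: on_bdry_cont => // x y hx hy hb.
by apply: derivable_ccont; exact: H.
Qed.

Lemma in_rect_bdry rho z a b c d : 0 < rho -> in_rect rho z a b c d ->
  on_bdry (fun w => rho <= normc (w - z)) a b c d.
Proof.
case: z => zx zy rho0 [/= z1 z2 z3 z4] x y hx hy hb; rewrite complexB.
have hR := le_normr_Re ((x - zx) +i* (y - zy)); have hI := le_normr_Im ((x - zx) +i* (y - zy)).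
move: hR hI; rewrite /complex.Re /complex.Im.
case/or4P : hb => /eqP e hR hI; [apply: le_trans hR|apply: le_trans hR|apply: le_trans hI|apply: le_trans hI];
  rewrite ler_normr; apply/orP; by [left; lra|right; lra].
Qed.

Lemma in_rect_le rho z a b c d : 0 < rho -> in_rect rho z a b c d -> a <= b /\ c <= d.
Proof. by move=> ? [? ? ? ?]; split; lra. Qed.

Definition two_pi_i : R[i] := 0 +i* (2 * pi).

Lemma normc_two_pi_i : 1 <= normc two_pi_i.
Proof.
rewrite normc_imag ger0_norm ?mulr_ge0 ?pi_ge0//.
by have := @pi_ge2 R; lra.
Qed.

Lemma two_pi_i_neq0 : two_pi_i != 0.
Proof. by rewrite -normc_gt0 (lt_le_trans _ normc_two_pi_i). Qed.

Lemma cint_real (D : set R) (g : R -> R) :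
  cint mu D (fun x => (g x)%:C) = (\int[mu]_(x in D) g x)%:C.
Proof.
by rewrite /cint /=; congr (_ +i* _); rewrite /Rintegral integral0.
Qed.

Lemma bdry_cont_inv rho z a b c d : 0 < rho -> in_rect rho z a b c d ->
  bdry_cont (fun w => (w - z)^-1) a b c d.
Proof.
move=> rho0 hz; have [ab cd] := in_rect_le rho0 hz.
apply: (on_bdry_derivable ab cd) => x y hx hy hb; apply: derivable_inv_sub.
have := in_rect_bdry rho0 hz hx hy hb; apply: contraTneq => ->.
by rewrite subrr normc0 -ltNge.
Qed.

Lemma inv_conj_sub (u s : R) : s != 0 ->
  (u +i* - s)^-1 - (u +i* s)^-1 = (0 +i* 2) * (s / (u ^+ 2 + s ^+ 2))%:C.
Proof.
move=> s0; have P0 : u ^+ 2 + s ^+ 2 != 0.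
  by rewrite gt_eqF// ltr_wpDl ?sqr_ge0// lt_neqAle eq_sym sqrf_eq0 s0 sqr_ge0.
apply/eqP; rewrite eq_complex; apply/andP; split; apply/eqP => /=; rewrite sqrrN; field;
  by rewrite ?P0.
Qed.

Lemma inv_neg_sub (s v : R) : s != 0 ->
  (s +i* v)^-1 - (- s +i* v)^-1 = 2 * (s / (v ^+ 2 + s ^+ 2))%:C.
Proof.
move=> s0; have P0 : s ^+ 2 + v ^+ 2 != 0.
  by rewrite gt_eqF// ltr_wpDr ?sqr_ge0// lt_neqAle eq_sym sqrf_eq0 s0 sqr_ge0.
have P1 : v ^+ 2 + s ^+ 2 != 0 by rewrite addrC.
by apply/eqP; rewrite eq_complex; apply/andP; split; apply/eqP => /=; rewrite ?sqrrN; field;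
  rewrite ?P0 ?P1.
Qed.

(** Taken together, opposite sides turn the kernel into a constant times [s / (u ^+ 2 + s ^+ 2)],
    whose integral is [pi / 2]; each pair then contributes ['i * pi]. *)
Lemma rint_inv_square z s : 0 < s ->
  rint (fun w => (w - z)^-1) (complex.Re z - s) (complex.Re z + s)
     (complex.Im z - s) (complex.Im z + s) = two_pi_i.
Proof.
case: z => zx zy /= s0; have s1 : s != 0 by rewrite gt_eqF.
have hz : in_rect s (zx +i* zy) (zx - s) (zx + s) (zy - s) (zy + s).
  by split => /=; lra.
have [h1 h2 v1 v2] := bdry_cont_inv s0 hz.
have Z (k : R[i]) (x0 : R) (F : R -> R[i]) : k != 0 ->
  cintegrable mu `[x0 - s, x0 + s]%classic F ->
  (forall x, F x = k * (s / ((x - x0) ^+ 2 + s ^+ 2))%:C) ->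
  cint mu `[x0 - s, x0 + s]%classic F = k * (pi / 2)%:C.
  move=> k0 iF HF; rewrite (eq_cint mu (G := fun x => k * (s / ((x - x0) ^+ 2 + s ^+ 2))%:C))//.
  rewrite cintZ ?cint_real ?integral_atan//.
  apply: eq_cintegrable (cintegrableZ k^-1 _ iF) => // x _.
  by rewrite HF mulKf.
rewrite /rint /hint /vint -!cintB//; try exact: lcont_cintegrable.
rewrite (Z (0 +i* 2)); last 3 first.
- by apply/eqP => -[] /eqP; rewrite pnatr_eq0.
- by apply: cintegrableB => //; exact: lcont_cintegrable.
- move=> x; rewrite !complexB -inv_conj_sub//.
  by congr ((_ +i* _)^-1 - (_ +i* _)^-1); ring.
rewrite (Z 2); last 3 first.
- by rewrite pnatr_eq0.
- by apply: cintegrableB => //; exact: lcont_cintegrable.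
- move=> x; rewrite !complexB -inv_neg_sub//.
  by congr ((_ +i* _)^-1 - (_ +i* _)^-1); ring.
by apply/eqP; rewrite eq_complex/=; apply/andP; split; apply/eqP; field.
Qed.

Lemma rint_inv rho z a b c d : 0 < rho -> in_rect rho z a b c d ->
  rint (fun w => (w - z)^-1) a b c d = two_pi_i.
Proof.
move=> rho0 hz; rewrite (rint_shrink rho0 hz) ?rint_inv_square//.
by move=> x y _ _; exact: derivable_inv_sub.
Qed.

Theorem cauchy_formula f rho z a b c d : 0 < rho -> in_rect rho z a b c d ->
  on_rect (fun w => derivable f w 1) a b c d ->
  rint (fun w => f w * (w - z)^-1) a b c d = two_pi_i * f z.
Proof.
move=> rho0 hz H; have [ab cd] := in_rect_le rho0 hz.
have [z1 z2 z3 z4] := hz.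
have dz : derivable f z 1.
  by rewrite -(complex_eta z); apply: H; apply/andP; split; lra.
have [L HL] : exists L, hasder f z L by exact/derivableE.
(* The difference quotient, completed by the derivative at [z], is continuous on the rectangle and
   derivable off [z], so its contour integral vanishes. *)
pose g w := if w == z then L else (f w - f z) * (w - z)^-1.
have dg w : derivable f w 1 -> w != z -> derivable g w 1.
  move=> dw wz.
  have n0 : 0 < normc (w - z) by rewrite normc_gt0 subr_eq0.
  have E : {near w, (fun v => (f v - f z) * (v - z)^-1) =1 g}.
    apply/nbhs_complexP; exists (normc (w - z)) => // v vw.
    by rewrite /g ifF//; apply: contraTF vw => /eqP ->; rewrite normcB ltxx.
  apply: (near_eq_derivable E).
  apply: derivableM; last exact: derivable_inv_sub.
  by apply: derivableB; [exact: dw|exact: derivable_cst].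
have cg : ccont g z.
  move=> e e0; have e20 : 0 < e / 2 by rewrite divr_gt0.
  have [r r0 Hr] := HL _ e20.
  exists r => // w wz; rewrite /g eqxx; case: eqVneq => [_|wz0].
    by rewrite subrr normc0.
  have w0 : w - z != 0 by rewrite subr_eq0.
  have -> : (f w - f z) * (w - z)^-1 - L = (f w - f z - L * (w - z)) / (w - z).
    by rewrite [RHS]mulrBl mulfK.
  rewrite normcM normcV ltr_pdivrMr ?normc_gt0// (le_lt_trans (Hr _ wz))//.
  by rewrite ltr_pM2r ?normc_gt0//; lra.
have G0 : rint g a b c d = 0.
  apply: (@rint_removable _ g z); try by apply/andP; split; lra.
    move=> x y hx hy; have [->//|n] := eqVneq (x +i* y) z.
    exact: (derivable_ccont (dg _ (H _ _ hx hy) n)).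
  by move=> x y hx hy n; exact: (dg _ (H _ _ hx hy) n).
have nz w : (rho <= normc (w - z)) -> w != z.
  by apply: contraTneq => ->; rewrite subrr normc0 -ltNge.
have bi := bdry_cont_inv rho0 hz.
have bf : bdry_cont (fun w => f w * (w - z)^-1) a b c d.
  apply: (on_bdry_derivable ab cd) => x y hx hy hb; apply: derivableM; first exact: H.
  by apply: derivable_inv_sub; apply: nz; exact: (in_rect_bdry rho0 hz).
have bz : bdry_cont (fun w => f z * (w - z)^-1) a b c d.
  apply: (on_bdry_derivable ab cd) => x y hx hy hb; apply: derivableM; first exact: derivable_cst.
  by apply: derivable_inv_sub; apply: nz; exact: (in_rect_bdry rho0 hz).
apply/eqP; rewrite -subr_eq0 -(rint_inv rho0 hz) mulrC -rintZ// -rintB// -G0; apply/eqP.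
apply: eq_rint => // x y hx hy hb; rewrite /g ifF ?mulrBl//.
by apply/negbTE/nz; exact: (in_rect_bdry rho0 hz).
Qed.

End cauchy_estimates.

(** * Cauchy estimates for values, increments and Taylor remainders *)

Section cauchy_bounds.
Variable R : realType.
Implicit Types (f g k : R[i] -> R[i]) (a b c d x y e rho K : R) (z w p L : R[i]).
Notation mu := (@lebesgue_measure R).

(** The bounds use the [L^1] norm on the boundary, not the supremum, because averaging over the
    position of the sides controls the former by an area integral. *)
Definition bdry_norm f a b c d : R :=
  (\int[mu]_(x in `[a, b]%classic) normc (f (x +i* c)) +
   \int[mu]_(x in `[a, b]%classic) normc (f (x +i* d))) +
  (\int[mu]_(y in `[c, d]%classic) normc (f (b +i* y)) +
   \int[mu]_(y in `[c, d]%classic) normc (f (a +i* y))).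

Lemma normc_rint_le f k a b c d K : a <= b -> c <= d ->
  bdry_cont f a b c d -> bdry_cont k a b c d ->
  on_bdry (fun w => normc (k w) <= K * normc (f w)) a b c d ->
  normc (rint k a b c d) <= K * bdry_norm f a b c d.
Proof.
move=> ab cd [f1 f2 f3 f4] [k1 k2 k3 k4] H.
have S (u v : R) (F G : R -> R[i]) : (forall t, u <= t <= v -> lcont F t) ->
    (forall t, u <= t <= v -> lcont G t) ->
    (forall t, u <= t <= v -> normc (G t) <= K * normc (F t)) ->
    normc (cint mu `[u, v]%classic G) <= K * \int[mu]_(x in `[u, v]%classic) normc (F x).
  move=> cF cG GF.
  have iF : mu.-integrable `[u, v]%classic (EFin \o (fun x => normc (F x))).
    by apply: cintegrable_norm => //; exact: lcont_cintegrable.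
  have iG := lcont_cintegrable cG.
  rewrite (le_trans (normc_cint _ iG))// -RintegralZl//.
  apply: le_Rintegral => //; first exact: cintegrable_norm.
  by apply: eq_integrable (integrableZl _ K iF).
rewrite (le_trans (le_normcD _ _))// normcM normc_i mul1r mulrDr.
apply: lerD; rewrite (le_trans (le_normcB _ _))// mulrDr; apply: lerD; apply: S => // t ht;
  apply: H; by rewrite ?lexx ?ab ?cd ?eqxx ?orbT.
Qed.

Lemma normc_rint_kernel f k a b c d K : a <= b -> c <= d ->
  on_bdry (fun w => derivable f w 1) a b c d ->
  on_bdry (fun w => derivable k w 1) a b c d ->
  on_bdry (fun w => normc (k w) <= K) a b c d ->
  normc (rint (fun w => f w * k w) a b c d) <= K * bdry_norm f a b c d.
Proof.
move=> ab cd df dk kK; apply: normc_rint_le; [by []|by []|exact: on_bdry_derivable| |].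
- apply: (on_bdry_derivable ab cd) => x y hx hy hb.
  by apply: derivableM; [exact: df|exact: dk].
- move=> x y hx hy hb; rewrite normcM mulrC ler_wpM2r ?normc_ge0//; exact: kK.
Qed.

Lemma in_rect_neq rho z a b c d : 0 < rho -> in_rect rho z a b c d ->
  on_bdry (fun w => w != z) a b c d.
Proof.
move=> rho0 hz x y hx hy hb; have := in_rect_bdry rho0 hz hx hy hb.
by apply: contraTneq => ->; rewrite subrr normc0 -ltNge.
Qed.

Lemma normc_inv_le rho z w : 0 < rho -> rho <= normc (w - z) ->
  normc (w - z)^-1 <= rho^-1.
Proof.
by move=> rho0 h; rewrite normcV lef_pV2// posrE// (lt_le_trans rho0).
Qed.

Lemma le_two_pi_i z K : normc (two_pi_i R * z) <= K -> normc z <= K.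
Proof.
apply: le_trans; rewrite normcM ler_peMl ?normc_ge0//; exact: normc_two_pi_i.
Qed.

Section bounds.
Variables (f : R[i] -> R[i]) (rho a b c d : R).
Hypothesis rho0 : 0 < rho.
Hypothesis df : on_rect (fun w => derivable f w 1) a b c d.

Let dfb := on_rect_on_bdry df.

Let derivable_inv z : in_rect rho z a b c d ->
  on_bdry (fun w => derivable (fun w => (w - z)^-1) w 1) a b c d.
Proof. by move=> hz x y hx hy hb; apply: derivable_inv_sub; exact: (in_rect_neq rho0 hz). Qed.

Lemma cauchy_bound z : in_rect rho z a b c d ->
  normc (f z) <= rho^-1 * bdry_norm f a b c d.
Proof.
move=> hz; have [ab cd] := in_rect_le rho0 hz.
apply: le_two_pi_i; rewrite -(cauchy_formula rho0 hz df).
apply: (normc_rint_kernel ab cd dfb (derivable_inv hz)) => x y hx hy hb.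
by apply: normc_inv_le => //; exact: (in_rect_bdry rho0 hz).
Qed.

Lemma cauchy_bound_dist z z0 : in_rect rho z a b c d -> in_rect rho z0 a b c d ->
  normc (f z - f z0) <= normc (z - z0) * rho^-1 ^+ 2 * bdry_norm f a b c d.
Proof.
move=> hz hz0; have [ab cd] := in_rect_le rho0 hz.
apply: le_two_pi_i; rewrite mulrBr -(cauchy_formula rho0 hz df) -(cauchy_formula rho0 hz0 df).
have B v : in_rect rho v a b c d -> bdry_cont (fun w => f w * (w - v)^-1) a b c d.
  move=> hv; apply: (on_bdry_derivable ab cd) => x y hx hy hb.
  by apply: derivableM; [exact: dfb|exact: (derivable_inv hv)].
rewrite -rintB; [|exact: B|exact: B].
rewrite (@eq_rint _ _ (fun w => f w * ((w - z)^-1 - (w - z0)^-1)))//; last first.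
  by move=> *; rewrite mulrBr.
apply: (normc_rint_kernel ab cd dfb).
  by move=> x y hx hy hb; apply: derivableB; [exact: (derivable_inv hz)|exact: (derivable_inv hz0)].
move=> x y hx hy hb; set w := x +i* y.
have n1 : w - z != 0 by rewrite subr_eq0; exact: (in_rect_neq rho0 hz).
have n2 : w - z0 != 0 by rewrite subr_eq0; exact: (in_rect_neq rho0 hz0).
have -> : (w - z)^-1 - (w - z0)^-1 = (z - z0) * ((w - z)^-1 * (w - z0)^-1).
  by field; rewrite n1 n2.
rewrite normcM ler_wpM2l ?normc_ge0// normcM expr2 ler_pM ?normc_ge0//;
  apply: normc_inv_le => //; [exact: (in_rect_bdry rho0 hz)|exact: (in_rect_bdry rho0 hz0)].
Qed.

(** Second-order expansion of the kernel. The quadratic remainder depends on [f] only through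
    [bdry_norm], which is what lets analyticity pass to limits. The first-order coefficient is the
    Cauchy integral [D], identified with [L] by uniqueness of the derivative. *)
Lemma cauchy_bound_taylor z0 L : in_rect rho z0 a b c d -> hasder f z0 L ->
  normc L <= rho^-1 ^+ 2 * bdry_norm f a b c d /\
  forall z, in_rect rho z a b c d ->
    normc (f z - f z0 - L * (z - z0)) <=
      normc (z - z0) ^+ 2 * rho^-1 ^+ 3 * bdry_norm f a b c d.
Proof.
move=> hz0 HL; have [ab cd] := in_rect_le rho0 hz0.
have [z1 z2 z3 z4] := hz0.
pose D := (two_pi_i R)^-1 * rint (fun w => f w * ((w - z0)^-1 * (w - z0)^-1)) a b c d.
have B v : on_bdry (fun w => w != v) a b c d -> bdry_cont (fun w => f w * (w - v)^-1) a b c d.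
  move=> hv; apply: (on_bdry_derivable ab cd) => x y hx hy hb.
  by apply: derivableM; [exact: dfb|apply: derivable_inv_sub; exact: hv].
have dk2 : on_bdry (fun w => derivable (fun w => (w - z0)^-1 * (w - z0)^-1) w 1) a b c d.
  by move=> x y hx hy hb; apply: derivableM; exact: (derivable_inv hz0).
have B2 : bdry_cont (fun w => f w * ((w - z0)^-1 * (w - z0)^-1)) a b c d.
  apply: (on_bdry_derivable ab cd) => x y hx hy hb.
  by apply: derivableM; [exact: dfb|exact: dk2].
(* The margin [r] of [z] is kept apart from the margin [rho] of [z0]: points within [rho / 2] of
   [z0] are only sure of the margin [rho / 2], and these serve to identify [D]; the final estimate
   takes [r = rho]. *)
have T r z : 0 < r -> r <= rho -> in_rect r z a b c d ->
    normc (f z - f z0 - D * (z - z0)) <= normc (z - z0) ^+ 2 * (r^-1 * rho^-1 ^+ 2) * bdry_norm f a b c d.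
  move=> r0 rr hz; apply: le_two_pi_i.
  have hzn := in_rect_neq r0 hz; have hz0n := in_rect_neq rho0 hz0.
  have -> : two_pi_i R * (f z - f z0 - D * (z - z0)) =
    two_pi_i R * f z - two_pi_i R * f z0 - two_pi_i R * (D * (z - z0)) by ring.
  rewrite -(cauchy_formula r0 hz df) -(cauchy_formula rho0 hz0 df).
  have -> : two_pi_i R * (D * (z - z0)) = (z - z0) * rint (fun w => f w * ((w - z0)^-1 * (w - z0)^-1)) a b c d.
    by rewrite /D mulrA mulVKf ?two_pi_i_neq0// mulrC.
  rewrite -rintZ// -rintB; [|exact: B|exact: B].
  rewrite -rintB; last 2 first.
    by apply: bdry_contB; exact: B.
    apply: (on_bdry_derivable ab cd) => x y hx hy hb; apply: derivableM; first exact: derivable_cst.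
    by apply: derivableM; [exact: dfb|exact: dk2].
  rewrite (@eq_rint _ _ (fun w => f w * ((w - z)^-1 - (w - z0)^-1 - (z - z0) * ((w - z0)^-1 * (w - z0)^-1))))//; last first.
    by move=> *; ring.
  apply: (normc_rint_kernel ab cd dfb).
    move=> x y hx hy hb; apply: derivableB; first apply: derivableB.
    - by apply: derivable_inv_sub; exact: hzn.
    - by apply: derivable_inv_sub; exact: hz0n.
    - by apply: derivableM; [exact: derivable_cst|exact: dk2].
  move=> x y hx hy hb; set w := x +i* y.
  have n1 : w - z != 0 by rewrite subr_eq0; exact: hzn.
  have n2 : w - z0 != 0 by rewrite subr_eq0; exact: hz0n.
  have -> : (w - z)^-1 - (w - z0)^-1 - (z - z0) * ((w - z0)^-1 * (w - z0)^-1) =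
     (z - z0) ^+ 2 * ((w - z)^-1 * ((w - z0)^-1 * (w - z0)^-1)).
    by field; rewrite n1 n2.
  rewrite !normcM !expr2 ler_wpM2l ?mulr_ge0 ?normc_ge0// ler_pM ?mulr_ge0 ?normc_ge0//.
    by apply: normc_inv_le => //; exact: (in_rect_bdry r0 hz).
  by rewrite ler_pM ?normc_ge0//; apply: normc_inv_le => //; exact: (in_rect_bdry rho0 hz0).
have DL : D = L.
  apply: (hasder_unique _ HL) => e e0.
  set K := ((rho / 2)^-1 * rho^-1 ^+ 2) * bdry_norm f a b c d.
  pose r := Num.min (rho / 2) (e / (1 + `|K|)).
  have r0 : 0 < r by rewrite lt_min !divr_gt0// ltr_pwDl.
  exists r => // z; rewrite lt_min => /andP[zr ze].
  have hR := le_normr_Re (z - z0); have hI := le_normr_Im (z - z0).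
  rewrite cReD cReN in hR; rewrite cImD cImN in hI.
  have := le_lt_trans hR zr; have := le_lt_trans hI zr.
  rewrite !ltr_norml => /andP[? ?] /andP[? ?].
  have hz : in_rect (rho / 2) z a b c d by split; lra.
  have rh : rho / 2 <= rho by lra.
  rewrite (le_trans (T _ _ _ rh hz)) ?divr_gt0//.
  rewrite -mulrA -/K expr2 -mulrA mulrC ler_wpM2r ?normc_ge0//.
  rewrite mulrC (le_trans (ler_wpM2r (normc_ge0 _) (ler_norm K)))//.
  move: ze; rewrite ltr_pdivlMr ?ltr_pwDl// => /ltW; apply: le_trans.
  by rewrite mulrC ler_wpM2l ?normc_ge0// lerDr.
split; last first.
  by move=> z hz; rewrite -DL (le_trans (T _ _ rho0 (lexx _) hz)).
rewrite -DL; apply: le_two_pi_i; rewrite /D mulVKf ?two_pi_i_neq0//.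
apply: (normc_rint_kernel ab cd dfb dk2) => x y hx hy hb.
by rewrite normcM expr2 ler_pM ?normc_ge0//; apply: normc_inv_le => //; exact: (in_rect_bdry rho0 hz0).
Qed.

End bounds.
End cauchy_bounds.

(** * Semi-inner product spaces *)

Section semi_inner_product.
Variables (R : realType) (V : lmodType R[i]).
Implicit Types (H K : set V) (ip : V -> V -> R[i]) (f g h : V) (c : R[i]).

Definition subspace H := H 0 /\ forall c f g, H f -> H g -> H (c *: f + g).

(** Only semi-definite: [L2] consists of functions rather than classes modulo null sets, and the
    theory is also applied to the defect form [S <f, g> - <f, g>_K]. All is relative to a subset
    [H], since the ambient module contains all functions. *)
Definition semi_inner H ip :=
  [/\ forall c f g h, H f -> H g -> H h -> ip (c *: f + g) h = c * ip f h + ip g h,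
      forall f g, H f -> H g -> ip g f = (ip f g)^*
    & forall f, H f -> 0 <= complex.Re (ip f f)].

Definition inorm ip f : R := Num.sqrt (complex.Re (ip f f)).

Definition icauchy ip (u : nat -> V) := forall e : R, 0 < e ->
  exists N, forall n m, (N <= n)%N -> (N <= m)%N -> inorm ip (u n - u m) < e.

Definition icvg ip (u : nat -> V) f := forall e : R, 0 < e ->
  exists N, forall n, (N <= n)%N -> inorm ip (u n - f) < e.

Definition icomplete H ip := forall u, (forall n, H (u n)) -> icauchy ip u ->
  exists2 f, H f & icvg ip u f.

Lemma inorm_ge0 ip f : 0 <= inorm ip f.
Proof. exact: sqrtr_ge0. Qed.

Section theory.
Variables (H : set V) (ip : V -> V -> R[i]).
Hypotheses (sH : subspace H) (sip : semi_inner H ip).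
Let nrm := inorm ip.

Lemma sub0 : H 0. Proof. by case: sH. Qed.
Lemma subZ c f : H f -> H (c *: f).
Proof. by move=> Hf; rewrite -[_ *: _]addr0; apply: sH.2 => //; exact: sub0. Qed.
Lemma subD f g : H f -> H g -> H (f + g).
Proof. by move=> Hf Hg; rewrite -(scale1r f); apply: sH.2. Qed.
Lemma subN f : H f -> H (- f).
Proof. by move=> Hf; rewrite -scaleN1r; exact: subZ. Qed.
Lemma subB f g : H f -> H g -> H (f - g).
Proof. by move=> Hf Hg; apply: subD => //; exact: subN. Qed.
Lemma sub_sum (I : Type) (r : seq I) (P : pred I) (F : I -> V) :
  (forall i, P i -> H (F i)) -> H (\sum_(i <- r | P i) F i).
Proof. by move=> HF; elim/big_ind : _ => //; [exact: sub0|exact: subD]. Qed.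

Lemma ipDl f g h : H f -> H g -> H h -> ip (f + g) h = ip f h + ip g h.
Proof. by move=> Hf Hg Hh; case: sip => L _ _; rewrite -(scale1r f) L// scale1r mul1r. Qed.
Lemma ip0l h : H h -> ip 0 h = 0.
Proof.
move=> Hh; have := ipDl sub0 sub0 Hh; rewrite addr0 => /esym/eqP.
by rewrite -subr_eq0 addrK => /eqP.
Qed.
Lemma ipZl c f h : H f -> H h -> ip (c *: f) h = c * ip f h.
Proof.
move=> Hf Hh; case: sip => L _ _; rewrite -[c *: f]addr0 L ?ip0l ?addr0//; exact: sub0.
Qed.
Lemma ipNl f h : H f -> H h -> ip (- f) h = - ip f h.
Proof. by move=> Hf Hh; rewrite -scaleN1r ipZl// mulN1r. Qed.
Lemma ipBl f g h : H f -> H g -> H h -> ip (f - g) h = ip f h - ip g h.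
Proof. by move=> Hf Hg Hh; rewrite ipDl ?ipNl//; exact: subN. Qed.
Lemma ipC f g : H f -> H g -> ip g f = (ip f g)^*.
Proof. by move=> Hf Hg; case: sip => _ C _; exact: C. Qed.
Lemma ipDr f g h : H f -> H g -> H h -> ip h (f + g) = ip h f + ip h g.
Proof.
by move=> Hf Hg Hh; rewrite (ipC _ Hh) ?ipDl ?rmorphD/= -?(ipC _ Hh)//; exact: subD.
Qed.
Lemma ipZr c f h : H f -> H h -> ip h (c *: f) = c^* * ip h f.
Proof.
by move=> Hf Hh; rewrite (ipC _ Hh) ?ipZl ?rmorphM/= -?(ipC _ Hh)//; exact: subZ.
Qed.
Lemma ipNr f h : H f -> H h -> ip h (- f) = - ip h f.
Proof. by move=> Hf Hh; rewrite (ipC _ Hh) ?ipNl ?rmorphN/= -?(ipC _ Hh)//; exact: subN. Qed.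
Lemma ipBr f g h : H f -> H g -> H h -> ip h (f - g) = ip h f - ip h g.
Proof. by move=> Hf Hg Hh; rewrite ipDr ?ipNr//; exact: subN. Qed.

Lemma ipff f : H f -> ip f f = (nrm f ^+ 2)%:C.
Proof.
move=> Hf; have [_ _ P] := sip; rewrite /nrm /inorm sqr_sqrtr ?P//.
have := ipC Hf Hf; case: (ip f f) => a b [] /eqP.
by rewrite -addr_eq0 -mulr2n mulrn_eq0/= => /eqP ->.
Qed.

Lemma nrm_ge0 f : 0 <= nrm f. Proof. exact: sqrtr_ge0. Qed.

Lemma nrmD_sqr f g : H f -> H g ->
  nrm (f + g) ^+ 2 = nrm f ^+ 2 + nrm g ^+ 2 + 2 * complex.Re (ip f g).
Proof.
move=> Hf Hg; have Hfg := subD Hf Hg; apply: complexI.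
rewrite -ipff// ipDl// !ipDr// !ipff// (ipC Hf Hg).
by case: (ip f g) => a b; apply/eqP; rewrite eq_complex/=; apply/andP; split; apply/eqP; ring.
Qed.

Lemma nrmZ c f : H f -> nrm (c *: f) = normc c * nrm f.
Proof.
move=> Hf; apply/eqP; rewrite -(@eqrXn2 _ 2)// ?mulr_ge0 ?nrm_ge0 ?normc_ge0//.
apply/eqP/complexI; rewrite -ipff ?ipZl ?ipZr ?ipff//; try exact: subZ.
by rewrite mulrA mulcJ -rmorphM/= exprMn.
Qed.

Lemma nrmN f : H f -> nrm (- f) = nrm f.
Proof. by move=> Hf; rewrite -scaleN1r nrmZ// normcN normc1 mul1r. Qed.

Lemma nrmB_sqr f g : H f -> H g ->
  nrm (f - g) ^+ 2 = nrm f ^+ 2 + nrm g ^+ 2 - 2 * complex.Re (ip f g).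
Proof.
move=> Hf Hg; rewrite nrmD_sqr//; last exact: subN.
by rewrite nrmN// ipNr// cReN mulrN.
Qed.

(** Shifting along [ip f g *: g] makes the cross term real, so the squared norm is a real quadratic
    in [s]. Its positivity gives Cauchy-Schwarz, and minimality at [s = 0] gives orthogonality in
    [projection]. *)
Lemma nrm_shift_sqr f g (s : R) : H f -> H g ->
  nrm (f - (s%:C * ip f g) *: g) ^+ 2 =
  nrm f ^+ 2 - 2 * s * normc (ip f g) ^+ 2 + s ^+ 2 * normc (ip f g) ^+ 2 * nrm g ^+ 2.
Proof.
move=> Hf Hg; rewrite nrmB_sqr//; last exact: subZ.
rewrite nrmZ// ipZr// normcM normc_real !exprMn real_normK ?num_real//.
have -> : complex.Re ((s%:C * ip f g)^* * ip f g) = s * normc (ip f g) ^+ 2.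
  by rewrite sqr_normc; case: (ip f g) => a b /=; ring.
by ring.
Qed.

Lemma CauchySchwarz f g : H f -> H g -> normc (ip f g) <= nrm f * nrm g.
Proof.
move=> Hf Hg; rewrite -(@ler_pXn2r _ 2) ?nnegrE ?normc_ge0 ?mulr_ge0 ?nrm_ge0//.
rewrite exprMn.
have P s : 0 <= nrm f ^+ 2 - 2 * s * normc (ip f g) ^+ 2 + s ^+ 2 * normc (ip f g) ^+ 2 * nrm g ^+ 2.
  by rewrite -nrm_shift_sqr// exprn_ge0// nrm_ge0.
have A0 : 0 <= nrm f ^+ 2 by rewrite exprn_ge0// nrm_ge0.
have : 0 <= nrm g ^+ 2 by rewrite exprn_ge0// nrm_ge0.
have : 0 <= normc (ip f g) ^+ 2 by rewrite exprn_ge0// normc_ge0.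
move: (nrm f ^+ 2) (normc _ ^+ 2) (nrm g ^+ 2) A0 P => A B C A0 P B0.
(* If [g] has norm 0 the quadratic is affine in [s], and a nonzero slope would make it equal to -1
   at the point chosen. Otherwise its minimum, at [s = C^-1], gives the inequality. *)
rewrite le_eqVlt => /predU1P[C0|C0].
  move: P; rewrite -C0 mulr0 => P; rewrite leNgt; apply/negP => B1.
  have := P ((A + 1) / (2 * B)).
  have -> : A - 2 * ((A + 1) / (2 * B)) * B + ((A + 1) / (2 * B)) ^+ 2 * B * 0 = -1.
    by field; rewrite gt_eqF.
  by rewrite oppr_ge0 ler10.
have := P C^-1.
have -> : A - 2 * C^-1 * B + C^-1 ^+ 2 * B * C = A - B / C by field; rewrite gt_eqF.
by rewrite subr_ge0 ler_pdivrMr.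
Qed.

Lemma nrmD f g : H f -> H g -> nrm (f + g) <= nrm f + nrm g.
Proof.
move=> Hf Hg; rewrite -(@ler_pXn2r _ 2) ?nnegrE ?addr_ge0 ?nrm_ge0//.
have := le_trans (le_Re_normc _) (CauchySchwarz Hf Hg).
by rewrite nrmD_sqr// sqrrD -mulr_natl; lra.
Qed.

Lemma nrmB f g : H f -> H g -> nrm (f - g) <= nrm f + nrm g.
Proof. by move=> Hf Hg; rewrite -(nrmN Hg) nrmD//; exact: subN. Qed.

Lemma nrm_dist f g : H f -> H g -> nrm (f - g) = nrm (g - f).
Proof. by move=> Hf Hg; rewrite -opprB nrmN//; exact: subB. Qed.

Lemma nrm_triB f g h : H f -> H g -> H h -> nrm (f - h) <= nrm (f - g) + nrm (g - h).
Proof.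
by move=> Hf Hg Hh; rewrite -[f - h](subrKA g) nrmD//; exact: subB.
Qed.

Lemma nrm0 : nrm 0 = 0.
Proof. by rewrite -(scale0r (0 : V)) nrmZ ?normc0 ?mul0r//; exact: sub0. Qed.

Lemma parallelogram f g : H f -> H g ->
  nrm (f - g) ^+ 2 + nrm (f + g) ^+ 2 = 2 * nrm f ^+ 2 + 2 * nrm g ^+ 2.
Proof. by move=> Hf Hg; rewrite nrmB_sqr// nrmD_sqr//; ring. Qed.

End theory.
End semi_inner_product.

(** * Projection, surjectivity from lower bounds, and the gliding hump *)

Section hilbert_theorems.
Variables (R : realType) (V : lmodType R[i]).
Implicit Types (f g h : V) (c : R[i]).

Lemma natSV_lt (e : R) : 0 < e -> exists N, forall n, (N <= n)%N -> n.+1%:R^-1 < e.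
Proof.
move=> e0; exists (Num.bound e^-1) => n Nn.
have b : e^-1 < (Num.bound e^-1)%:R by apply: archi_boundP; rewrite invr_ge0 ltW.
by rewrite invf_plt ?posrE// (lt_le_trans b)// ler_nat (leq_trans Nn).
Qed.

Section projection.
Variables (E K : set V) (ip : V -> V -> R[i]).
Hypotheses (sE : subspace E) (sip : semi_inner E ip).
Hypotheses (KE : K `<=` E) (sK : subspace K) (cK : icomplete K ip).
Let nrm := inorm ip.
Let n0 f : 0 <= nrm f := inorm_ge0 ip f.

(** A minimising sequence is Cauchy by the parallelogram law. Completeness is asked of [K] alone, so
    that [E] may be the set of square-integrable functions and [K] the Bergman space. *)
Theorem projection phi : E phi ->
  exists2 h, K h & forall k, K k -> ip (phi - h) k = 0.
Proof.
move=> Ephi.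
pose S := [set nrm (phi - k) ^+ 2 | k in K].
have S0 : S (nrm (phi - 0) ^+ 2) by exists 0 => //; exact: (sub0 sK).
have lbS : lbound S 0 by move=> _ [k _ <-]; rewrite exprn_ge0// n0.
have hS : has_inf S by split; [exists (nrm (phi - 0) ^+ 2)|exists 0].
pose del := inf S.
have delS k : K k -> del <= nrm (phi - k) ^+ 2.
  by move=> Kk; apply: ge_inf; [exists 0|exists k].
have /choice[u Hu] : forall n : nat, exists k, K k /\ nrm (phi - k) ^+ 2 < del + n.+1%:R^-1.
  move=> n; have r0 : (0 : R) < n.+1%:R^-1 by rewrite invr_gt0.
  by have [_ [k Kk <-] kl] := inf_adherent r0 hS; exists k.
have Ku n : K (u n) by have [] := Hu n.
have Eu n : E (phi - u n) by apply: (subB sE) => //; exact/KE.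
have cu : icauchy ip u.
  (* Midpoints lie in [K], so the parallelogram law bounds the squared distance by
     [4 * (del + e ^+ 2 / 4) - 4 * del]. *)
  move=> e e0; have e40 : 0 < e ^+ 2 / 4 by rewrite divr_gt0// exprn_gt0.
  have [N HN] := natSV_lt e40; exists N => n m Nn Nm.
  rewrite -(@ltr_pXn2r _ 2) ?nnegrE ?inorm_ge0 ?ltW// -/(nrm (u n - u m)).
  have -> : u n - u m = (phi - u m) - (phi - u n) by rewrite opprB [RHS]addrC subrKA.
  have := parallelogram sE sip (Eu m) (Eu n).
  have -> : phi - u m + (phi - u n) = 2%:R *: (phi - 2%:R^-1 *: (u m + u n)).
    rewrite scalerBr scalerA divff ?pnatr_eq0// scale1r scaler_nat mulr2n opprD.
    by rewrite addrACA.
  have Km : K (2%:R^-1 *: (u m + u n)) by apply: (subZ sK); exact: (subD sK).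
  rewrite (nrmZ sE sip); last by apply: (subB sE) => //; exact/KE.
  have -> : normc (2%:R : R[i]) = 2 by rewrite -(rmorph_nat (real_complex R)) normc_real ger0_norm.
  rewrite exprMn -/nrm; have := delS _ Km; have := (Hu n).2; have := (Hu m).2.
  have := HN n Nn; have := HN m Nm.
  move: (n.+1%:R^-1) (m.+1%:R^-1) (nrm _ ^+ 2) (nrm _ ^+ 2) (nrm _ ^+ 2) (nrm _ ^+ 2) => *; lra.
have [h Kh uh] := cK Ku cu; exists h => //.
have Eh : E (phi - h) by apply: (subB sE) => //; exact/KE.
have hd : nrm (phi - h) ^+ 2 <= del.
  have d0 : 0 <= del by apply: lb_le_inf; [by exists (nrm (phi - 0) ^+ 2)|exact: lbS].
  suff : nrm (phi - h) <= Num.sqrt del.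
    by move=> le_sqrt; rewrite -(sqr_sqrtr d0) ler_pXn2r ?nnegrE ?n0 ?sqrtr_ge0.
  apply/ler_addgt0Pr => e e0; have e20 : 0 < e / 2 by rewrite divr_gt0.
  have [N1 H1] := uh _ e20.
  have e2 : 0 < (e / 2) ^+ 2 by rewrite exprn_gt0.
  have [N2 H2] := natSV_lt e2.
  pose n := maxn N1 N2.
  have h1 := H1 n (leq_maxl _ _); have h2 := H2 n (leq_maxr _ _).
  have h3 : nrm (phi - u n) <= Num.sqrt del + e / 2.
    rewrite -(@ler_pXn2r _ 2) ?nnegrE ?n0 ?addr_ge0 ?sqrtr_ge0 ?(ltW e20)//.
    rewrite sqrrD (sqr_sqrtr d0); have h4 := (Hu n).2.
    have h5 : 0 <= Num.sqrt del * (e / 2) *+ 2.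
      by rewrite mulrn_wge0// mulr_ge0 ?sqrtr_ge0// ltW.
    by rewrite (le_trans (ltW h4))// -addrA lerD2l (le_trans (ltW h2))// lerDr.
  have := nrm_triB sE sip Ephi (KE (Ku n)) (KE Kh); rewrite -/nrm; move: h1; rewrite -/nrm => h1; lra.
move=> k Kk; have Ek := KE Kk.
apply/eqP; rewrite -normc_eq0; apply/eqP.
have P s : 0 <= - (2 * s * normc (ip (phi - h) k) ^+ 2) + s ^+ 2 * normc (ip (phi - h) k) ^+ 2 * nrm k ^+ 2.
  have := nrm_shift_sqr sE sip s Eh Ek.
  have -> : phi - h - (s%:C * ip (phi - h) k) *: k = phi - (h + (s%:C * ip (phi - h) k) *: k).
    by rewrite opprD addrA.
  have Kk' : K (h + (s%:C * ip (phi - h) k) *: k) by apply: (subD sK) => //; exact: (subZ sK).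
  by have := delS _ Kk'; rewrite -/nrm; lra.
have : 0 <= normc (ip (phi - h) k) ^+ 2 by rewrite exprn_ge0// normc_ge0.
have : 0 <= nrm k ^+ 2 by rewrite exprn_ge0// n0.
suff : normc (ip (phi - h) k) ^+ 2 <= 0.
  move=> a _ b; have /eqP : normc (ip (phi - h) k) ^+ 2 = 0 by apply/le_anti; rewrite a b.
  by rewrite expf_eq0/= => /eqP.
move: P; move: (normc _ ^+ 2) (nrm k ^+ 2) (exprn_ge0 2 (n0 k)) => B C; rewrite -/nrm => C0 P.
(* The optimal step would be [C^-1]; [(C + 1)^-1] does as well and covers [C = 0]. *)
have := P (C + 1)^-1.
have -> : - (2 * (C + 1)^-1 * B) + (C + 1)^-1 ^+ 2 * B * C = - (B * ((C + 2) / (C + 1) ^+ 2)).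
  by field; rewrite gt_eqF// ltr_wpDl.
by rewrite oppr_ge0 pmulr_lle0// divr_gt0 ?exprn_gt0 ?ltr_wpDl.
Qed.

End projection.

Section operators.
Variables (H : set V) (ip : V -> V -> R[i]).
Hypotheses (sH : subspace H) (sip : semi_inner H ip) (cH : icomplete H ip).
Hypothesis definite : forall f, H f -> inorm ip f = 0 -> f = 0.
Let nrm := inorm ip.
Let n0 f : 0 <= nrm f := inorm_ge0 ip f.

(** The lower bound on [A] makes its range complete, so [g] projects onto it. The residue is
    orthogonal to the range, hence annihilated by the adjoint [B], and the lower bound on [B] makes
    it 0. *)
Theorem surjective_of_bounded_below (A B : V -> V) (C M : R) :
  (forall f, H f -> H (A f)) -> (forall f, H f -> H (B f)) ->
  (forall c f g, H f -> H g -> A (c *: f + g) = c *: A f + A g) ->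
  (forall f g, H f -> H g -> ip (A f) g = ip f (B g)) ->
  (forall f, H f -> nrm (A f) <= M * nrm f) ->
  (forall f, H f -> nrm f <= C * nrm (A f)) ->
  (forall f, H f -> nrm f <= C * nrm (B f)) ->
  forall g, H g -> exists2 f, H f & A f = g.
Proof.
move=> HA HB lA adj bA lbA lbB g Hg.
have A0 : A 0 = 0.
  by have := lA 1 0 0 (sub0 sH) (sub0 sH); rewrite scaler0 addr0 scale1r => /esym/eqP; rewrite -subr_eq0 addrK => /eqP.
have AB f1 f2 : H f1 -> H f2 -> A (f1 - f2) = A f1 - A f2.
  by move=> h1 h2; rewrite addrC -scaleN1r lA// scaleN1r addrC.
pose K := [set A f | f in H].
have sK : subspace K.
  split; first by exists 0 => //; exact: (sub0 sH).
  by move=> c _ _ [f1 h1 <-] [f2 h2 <-]; exists (c *: f1 + f2); [apply: sH.2|exact: lA].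
have KH : K `<=` H by move=> _ [f Hf <-]; exact: HA.
have cK : icomplete K ip.
  move=> u Ku cu.
  have /choice[v Hv] : forall n, exists f, H f /\ A f = u n.
    by move=> n; have [f Hf e] := Ku n; exists f.
  have hv n : H (v n) by have [] := Hv n.
  have Av n : A (v n) = u n by have [] := Hv n.
  have cv : icauchy ip v.
    move=> e e0; have e'0 : 0 < e / (1 + `|C|) by rewrite divr_gt0// ltr_pwDl.
    have [N HN] := cu _ e'0; exists N => n m Nn Nm.
    have := HN n m Nn Nm; rewrite ltr_pdivlMr ?ltr_pwDl//; apply: le_lt_trans.
    rewrite (le_trans (lbA _ (subB sH (hv n) (hv m))))// AB// !Av mulrC ler_wpM2l ?inorm_ge0//.
    by rewrite (le_trans (ler_norm _))// lerDr.
  have [f Hf vf] := cH hv cv; exists (A f); first by exists f.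
  move=> e e0; have e'0 : 0 < e / (1 + `|M|) by rewrite divr_gt0// ltr_pwDl.
  have [N HN] := vf _ e'0; exists N => n Nn.
  have := HN n Nn; rewrite ltr_pdivlMr ?ltr_pwDl//; apply: le_lt_trans.
  rewrite -Av -AB// (le_trans (bA _ (subB sH (hv n) Hf)))// mulrC ler_wpM2l ?inorm_ge0//.
  by rewrite (le_trans (ler_norm _))// lerDr.
have [_ [f Hf <-] orth] := projection sH sip KH sK cK Hg.
exists f => //; have Hd : H (g - A f) by apply: (subB sH) => //; exact: HA.
have B0 : nrm (B (g - A f)) = 0.
  have HBd := HB _ Hd.
  have := ipff sip HBd; rewrite -adj//.
  have := orth (A (B (g - A f))) (ex_intro2 _ _ _ HBd erefl).
  have -> : ip (A (B (g - A f))) (g - A f) = (ip (g - A f) (A (B (g - A f))))^*.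
    by rewrite -(ipC sip)//; exact: HA.
  move=> ->; rewrite rmorph0 => /esym/complexI/eqP.
  by rewrite expf_eq0/= => /eqP.
have : nrm (g - A f) = 0.
  by apply/le_anti; rewrite n0 andbT; have := lbB _ Hd; rewrite B0 mulr0.
by move/(definite Hd)/eqP; rewrite subr_eq0 => /eqP.
Qed.

(* Sokal's form of the gliding hump. *)
Theorem gliding_hump (w : nat -> V) : (forall n, H (w n)) ->
  (forall n, 2^-1 <= nrm (w n)) ->
  exists2 h, H h & forall n, (3^-1) ^+ n / 4 <= normc (ip h (w n)).
Proof.
move=> Hw wn.
have w0 n : 0 < nrm (w n) by apply: lt_le_trans (wn n); rewrite invr_gt0.
have t0 n : 0 < (3^-1 : R) ^+ n by rewrite exprn_gt0// invr_gt0.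
have /choice[step Hstep] : forall p : nat * V, exists x, H p.2 ->
    [/\ H x, nrm (x - p.2) <= (3^-1) ^+ p.1 & (3^-1) ^+ p.1 * nrm (w p.1) <= normc (ip x (w p.1))].
  move=> [n x]/=; have [Hx|nHx] := pselect (H x); last by exists x.
  pose t := (3^-1) ^+ n / nrm (w n).
  have tt : 0 < t by rewrite divr_gt0.
  have Ht (s : R) : H (s%:C *: w n) by apply: (subZ sH).
  have n1 : nrm (t%:C *: w n) = (3^-1) ^+ n.
    by rewrite /nrm (nrmZ sH sip)// normc_real gtr0_norm// /t -/nrm divfK// gt_eqF.
  (* The pairings of [x + t w] and [x - t w] with [w n] differ by twice [(3^-1) ^+ n * nrm (w n)],
     so one of them has at least that modulus and becomes the next term. *)
  have [h|h] := leP ((3^-1) ^+ n * nrm (w n)) (normc (ip (x + t%:C *: w n) (w n))).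
    exists (x + t%:C *: w n) => _; split => //; first exact: (subD sH).
    by rewrite addrC addKr n1.
  exists (x - t%:C *: w n) => _; split => //; first exact: (subB sH).
    by rewrite addrAC subrr add0r /nrm (nrmN sH sip)// -/nrm n1.
  move: h; rewrite (ipDl sip)// (ipBl sH sip)// (ipZl sH sip)// (ipff sip)//.
  rewrite -rmorphM/= -/nrm; have -> : t * nrm (w n) ^+ 2 = (3^-1) ^+ n * nrm (w n).
    by rewrite /t; field; rewrite gt_eqF.
  set q := _ * _; move=> h.
  have q0 : 0 <= q by rewrite mulr_ge0 ?ltW.
  have := le_normcB (ip x (w n) + q%:C) (ip x (w n) - q%:C).
  have -> : ip x (w n) + q%:C - (ip x (w n) - q%:C) = (2 * q)%:C by case: (ip x (w n)) => a b; apply/eqP; rewrite eq_complex/=; apply/andP; split; apply/eqP; ring.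
  by rewrite normc_real ger0_norm ?mulr_ge0//; lra.
pose x := fix x n := if n is n'.+1 then step (n', x n') else 0.
have Hx n : H (x n).
  by elim: n => [|n IH]; [exact: (sub0 sH)|have [] := Hstep (n, x n) IH].
have X1 n : nrm (x n.+1 - x n) <= (3^-1) ^+ n by have [] := Hstep (n, x n) (Hx n).
have X2 n : (3^-1) ^+ n * nrm (w n) <= normc (ip (x n.+1) (w n)) by have [] := Hstep (n, x n) (Hx n).
have X3 n m : (n <= m)%N -> nrm (x m - x n) <= (3 / 2) * ((3^-1) ^+ n - (3^-1) ^+ m).
  elim: m => [|m IH]; first by rewrite leqn0 => /eqP ->; rewrite !subrr mulr0 /nrm (nrm0 sH sip).
  rewrite leq_eqVlt => /predU1P[->|]; first by rewrite !subrr mulr0 /nrm (nrm0 sH sip).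
  rewrite ltnS => /IH; have := X1 m; have := nrm_triB sH sip (Hx m.+1) (Hx m) (Hx n).
  by rewrite -/nrm [in _ ^+ m.+1]exprS; lra.
have cx : icauchy ip x.
  move=> e e0.
  have [N HN] := @small_half_pow R 3 _ e0; exists N.
  have S n m : (N <= n)%N -> (n <= m)%N -> nrm (x m - x n) < e.
    move=> Nn nm; rewrite (le_lt_trans (X3 _ _ nm))//; apply: le_lt_trans HN.
    apply: (@le_trans _ _ ((3 / 2) * (3^-1) ^+ n)).
      by rewrite ler_wpM2l// gerBl exprn_ge0.
    apply: (@le_trans _ _ (3 * (2^-1) ^+ N)); last by rewrite exprVn.
    apply: ler_pM; rewrite ?exprn_ge0//; first lra.
    rewrite (@le_trans _ _ ((2^-1) ^+ n))//.
      by apply: lerXn2r; rewrite ?nnegrE ?invr_ge0//; lra.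
    by apply: ler_wiXn2l; rewrite ?invr_ge0//; lra.
  move=> n m Nn Nm; have [nm|/ltnW mn] := leqP n m; last exact: S.
  by rewrite -/nrm /nrm (nrm_dist sH sip)//; exact: S.
have [h Hh xh] := cH Hx cx; exists h => // n.
have hx : nrm (h - x n.+1) <= (3^-1) ^+ n / 2.
  apply/ler_addgt0Pr => e e0; have [N HN] := xh _ e0.
  have := HN (maxn N n.+1) (leq_maxl _ _) => a.
  have b := X3 n.+1 (maxn N n.+1) (leq_maxr _ _).
  have c := nrm_triB sH sip Hh (Hx (maxn N n.+1)) (Hx n.+1).
  rewrite (nrm_dist sH sip)// in a.
  have : 0 <= (3^-1 : R) ^+ maxn N n.+1 by rewrite exprn_ge0.
  move: b c a; rewrite -/nrm [in _ ^+ n.+1]exprS; lra.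
have := X2 n; have := CauchySchwarz sH sip (subB sH Hh (Hx n.+1)) (Hw n).
rewrite (ipBl sH sip)// -/nrm => c1 c2.
have c3 : nrm (h - x n.+1) * nrm (w n) <= (3^-1) ^+ n / 2 * nrm (w n) by rewrite ler_wpM2r// ltW.
have c4 := le_normc_dist (ip (x n.+1) (w n)) (ip h (w n)).
rewrite normcB in c4.
have c5 : (3^-1) ^+ n / 4 <= (3^-1) ^+ n / 2 * nrm (w n).
  by have := wn n; have := t0 n; move: (_ ^+ n) (nrm _) => T W *; nra.
lra.
Qed.

(** For suitably selected indices, [T f] and the finitely many [e i] pair with [w] at the rate
    [4 ^- n] up to a constant, whereas the gliding hump produces an [h] whose pairings with the same
    vectors decay no faster than [3 ^- n]. *)
Theorem not_cofinite_range (T : V -> V) (k : nat) (e : 'I_k -> V) (w : nat -> V) (sig : nat -> R) :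
  (forall n, H (w n)) -> (forall n, 2^-1 <= nrm (w n)) ->
  (forall n f, H f -> normc (ip (T f) (w n)) <= sig n * nrm f) ->
  (forall f, H f -> H (T f)) -> (forall i, H (e i)) ->
  (forall r : R, 0 < r -> exists N, forall n, (N <= n)%N -> sig n < r) ->
  (forall f, H f -> forall r : R, 0 < r -> exists N, forall n, (N <= n)%N -> normc (ip f (w n)) < r) ->
  ~ forall h, H h -> exists (f : V) (c : 'I_k -> R[i]), H f /\ h = T f + \sum_i c i *: e i.
Proof.
move=> Hw wn Tw HT He sig0 weak cof.
have /choice[s Hs] : forall n, exists N, sig N < (4^-1) ^+ n /\
    forall i, normc (ip (e i) (w N)) < (4^-1) ^+ n.
  move=> n; have r0 : 0 < (4^-1 : R) ^+ n by rewrite exprn_gt0 ?invr_gt0.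
  have [N1 H1] := sig0 _ r0.
  have /choice[N2 H2] i := weak _ (He i) _ r0.
  exists (N1 + \sum_i N2 i)%N; split; first by apply: H1; rewrite leq_addr.
  by move=> i; apply: H2; rewrite (bigD1 i)//= addnCA leq_addr.
have [h Hh hump] := gliding_hump (fun n => Hw (s n)) (fun n => wn (s n)).
have [f [c [Hf hE]]] := cof _ Hh.
pose Cs := nrm f + \sum_i normc (c i).
have up n : normc (ip h (w (s n))) <= (4^-1) ^+ n * Cs.
  have [s1 s2] := Hs n.
  rewrite hE (ipDl sip)//; [|exact: HT|by apply: (sub_sum sH) => i _; exact: (subZ sH)].
  rewrite (le_trans (le_normcD _ _))// mulrDr lerD//.
    by rewrite (le_trans (Tw _ _ Hf))// ler_wpM2r ?n0// ltW.
  rewrite mulr_sumr.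
  have : H (\sum_i c i *: e i) /\ normc (ip (\sum_i c i *: e i) (w (s n))) <= \sum_i (4^-1) ^+ n * normc (c i).
    elim/big_ind2 : _ => [|x1 x2 y1 y2 [Hx1 a1] [Hx2 a2]|i _].
    - by rewrite (ip0l sH sip)// normc0; split=> //; exact: (sub0 sH).
    - split; first exact: (subD sH).
      by rewrite (ipDl sip)// (le_trans (le_normcD _ _))// lerD.
    - split; first exact: (subZ sH).
      by rewrite (ipZl sH sip)// normcM mulrC ler_wpM2r ?normc_ge0// ltW.
  by case.
have C0 : 0 <= Cs by rewrite addr_ge0 ?n0// sumr_ge0// => i _; exact: normc_ge0.
have key n : (4 / 3) ^+ n <= 4 * Cs :> R.
  have := le_trans (hump n) (up n).
  rewrite -(@ler_pM2l _ (4 ^+ n * 4)) ?mulr_gt0 ?exprn_gt0//.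
  have -> : 4 ^+ n * 4 * ((3^-1) ^+ n / 4) = (4 / 3) ^+ n :> R.
    by rewrite exprMn [RHS]mulrC; field.
  have -> : 4 ^+ n * 4 * ((4^-1) ^+ n * Cs) = (4 / 4) ^+ n * (4 * Cs) by rewrite exprMn; ring.
  by rewrite divff ?pnatr_eq0// expr1n mul1r.
(* Bernoulli's inequality: [(4 / 3) ^+ n] is unbounded, against [key]. *)
have B n : 1 + n%:R / 3 <= (4 / 3) ^+ n :> R.
  elim: n => [|n IH]; first by rewrite mul0r addr0 expr0.
  rewrite exprS -natr1; have := ler0n R n; move: IH; move: (_ ^+ n) (n%:R) => u v; lra.
have := B (Num.bound (12 * Cs)); have := key (Num.bound (12 * Cs)).
have := archi_boundP (mulr_ge0 (ler0n R 12) C0).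
move: (_ ^+ _) => u; lra.
Qed.

End operators.
End hilbert_theorems.

(** * Bergman spaces and Toeplitz operators *)

Section complex_sequences.
Variable R : realType.
Implicit Types (v w : nat -> R[i]) (l k : R[i]).

Definition ctends v l := forall e : R, 0 < e ->
  exists N, forall n, (N <= n)%N -> normc (v n - l) < e.

Definition ccauchy v := forall e : R, 0 < e ->
  exists N, forall n m, (N <= n)%N -> (N <= m)%N -> normc (v n - v m) < e.

Lemma real_cauchy (u : nat -> R) : (forall e : R, 0 < e ->
  exists N, forall n m, (N <= n)%N -> (N <= m)%N -> `|u n - u m| < e) ->
  exists x : R, u @ \oo --> x.
Proof.
move=> H; apply/cvg_ex; apply: R_complete; apply: cauchy_exP => e e0.
have [N HN] := H _ e0; exists (u N); exists N => // n /= Nn.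
by rewrite /ball/=; exact: HN.
Qed.

Lemma ctends_Re v l : ctends v l -> (fun n => complex.Re (v n)) @ \oo --> complex.Re l.
Proof.
move=> H; apply/cvgrPdist_lt => e /H[N HN]; exists N => // n /= /HN.
by rewrite normcB; apply: le_lt_trans; rewrite -cReN -cReD; exact: le_normr_Re.
Qed.

Lemma ctends_Im v l : ctends v l -> (fun n => complex.Im (v n)) @ \oo --> complex.Im l.
Proof.
move=> H; apply/cvgrPdist_lt => e /H[N HN]; exists N => // n /= /HN.
by rewrite normcB; apply: le_lt_trans; rewrite -cImN -cImD; exact: le_normr_Im.
Qed.

Lemma ctends_complete v : ccauchy v -> exists l, ctends v l.
Proof.
move=> H.
have [x Hx] : exists x : R, (fun n => complex.Re (v n)) @ \oo --> x.
  apply: (real_cauchy (u := fun n => complex.Re (v n))) => e /H[N HN]; exists N => n m Nn Nm.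
  by rewrite -cReN -cReD (le_lt_trans (le_normr_Re _))// HN.
have [y Hy] : exists y : R, (fun n => complex.Im (v n)) @ \oo --> y.
  apply: (real_cauchy (u := fun n => complex.Im (v n))) => e /H[N HN]; exists N => n m Nn Nm.
  by rewrite -cImN -cImD (le_lt_trans (le_normr_Im _))// HN.
exists (x +i* y) => e e0; have e20 : 0 < e / 2 by rewrite divr_gt0.
move/cvgrPdist_lt : Hx => /(_ _ e20)[N1 _ H1].
move/cvgrPdist_lt : Hy => /(_ _ e20)[N2 _ H2].
exists (maxn N1 N2) => n; rewrite geq_max => /andP[h1 h2].
rewrite (le_lt_trans (le_normc_ReIm _))// cReD cImD cReN cImN /= [ltRHS]splitr.
by apply: ltrD; rewrite distrC; [exact: H1|exact: H2].
Qed.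

Lemma ctends_cst k : ctends (fun=> k) k.
Proof. by move=> e e0; exists 0%N => n _; rewrite subrr normc0. Qed.

Lemma ctendsB v w l k : ctends v l -> ctends w k -> ctends (fun n => v n - w n) (l - k).
Proof.
move=> Hv Hw e e0; have e20 : 0 < e / 2 by rewrite divr_gt0.
have [N1 H1] := Hv _ e20; have [N2 H2] := Hw _ e20.
exists (maxn N1 N2) => n; rewrite geq_max => /andP[h1 h2].
have -> : v n - w n - (l - k) = (v n - l) - (w n - k) by ring.
by rewrite (le_lt_trans (le_normcB _ _))// [ltRHS]splitr ltrD ?H1 ?H2.
Qed.

Lemma ctendsZr v l k : ctends v l -> ctends (fun n => v n * k) (l * k).
Proof.
move=> Hv e e0; have K0 : 0 < normc k + 1 by rewrite ltr_wpDl// normc_ge0.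
have e'0 : 0 < e / (normc k + 1) by rewrite divr_gt0.
have [N H] := Hv _ e'0; exists N => n /H; rewrite -mulrBl normcM ltr_pdivlMr//.
by apply: le_lt_trans; rewrite ler_wpM2l ?normc_ge0// lerDl.
Qed.

Lemma ctends_le v l (K : R) N : ctends v l -> (forall n, (N <= n)%N -> normc (v n) <= K) -> normc l <= K.
Proof.
move=> H HK; apply/ler_addgt0Pr => e /H[M HM].
have := HM (maxn N M) (leq_maxr _ _); have := HK (maxn N M) (leq_maxl _ _).
by have := le_normc_dist l (v (maxn N M)); rewrite normcB; lra.
Qed.

Lemma ctends_unique v l k : ctends v l -> ctends v k -> l = k.
Proof.
move=> H H'; apply/eqP; rewrite -subr_eq0 -normc_eq0; apply/eqP/le_anti.
rewrite normc_ge0 andbT; apply: (ctends_le (N := 0%N) (ctendsB H H')) => n _.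
by rewrite subrr normc0.
Qed.

Lemma ctends_normc_sqr v l : ctends v l -> (fun n => normc (v n) ^+ 2) @ \oo --> normc l ^+ 2.
Proof.
move=> H; rewrite (_ : (fun n => _) = (fun n => complex.Re (v n) * complex.Re (v n) + complex.Im (v n) * complex.Im (v n))); last first.
  by apply/funext => n; rewrite sqr_normc !expr2.
by rewrite sqr_normc !expr2; apply: cvgD; apply: cvgM; (exact: ctends_Re || exact: ctends_Im).
Qed.

End complex_sequences.

(** * Square-integrable functions on plane sets *)

Section L2_space.
Variable R : realType.
Implicit Types (Omega D : set R[i]) (f g : R[i] -> R[i]) (c : R[i]).

Definition cmset Omega := measurable (@cplx R @^-1` Omega).

Definition sqf f := (fun p => normc (f (@cplx R p)) ^+ 2).

Lemma sqf_ge0 f p : 0 <= sqf f p.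
Proof. by rewrite exprn_ge0// normc_ge0. Qed.

Lemma L2normsq_ge0 Omega f : (0 <= L2normsq Omega f)%E.
Proof. by apply: integral_ge0 => p _; rewrite lee_fin exprn_ge0// normc_ge0. Qed.

Lemma measurable_sqf Omega f : cmeasurable Omega f ->
  measurable_fun (@cplx R @^-1` Omega) (sqf f).
Proof. by move=> mf; apply: measurable_funX; exact: (measurable_normc mf). Qed.

Lemma L2P Omega f : cmset Omega -> L2 Omega f <->
  cmeasurable Omega f /\ (@area R).-integrable (@cplx R @^-1` Omega) (EFin \o sqf f).
Proof.
move=> mO; split=> -[mf H]; split=> //.
  apply/integrableP; split; first by apply/measurable_EFinP; apply: measurable_sqf.
  suff -> : (\int[@area R]_(x in @cplx R @^-1` Omega) `|(EFin \o sqf f) x| = L2normsq Omega f)%E by [].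
  by apply: eq_integral => p _ /=; rewrite ger0_norm// exprn_ge0// normc_ge0.
move/integrableP : H => [_].
suff -> : (\int[@area R]_(x in @cplx R @^-1` Omega) `|(EFin \o sqf f) x| = L2normsq Omega f)%E by [].
by apply: eq_integral => p _ /=; rewrite ger0_norm// exprn_ge0// normc_ge0.
Qed.

Lemma L2_cintegrableM Omega f g : cmset Omega -> L2 Omega f -> L2 Omega g ->
  cintegrable (@area R) (@cplx R @^-1` Omega)
    (fun p => f (cplx p) * (g (cplx p))^*).
Proof.
move=> mO /(L2P _ mO)[mf If] /(L2P _ mO)[mg Ig].
apply: (@cintegrable_le _ _ _ _ _ _ (fun p => sqf f p + sqf g p)) => //.
- by apply: cmeasM => //; exact: cmeasJ.
- by apply: eq_integrable (integrableD mO If Ig).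
- move=> p _; rewrite normcM normc_conj /sqf.
  have := normc_ge0 (f (cplx p)); have := normc_ge0 (g (cplx p)).
  by move: (normc _) (normc _) => u v *; nra.
Qed.

Lemma L2_subspace Omega : cmset Omega -> subspace (L2 Omega).
Proof.
move=> mO; split.
  apply/(L2P _ mO); split; first exact: cmeas_cst.
  apply: (eq_integrable mO (cst 0%E)); last exact: integrable0.
  by move=> p _ /=; rewrite /sqf normc0 expr0n.
move=> c f g /(L2P _ mO)[mf If] /(L2P _ mO)[mg Ig]; apply/(L2P _ mO).
have mfg : cmeasurable Omega (c *: f + g).
  by apply: cmeasD => //; apply: cmeasM => //; exact: cmeas_cst.
split=> //.
apply: (@le_integrable _ _ _ _ _ mO _ (fun p => (2 * normc c ^+ 2)%:E * (EFin \o sqf f) p + 2%:E * (EFin \o sqf g) p)%E).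
- by apply/measurable_EFinP; apply: measurable_sqf.
- move=> p _ /=; rewrite lee_fin !ger0_norm ?sqf_ge0//; last first.
    by rewrite addr_ge0 ?mulr_ge0 ?sqf_ge0 ?normc_ge0.
  have := le_normcD (c * f (cplx p)) (g (cplx p)); rewrite normcM => h.
  rewrite /sqf /=; apply: (@le_trans _ _ ((normc c * normc (f (cplx p)) + normc (g (cplx p))) ^+ 2)).
    by rewrite ler_pXn2r ?nnegrE ?normc_ge0// ?addr_ge0 ?mulr_ge0 ?normc_ge0.
  move: (normc (g _)) (normc (f _)) (normc c) => w v u.
  rewrite -subr_ge0 (_ : _ - _ = (u * v - w) ^+ 2) ?sqr_ge0//; ring.
- by apply: integrableD => //; exact: integrableZl.
Qed.

Lemma Re_L2inner Omega f : complex.Re (L2inner Omega f f) = fine (L2normsq Omega f).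
Proof.
rewrite /L2inner /=; apply: eq_Rintegral => p _.
by rewrite mulcJ.
Qed.

Lemma L2norm_inorm Omega f : L2norm Omega f = inorm (L2inner Omega) f.
Proof. by rewrite /L2norm /inorm Re_L2inner. Qed.

Lemma L2_semi_inner Omega : cmset Omega -> semi_inner (L2 Omega) (L2inner Omega).
Proof.
move=> mO; split.
- move=> c f g h Hf Hg Hh.
  have i1 := L2_cintegrableM mO Hf Hh; have i2 := L2_cintegrableM mO Hg Hh.
  transitivity (cint (@area R) (@cplx R @^-1` Omega) (fun p => c * (f (cplx p) * (h (cplx p))^*) + g (cplx p) * (h (cplx p))^*)).
    by apply: eq_cint => p _; rewrite mulrA -mulrDl.
  by rewrite cintD ?cintZ//; exact: cintegrableZ.
- move=> f g Hf Hg; have i1 := L2_cintegrableM mO Hf Hg.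
  rewrite [RHS](_ : _ = (cint (@area R) (@cplx R @^-1` Omega) (fun p => f (cplx p) * (g (cplx p))^*))^*)//.
  rewrite -cintJ//; apply: eq_cint => p _.
  case: (f _) => a1 b1; case: (g _) => a2 b2.
  by apply/eqP; rewrite eq_complex/=; apply/andP; split; apply/eqP; ring.
- by move=> f Hf; rewrite Re_L2inner fine_ge0// L2normsq_ge0.
Qed.

Lemma L2norm_ge0 Omega f : 0 <= L2norm Omega f.
Proof. exact: sqrtr_ge0. Qed.

Lemma sqr_L2norm Omega f : L2 Omega f -> ((L2norm Omega f ^+ 2)%:E = L2normsq Omega f)%E.
Proof.
move=> [_ H]; rewrite sqr_sqrtr ?fine_ge0 ?L2normsq_ge0// fineK//.
by rewrite ge0_fin_numE// L2normsq_ge0.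
Qed.

Lemma L2_CauchySchwarz Omega f g : cmset Omega -> L2 Omega f -> L2 Omega g ->
  normc (L2inner Omega f g) <= L2norm Omega f * L2norm Omega g.
Proof.
move=> mO Hf Hg; rewrite !L2norm_inorm.
exact: (CauchySchwarz (L2_subspace mO) (L2_semi_inner mO)).
Qed.

Lemma L2normsqS D Omega f : cmset Omega -> cmset D -> D `<=` Omega -> cmeasurable Omega f ->
  (L2normsq D f <= L2normsq Omega f)%E.
Proof.
move=> mO mD DO mf; apply: ge0_subset_integral => //.
- by apply/measurable_EFinP; apply: measurable_sqf.
- by move=> p _; rewrite lee_fin exprn_ge0// normc_ge0.
- by move=> p; exact: DO.
Qed.

Lemma L2S D Omega f : cmset Omega -> cmset D -> D `<=` Omega -> L2 Omega f -> L2 D f.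
Proof.
move=> mO mD DO [mf H]; split; last exact: le_lt_trans (L2normsqS mO mD DO mf) H.
by apply: cmeasS mf => // p; exact: DO.
Qed.

Lemma L2normS D Omega f : cmset Omega -> cmset D -> D `<=` Omega -> L2 Omega f ->
  L2norm D f <= L2norm Omega f.
Proof.
move=> mO mD DO Hf; rewrite -(@ler_pXn2r _ 2) ?nnegrE ?L2norm_ge0//.
rewrite -lee_fin !sqr_L2norm//; last exact: (L2S mO).
by apply: L2normsqS => //; case: Hf.
Qed.

(* The integral of |f||g|, not just |<f, g>|, is controlled. *)
Lemma L2_normM Omega f g : cmset Omega -> L2 Omega f -> L2 Omega g ->
  \int[@area R]_(p in @cplx R @^-1` Omega) (normc (f (cplx p)) * normc (g (cplx p))) <=
    L2norm Omega f * L2norm Omega g.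
Proof.
move=> mO Hf Hg.
have A h : L2 Omega h -> L2 Omega (fun z => (normc (h z))%:C) /\
    L2norm Omega (fun z => (normc (h z))%:C) = L2norm Omega h.
  move=> [mh ih].
  have E : L2normsq Omega (fun z => (normc (h z))%:C) = L2normsq Omega h.
    by apply: eq_integral => p _; rewrite normc_real ger0_norm ?normc_ge0.
  split; last by rewrite /L2norm E.
  split; last by rewrite E.
  by split; [exact: (measurable_normc mh)|exact: measurable_cst].
have [Hf' <-] := A _ Hf; have [Hg' <-] := A _ Hg.
apply: le_trans (L2_CauchySchwarz mO Hf' Hg'); apply: le_trans (le_Re_normc _).
rewrite /= le_eqVlt; apply/orP; left; apply/eqP/eq_Rintegral => p _.
by rewrite oppr0 mul0r subr0.
Qed.

End L2_space.

(** * From area integrals to pointwise bounds of analytic functions *)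

Section box.
Variable R : realType.
Notation mu := (@lebesgue_measure R).
Implicit Types (f : R[i] -> R[i]) (a b c d x y s : R).

Definition box a b c d : set R[i] :=
  [set z | a <= complex.Re z <= b /\ c <= complex.Im z <= d].

Lemma cplx_box a b c d : @cplx R @^-1` box a b c d = `[a, b]%classic `*` `[c, d]%classic.
Proof. by apply/seteqP; split => -[x y] /=; rewrite !in_itv. Qed.

Lemma cmset_box a b c d : cmset (box a b c d).
Proof. by rewrite /cmset cplx_box; exact: measurableX. Qed.

Lemma area_box a b c d : a <= b -> c <= d ->
  @area R (@cplx R @^-1` box a b c d) = ((b - a) * (d - c))%:E.
Proof.
move=> ab cd; rewrite cplx_box.
rewrite (_ : @area R _ = mu `[a, b]%classic * mu `[c, d]%classic)%E; last first.
  by apply: product_measure1E; exact: measurable_itv.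
rewrite EFinM -(fine_lebesgue_itv ab) -(fine_lebesgue_itv cd) !fineK//;
  by rewrite lebesgue_measure_itv/=; case: ifP.
Qed.

Lemma L2_cst_box (k : R[i]) a b c d : a <= b -> c <= d ->
  L2 (box a b c d) (fun=> k) /\
  L2norm (box a b c d) (fun=> k) = normc k * Num.sqrt ((b - a) * (d - c)).
Proof.
move=> ab cd.
have E : L2normsq (box a b c d) (fun=> k) = (normc k ^+ 2 * ((b - a) * (d - c)))%:E.
  rewrite /L2normsq integral_cst ?area_box//; exact: cmset_box.
split; first by split; [exact: cmeas_cst|rewrite E ltry].
by rewrite /L2norm E/= sqrtrM ?exprn_ge0 ?normc_ge0// sqrtr_sqr ger0_norm ?normc_ge0.
Qed.

Lemma average_lt (u v M m : R) (phi : R -> \bar R) : u < v ->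
  measurable_fun `[u, v]%classic phi -> (forall x, 0 <= phi x)%E ->
  (\int[mu]_(x in `[u, v]%classic) phi x <= M%:E)%E -> M < m * (v - u) -> 0 <= m ->
  exists2 x, u <= x <= v & (phi x < m%:E)%E.
Proof.
move=> uv mphi phi0 phiM Mm m0; apply: contrapT => N.
have : (\int[mu]_(x in `[u, v]%classic) (cst m%:E) x <= \int[mu]_(x in `[u, v]%classic) phi x)%E.
  apply: ge0_le_integral => //.
  move=> x /=; rewrite in_itv/= => hx; rewrite leNgt; apply/negP => h; apply: N.
  by exists x.
rewrite integral_cst//= lebesgue_measure_itv/= lte_fin uv => /le_trans/(_ phiM).
by rewrite -EFinB -EFinM lee_fin leNgt Mm.
Qed.

Section good_rectangle.
Variables (f : R[i] -> R[i]) (x0 y0 s : R).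
Hypothesis s0 : 0 < s.
Let B := box (x0 - s) (x0 + s) (y0 - s) (y0 + s).
Hypothesis Lf : L2 B f.

(** The modulus of [f] is extended by 0 from the square to the plane so that Tonelli's theorem
    applies in both orders; [FY] and [FX] below are its integrals along vertical and horizontal
    lines. *)
Let F : measurableTypeR R * measurableTypeR R -> \bar R := (fun p => (normc (f (@cplx R p)))%:E) \_ (@cplx R @^-1` B).

Let mF : measurable_fun setT F.
Proof.
apply/(measurable_restrictT _ (cmset_box _ _ _ _)); apply/measurable_EFinP.
by apply: measurable_normc; case: Lf.
Qed.

Let F0 p : (0 <= F p)%E.
Proof. by rewrite /F patchE; case: ifP => // _; rewrite lee_fin normc_ge0. Qed.

Let FY (x : measurableTypeR R) : \bar R := (\int[mu]_y F (x, y))%E.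
Let FX (y : measurableTypeR R) : \bar R := (\int[mu]_x F (x, y))%E.

Let mFY : measurable_fun setT FY.
Proof. exact: measurable_fun_fubini_tonelli_F. Qed.

Let mFX : measurable_fun setT FX.
Proof. exact: measurable_fun_fubini_tonelli_G. Qed.

Let FY0 x : (0 <= FY x)%E.
Proof. by apply: integral_ge0 => y _; exact: F0. Qed.

Let FX0 x : (0 <= FX x)%E.
Proof. by apply: integral_ge0 => y _; exact: F0. Qed.

Let intFY : (\int[@area R]_p F p = \int[mu]_x FY x)%E.
Proof. exact: fubini_tonelli1. Qed.

Let intFX : (\int[@area R]_p F p = \int[mu]_y FX y)%E.
Proof. by rewrite intFY; exact: fubini_tonelli. Qed.

(** Cauchy-Schwarz against the constant 1, whose norm on the square is [2 * s]. *)
Lemma L1_box : (\int[@area R]_p F p <= (2 * s * L2norm B f)%:E)%E.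
Proof.
have h1 : x0 - s <= x0 + s by move: s0; lra.
have h2 : y0 - s <= y0 + s by move: s0; lra.
have [L1 n1] := L2_cst_box 1 h1 h2.
have mB : cmset B by exact: cmset_box.
have i := cintegrable_norm mB (L2_cintegrableM mB Lf L1).
rewrite -integral_mkcond.
have -> : (\int[@area R]_(p in @cplx R @^-1` B) (normc (f (cplx p)))%:E =
  (\int[@area R]_(p in @cplx R @^-1` B) (normc (f (cplx p)) * normc (1 : R[i])))%:E)%E.
  rewrite /Rintegral fineK; first by apply: eq_integral => p _; rewrite normc1 mulr1.
  have := integrable_fin_num mB i; congr (_ \is a fin_num).
  by apply: eq_integral => p _ /=; rewrite normcM normc_conj.
rewrite lee_fin (le_trans (L2_normM mB Lf L1))// n1 normc1 mul1r.
have -> : x0 + s - (x0 - s) = 2 * s by ring.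
have -> : y0 + s - (y0 - s) = 2 * s by ring.
by rewrite -expr2 sqrtr_sqr ger0_norm ?mulr_ge0 ?(ltW s0)// [leLHS]mulrC.
Qed.

Let I1 := `[x0 - s, x0 + s]%classic.
Let I2 := `[y0 - s, y0 + s]%classic.

Let FE x y : I1 x -> I2 y -> F (x, y) = (normc (f (x +i* y)))%:E.
Proof.
move=> hx hy; rewrite /F patchE ifT// inE.
by move: hx hy; rewrite /I1 /I2 /= !in_itv.
Qed.

(** Averaging over the abscissas in [[u, v]]: the mean of the line integrals is at most the [L^1]
    norm on the square divided by [v - u]. The slack [e] provides the strict inequality, also when
    the norm is 0. *)
Lemma good_vline (u v e : R) : x0 - s <= u -> u < v -> v <= x0 + s -> 0 < e ->
  exists2 a, u <= a <= v &
    forall c d, y0 - s <= c -> d <= y0 + s ->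
      \int[mu]_(y in `[c, d]%classic) normc (f (a +i* y)) <= 2 * s / (v - u) * L2norm B f + e.
Proof.
move=> xu uv vx e0; have vu : 0 < v - u by rewrite subr_gt0.
have n0 := L2norm_ge0 B f.
have [|||||a ha aM] := @average_lt u v (2 * s * L2norm B f) (2 * s / (v - u) * L2norm B f + e) FY uv.
- exact: measurable_funS mFY.
- exact: FY0.
- by apply: le_trans L1_box; rewrite intFY; apply: ge0_subset_integral.
- have -> : (2 * s / (v - u) * L2norm B f + e) * (v - u) = 2 * s * L2norm B f + e * (v - u).
    by field; rewrite gt_eqF.
  by rewrite ltrDl mulr_gt0.
- have k0 : 0 <= 2 * s / (v - u) by rewrite divr_ge0 ?mulr_ge0 ?(ltW s0) ?(ltW vu).
  by rewrite addr_ge0 ?(ltW e0)// mulr_ge0.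
exists a => // c d hc hd.
have Ia : I1 a by rewrite /I1 /= in_itv/=; move: ha => /andP[? ?]; apply/andP; split; lra.
rewrite -lee_fin; apply: le_trans (ltW aM).
have le1 : (\int[mu]_(y in `[c, d]%classic) (normc (f (a +i* y)))%:E <= FY a)%E.
  rewrite (@eq_integral _ _ _ mu _ (fun y => F (a, y))); last first.
    move=> y; rewrite inE/= in_itv/= => /andP[? ?]; rewrite FE// /I2 /= in_itv/=.
    by apply/andP; split; lra.
  by apply: ge0_subset_integral => //; exact: measurable_fun_pair2.
rewrite /Rintegral fineK//.
rewrite ge0_fin_numE; last by apply: integral_ge0 => y _; rewrite lee_fin normc_ge0.
by rewrite (le_lt_trans le1)// (lt_trans aM)// ltry.
Qed.

Lemma good_hline (u v e : R) : y0 - s <= u -> u < v -> v <= y0 + s -> 0 < e ->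
  exists2 c, u <= c <= v &
    forall a b, x0 - s <= a -> b <= x0 + s ->
      \int[mu]_(x in `[a, b]%classic) normc (f (x +i* c)) <= 2 * s / (v - u) * L2norm B f + e.
Proof.
move=> xu uv vx e0; have vu : 0 < v - u by rewrite subr_gt0.
have n0 := L2norm_ge0 B f.
have [|||||a ha aM] := @average_lt u v (2 * s * L2norm B f) (2 * s / (v - u) * L2norm B f + e) FX uv.
- exact: measurable_funS mFX.
- exact: FX0.
- by apply: le_trans L1_box; rewrite intFX; apply: ge0_subset_integral.
- have -> : (2 * s / (v - u) * L2norm B f + e) * (v - u) = 2 * s * L2norm B f + e * (v - u).
    by field; rewrite gt_eqF.
  by rewrite ltrDl mulr_gt0.
- have k0 : 0 <= 2 * s / (v - u) by rewrite divr_ge0 ?mulr_ge0 ?(ltW s0) ?(ltW vu).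
  by rewrite addr_ge0 ?(ltW e0)// mulr_ge0.
exists a => // c d hc hd.
have Ia : I2 a by rewrite /I2 /= in_itv/=; move: ha => /andP[? ?]; apply/andP; split; lra.
rewrite -lee_fin; apply: le_trans (ltW aM).
have le1 : (\int[mu]_(y in `[c, d]%classic) (normc (f (y +i* a)))%:E <= FX a)%E.
  rewrite (@eq_integral _ _ _ mu _ (fun y => F (y, a))); last first.
    move=> y; rewrite inE/= in_itv/= => /andP[? ?]; rewrite FE// /I1 /= in_itv/=.
    by apply/andP; split; lra.
  by apply: ge0_subset_integral => //; exact: measurable_fun_pair1.
rewrite /Rintegral fineK//.
rewrite ge0_fin_numE; last by apply: integral_ge0 => y _; rewrite lee_fin normc_ge0.
by rewrite (le_lt_trans le1)// (lt_trans aM)// ltry.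
Qed.

End good_rectangle.
End box.

Section local_bounds.
Variable R : realType.
Variables (f : R[i] -> R[i]) (z0 : R[i]) (s : R).
Hypothesis s0 : 0 < s.

Definition square (R : realType) (z : R[i]) (s : R) : set R[i] :=
  box (complex.Re z - s) (complex.Re z + s) (complex.Im z - s) (complex.Im z + s).

Let B := square z0 s.
Hypothesis df : forall z, B z -> derivable f z 1.
Hypothesis Lf : L2 B f.

(** The sides are picked in the outer bands of width [s / 2], where the averaging factor
    [2 * s / (s / 2)] is 4, hence 16 for the four of them; every point of the inner square keeps the
    margin [s / 4]. *)
Lemma good_rect (e : R) : 0 < e -> exists a b c d : R,
  [/\ forall z, square z0 (s / 4) z -> in_rect (s / 4) z a b c d,
      on_rect (fun z => derivable f z 1) a b c d &
      bdry_norm f a b c d <= 16 * L2norm B f + e].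
Proof.
move=> e0; have e40 : 0 < e / 4 by rewrite divr_gt0.
have [a /andP[a1 a2] Ha] := @good_vline R f (complex.Re z0) (complex.Im z0) s s0 Lf
  (complex.Re z0 - s) (complex.Re z0 - s / 2) (e / 4) ltac:(move: s0; lra) ltac:(move: s0; lra) ltac:(move: s0; lra) e40.
have [b /andP[b1 b2] Hb] := @good_vline R f (complex.Re z0) (complex.Im z0) s s0 Lf
  (complex.Re z0 + s / 2) (complex.Re z0 + s) (e / 4) ltac:(move: s0; lra) ltac:(move: s0; lra) ltac:(move: s0; lra) e40.
have [c /andP[c1 c2] Hc] := @good_hline R f (complex.Re z0) (complex.Im z0) s s0 Lf
  (complex.Im z0 - s) (complex.Im z0 - s / 2) (e / 4) ltac:(move: s0; lra) ltac:(move: s0; lra) ltac:(move: s0; lra) e40.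
have [d /andP[d1 d2] Hd] := @good_hline R f (complex.Re z0) (complex.Im z0) s s0 Lf
  (complex.Im z0 + s / 2) (complex.Im z0 + s) (e / 4) ltac:(move: s0; lra) ltac:(move: s0; lra) ltac:(move: s0; lra) e40.
exists a, b, c, d; split.
- by move=> z [/andP[h1 h2] /andP[h3 h4]]; move: s0 => ?; split; lra.
- move=> x y /andP[h1 h2] /andP[h3 h4]; apply: df.
  by split => /=; apply/andP; split; lra.
have E (u v : R) : v - u = s / 2 -> 2 * s / (v - u) * L2norm B f + e / 4 = 4 * L2norm B f + e / 4.
  by move=> ->; congr (_ * _ + _); field; rewrite gt_eqF.
have [E1 E2 E3 E4] : [/\ complex.Re z0 - s / 2 - (complex.Re z0 - s) = s / 2,
    complex.Re z0 + s - (complex.Re z0 + s / 2) = s / 2,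
    complex.Im z0 - s / 2 - (complex.Im z0 - s) = s / 2 &
    complex.Im z0 + s - (complex.Im z0 + s / 2) = s / 2] by split; field.
rewrite /bdry_norm.
have := Ha c d c1 d2; have := Hb c d c1 d2; have := Hc a b a1 b2; have := Hd a b a1 b2.
by rewrite !E//; lra.
Qed.

Let limit (X k : R) : 0 <= k -> (forall e, 0 < e -> X <= k * (16 * L2norm B f + e)) ->
  X <= k * (16 * L2norm B f).
Proof.
move=> k0 H; apply/ler_addgt0Pr => e e0.
have e'0 : 0 < e / (k + 1) by rewrite divr_gt0// ltr_wpDl.
apply: le_trans (H _ e'0) _; rewrite mulrDr lerD2l mulrA ler_pdivrMr ?ltr_wpDl//.
by rewrite mulrC ler_pM2l// lerDl.
Qed.

Let s4 : 0 < s / 4. Proof. by rewrite divr_gt0. Qed.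
Let k0 n : 0 <= (s / 4)^-1 ^+ n. Proof. by rewrite exprn_ge0// invr_ge0 ltW. Qed.

Lemma local_bound z : square z0 (s / 4) z ->
  normc (f z) <= (s / 4)^-1 * (16 * L2norm B f).
Proof.
move=> hz; apply: limit; first exact: (k0 1).
move=> e /good_rect[a [b [c [d [H1 H2 H3]]]]].
apply: le_trans (cauchy_bound s4 H2 (H1 _ hz)) _.
by rewrite ler_wpM2l//; exact: (k0 1).
Qed.

Lemma local_bound_dist z w : square z0 (s / 4) z -> square z0 (s / 4) w ->
  normc (f z - f w) <= normc (z - w) * (s / 4)^-1 ^+ 2 * (16 * L2norm B f).
Proof.
move=> hz hw; apply: limit; first by rewrite mulr_ge0 ?normc_ge0.
move=> e /good_rect[a [b [c [d [H1 H2 H3]]]]].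
apply: le_trans (cauchy_bound_dist s4 H2 (H1 _ hz) (H1 _ hw)) _.
by rewrite ler_wpM2l// mulr_ge0 ?normc_ge0.
Qed.

Lemma local_bound_taylor L z : hasder f z0 L -> square z0 (s / 4) z ->
  normc L <= (s / 4)^-1 ^+ 2 * (16 * L2norm B f) /\
  normc (f z - f z0 - L * (z - z0)) <= normc (z - z0) ^+ 2 * (s / 4)^-1 ^+ 3 * (16 * L2norm B f).
Proof.
move=> HL hz.
have h0 : square z0 (s / 4) z0 by split; apply/andP; split; move: s0; lra.
split; apply: limit => //.
- move=> e /good_rect[a [b [c [d [H1 H2 H3]]]]].
  have [h _] := cauchy_bound_taylor s4 H2 (H1 _ h0) HL.
  by apply: le_trans h _; rewrite ler_wpM2l.
- by rewrite mulr_ge0// exprn_ge0// normc_ge0.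
- move=> e /good_rect[a [b [c [d [H1 H2 H3]]]]].
  have [_ h] := cauchy_bound_taylor s4 H2 (H1 _ h0) HL.
  apply: le_trans (h _ (H1 _ hz)) _; rewrite ler_wpM2l// mulr_ge0//.
  by rewrite exprn_ge0// normc_ge0.
Qed.

End local_bounds.

(** * Point evaluations and completeness of the Bergman space *)

Section bergman_space.
Variable R : realType.
Variable Omega : set R[i].
Hypotheses (oO : open Omega) (mO : cmset Omega).
Implicit Types (f g h : R[i] -> R[i]) (z w : R[i]).

Let H := bergman Omega.
Let ip := L2inner Omega.
Let nrm := L2norm Omega.

Lemma hasderD f g z L L' : hasder f z L -> hasder g z L' -> hasder (f + g) z (L + L').
Proof.
move=> Hf Hg e e0; have e20 : 0 < e / 2 by rewrite divr_gt0.
have [d1 d10 H1] := Hf _ e20; have [d2 d20 H2] := Hg _ e20.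
exists (Num.min d1 d2); first by rewrite lt_min d10.
move=> w; rewrite lt_min => /andP[w1 w2].
have -> : (f + g) w - (f + g) z - (L + L') * (w - z) =
  (f w - f z - L * (w - z)) + (g w - g z - L' * (w - z)).
  by rewrite !(_ : forall v, (f + g) v = f v + g v)//; ring.
rewrite (le_trans (le_normcD _ _))// (splitr e) mulrDl lerD//; [exact: H1|exact: H2].
Qed.

Lemma hasderZ c f z L : hasder f z L -> hasder (c *: f) z (c * L).
Proof.
move=> Hf e e0; have K0 : 0 < 1 + normc c by rewrite ltr_pwDl// normc_ge0.
have e'0 : 0 < e / (1 + normc c) by rewrite divr_gt0.
have [d d0 H1] := Hf _ e'0; exists d => // w /H1 h.
have -> : (c *: f) w - (c *: f) z - c * L * (w - z) = c * (f w - f z - L * (w - z)).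
  by rewrite !(_ : forall v, (c *: f) v = c * f v)//; ring.
rewrite normcM (le_trans (ler_wpM2l (normc_ge0 c) h))// mulrA ler_wpM2r ?normc_ge0//.
rewrite mulrCA ler_piMr ?(ltW e0)// ler_pdivrMr// mul1r lerDr//.
Qed.

Lemma bergman_hasder f z : H f -> Omega z -> exists L, hasder f z L.
Proof. by move=> [af _ _] Oz; apply/derivableE; exact: af. Qed.

Lemma bergman_L2 : H `<=` L2 Omega.
Proof. by move=> f []. Qed.

Lemma bergman_subspace : subspace H.
Proof.
have [L0 LD] := L2_subspace mO; split.
  by split => // z _; exact: derivable_cst.
move=> c f g Hf Hg; split.
- move=> z Oz; have [L HL] := bergman_hasder Hf Oz; have [L' HL'] := bergman_hasder Hg Oz.
  by apply/derivableE; exists (c * L + L'); apply: hasderD => //; exact: hasderZ.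
- by apply: LD; exact: bergman_L2.
- move=> z nOz; have [_ _ f0] := Hf; have [_ _ g0] := Hg.
  by rewrite (_ : (c *: f + g) z = c * f z + g z)// f0// g0// mulr0 addr0.
Qed.

Lemma semi_innerS (V : lmodType R[i]) (A B : set V) (q : V -> V -> R[i]) :
  A `<=` B -> semi_inner B q -> semi_inner A q.
Proof. by move=> AB [h1 h2 h3]; split; auto. Qed.

Lemma bergman_semi_inner : semi_inner H ip.
Proof. exact: semi_innerS bergman_L2 (L2_semi_inner mO). Qed.

Lemma square_sub z : Omega z -> exists2 s : R, 0 < s & square z s `<=` Omega.
Proof.
move=> Oz; have /nbhs_complexP[d d0 Hd] : nbhs z Omega by exact: open_nbhs_nbhs.
exists (d / 3); first by rewrite divr_gt0.
move=> w [/andP[h1 h2] /andP[h3 h4]]; apply: Hd.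
rewrite (le_lt_trans (le_normc_ReIm _))// cReD cImD cReN cImN.
have : `|complex.Re w - complex.Re z| <= d / 3 by rewrite ler_norml; apply/andP; split; lra.
have : `|complex.Im w - complex.Im z| <= d / 3 by rewrite ler_norml; apply/andP; split; lra.
lra.
Qed.

Lemma square_center z (s : R) : 0 <= s -> square z s z.
Proof. by move=> s0; split; apply/andP; split; lra. Qed.

Section at_point.
Variables (z0 : R[i]) (s : R).
Hypotheses (s0 : 0 < s) (sO : square z0 s `<=` Omega).

Let mB : cmset (square z0 s). Proof. exact: cmset_box. Qed.

Let df f : H f -> forall z, square z0 s z -> derivable f z 1.
Proof. by move=> [af _ _] z /sO; exact: af. Qed.

Let Lf f : H f -> L2 (square z0 s) f.
Proof. by move=> /bergman_L2; exact: L2S. Qed.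

Let nle f : H f -> L2norm (square z0 s) f <= nrm f.
Proof. by move=> /bergman_L2; exact: L2normS. Qed.

Lemma bergman_bound f z : H f -> square z0 (s / 4) z ->
  normc (f z) <= (s / 4)^-1 * 16 * nrm f.
Proof.
move=> Hf hz; apply: le_trans (local_bound s0 (df Hf) (Lf Hf) hz) _.
by rewrite -mulrA ler_wpM2l ?invr_ge0 ?divr_ge0 ?(ltW s0)// ler_wpM2l// nle.
Qed.

Lemma bergman_taylor f L z : H f -> hasder f z0 L -> square z0 (s / 4) z ->
  normc L <= (s / 4)^-1 ^+ 2 * 16 * nrm f /\
  normc (f z - f z0 - L * (z - z0)) <= normc (z - z0) ^+ 2 * (s / 4)^-1 ^+ 3 * 16 * nrm f.
Proof.
move=> Hf HL hz.
have [h1 h2] := local_bound_taylor s0 (df Hf) (Lf Hf) HL hz.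
have kn : 16 * L2norm (square z0 s) f <= 16 * nrm f by rewrite ler_wpM2l// nle.
have k0 n : 0 <= (s / 4)^-1 ^+ n by rewrite exprn_ge0// invr_ge0 divr_ge0// ltW.
split.
  by apply: le_trans h1 _; rewrite -mulrA; apply: ler_wpM2l.
apply: le_trans h2 _; rewrite -[leRHS]mulrA; apply: ler_wpM2l => //.
by rewrite mulr_ge0// exprn_ge0// normc_ge0.
Qed.
End at_point.

(** Point evaluations are bounded by the norm, and values outside [Omega] are 0 by the chosen
    representation: on this set of functions the seminorm is a norm. *)
Lemma bergman_definite f : H f -> nrm f = 0 -> f = 0.
Proof.
move=> Hf n0; apply/funext => z; have [Oz|nOz] := pselect (Omega z); last by have [_ _ ->] := Hf.
have [s s0 sO] := square_sub Oz.
have := bergman_bound s0 sO Hf (square_center _ (ltW (divr_gt0 s0 (ltr0n R 4)))).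
rewrite n0 mulr0 => h; apply/eqP; rewrite -normc_eq0; apply/eqP/le_anti.
by rewrite h normc_ge0.
Qed.

Section limit.
Variables (u : nat -> R[i] -> R[i]) (f : R[i] -> R[i]).
Hypotheses (Hu : forall n, H (u n)) (cu : icauchy ip u).
Hypothesis uf : forall z, ctends (fun n => u n z) (f z).

Let cu' e : 0 < e -> exists N, forall n m, (N <= n)%N -> (N <= m)%N -> nrm (u n - u m) < e.
Proof. by move=> /cu[N HN]; exists N => n m Nn Nm; rewrite /nrm L2norm_inorm; exact: HN. Qed.

Let HB n m : H (u n - u m).
Proof. exact: (subB bergman_subspace). Qed.

Lemma limit_cmeasurable : cmeasurable Omega f.
Proof.
have mu n : cmeasurable Omega (u n) by have [_ []] := Hu n.
split.
  apply: (@measurable_fun_cvg _ _ _ _ (fun n p => complex.Re (u n (cplx p)))).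
    by move=> n; have [] := mu n.
  by move=> p _; apply: ctends_Re; exact: uf.
apply: (@measurable_fun_cvg _ _ _ _ (fun n p => complex.Im (u n (cplx p)))).
  by move=> n; have [] := mu n.
by move=> p _; apply: ctends_Im; exact: uf.
Qed.

(** Fatou's lemma for [u n - u m] as [m] grows: a pointwise limit inherits the Cauchy bound. *)
Lemma limit_L2normsq (e : R) N n : 0 < e ->
  (forall m, (N <= m)%N -> nrm (u n - u m) < e) -> (L2normsq Omega (u n - f)%R <= (e ^+ 2)%:E)%E.
Proof.
move=> e0 HN.
pose F m := (fun p => (sqf (u n - u (N + m)%N) p)%:E).
have LF m : L2 Omega (u n - u (N + m)%N) by apply: bergman_L2; exact: HB.
have mF m : measurable_fun (@cplx R @^-1` Omega) (F m).
  by apply/measurable_EFinP; apply: measurable_sqf; case: (LF m).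
have F0 m p : (@cplx R @^-1` Omega) p -> (0 <= F m p)%E by move=> _; rewrite lee_fin sqf_ge0.
have := fatou (@area R) mO mF F0.
rewrite (eq_integral (fun p => (normc ((u n - f) (cplx p)) ^+ 2)%:E)); last first.
  move=> p _; apply: (cvg_limn_einf_sup _).1.
  apply: cvg_EFin; first by near=> m.
  rewrite /F /sqf/=; apply: (ctends_normc_sqr (v := fun m => u n (cplx p) - u (N + m)%N (cplx p))).
  apply: ctendsB; first exact: ctends_cst.
  move=> r /(uf (cplx p))[M HM]; exists M => m Mm; apply: HM.
  by rewrite (leq_trans Mm)// leq_addl.
move=> /le_trans; apply; rewrite limn_einf_lim; apply: lime_le; first exact: is_cvg_einfs.
near=> m.
apply: (@le_trans _ _ (\int[@area R]_(x in @cplx R @^-1` Omega) F m x)%E).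
  by apply: ereal_inf_lbound; exists m => //=.
have -> : (\int[@area R]_(x in @cplx R @^-1` Omega) F m x = L2normsq Omega (u n - u (N + m)%N)%R)%E by [].
rewrite -sqr_L2norm// lee_fin ler_pXn2r ?nnegrE ?L2norm_ge0 ?(ltW e0)//.
by apply/ltW/HN; rewrite leq_addr.
Unshelve. all: by end_near. Qed.

Lemma limit_L2 : L2 Omega f.
Proof.
have [N HN] := cu' ltr01.
have h := limit_L2normsq ltr01 (fun m => HN N m (leqnn _)).
have Ld : L2 Omega (u N - f).
  split; last by apply: le_lt_trans h _; rewrite ltry.
  by apply: cmeasB; [have [_ []] := Hu N|exact: limit_cmeasurable].
have -> : f = u N - (u N - f) by rewrite subKr.
by apply: (subB (L2_subspace mO)) => //; exact: bergman_L2.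
Qed.

Lemma limit_nrm e : 0 < e -> exists N, forall n, (N <= n)%N -> nrm (u n - f) < e.
Proof.
move=> e0; have e20 : 0 < e / 2 by rewrite divr_gt0.
have [N HN] := cu' e20; exists N => n Nn.
have h := limit_L2normsq e20 (fun m => HN n m Nn).
have Ld : L2 Omega (u n - f).
  by apply: (subB (L2_subspace mO)); [exact: bergman_L2|exact: limit_L2].
move: h; rewrite -sqr_L2norm// lee_fin ler_pXn2r ?nnegrE ?L2norm_ge0 ?(ltW e20)//.
by move=> /le_lt_trans; apply; rewrite ltr_pdivrMr// mulr_natr mulr2n ltrDl.
Qed.

(** The derivatives at [z] are Cauchy by the Taylor estimate for [u n - u m]. The quadratic
    remainder of [u n] is uniform in large [n], because the norms are bounded, and so survives in
    the limit. *)
Lemma limit_analytic : analytic_on Omega f.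
Proof.
move=> z Oz; have [s s0 sO] := square_sub Oz.
have /choice[L HL] n := bergman_hasder (Hu n) Oz.
have hz : square z (s / 4) z by apply: square_center; rewrite divr_ge0// ltW.
have k0 n : 0 <= (s / 4)^-1 ^+ n by rewrite exprn_ge0// invr_ge0 divr_ge0// ltW.
pose K1 := (s / 4)^-1 ^+ 2 * 16 + 1.
have K10 : 0 < K1 by rewrite ltr_wpDl// mulr_ge0.
have LB n m : normc (L n - L m) <= K1 * nrm (u n - u m).
  have h : hasder (u n - u m) z (L n - L m).
    rewrite -(scaleN1r (u m)) -[- L m]mulN1r; apply: hasderD; first exact: HL.
    by apply: hasderZ; exact: HL.
  have [+ _] := bergman_taylor s0 sO (HB n m) h hz.
  by move=> /le_trans; apply; rewrite ler_wpM2r ?L2norm_ge0// /K1 lerDl.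
have [l Hl] : exists l, ctends L l.
  apply: ctends_complete => e e0; have e'0 : 0 < e / K1 by rewrite divr_gt0.
  have [N HN] := cu' e'0; exists N => n m Nn Nm.
  apply: le_lt_trans (LB n m) _; have := HN n m Nn Nm.
  by rewrite ltr_pdivlMr// mulrC.
have [N HN] := cu' ltr01.
pose M := nrm (u N) + 1.
have uM n : (N <= n)%N -> nrm (u n) <= M.
  move=> Nn; have := HN n N Nn (leqnn _).
  have := nrmD bergman_subspace bergman_semi_inner (HB n N) (Hu N).
  by rewrite subrK -!L2norm_inorm /M -/nrm; lra.
pose K := (s / 4)^-1 ^+ 3 * 16 * M + 1.
have M0 : 0 <= M by rewrite addr_ge0// L2norm_ge0.
have K0 : 0 < K by rewrite ltr_wpDl// mulr_ge0// mulr_ge0.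
apply/derivableE; exists l => e e0.
exists (Num.min (s / 4) (e / K)); first by rewrite lt_min !divr_gt0.
move=> w; rewrite lt_min => /andP[w1 w2].
have hw : square z (s / 4) w.
  have := le_lt_trans (le_normr_Re (w - z)) w1; have := le_lt_trans (le_normr_Im (w - z)) w1.
  rewrite cReD cReN cImD cImN !ltr_norml => /andP[? ?] /andP[? ?].
  by split; apply/andP; split; lra.
have : normc (f w - f z - l * (w - z)) <= normc (w - z) ^+ 2 * K.
  have T : ctends (fun n => u n w - u n z - L n * (w - z)) (f w - f z - l * (w - z)).
    by apply: ctendsB; [apply: ctendsB|exact: ctendsZr].
  apply: (ctends_le (N := N) T) => n Nn.
  have [_ h] := bergman_taylor s0 sO (Hu n) (HL n) hw.
  have kM : (s / 4)^-1 ^+ 3 * 16 * nrm (u n) <= K.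
    apply: (@le_trans _ _ ((s / 4)^-1 ^+ 3 * 16 * M)); last by rewrite lerDl.
    by rewrite ler_wpM2l ?uM// mulr_ge0.
  apply: le_trans h _.
  have -> : normc (w - z) ^+ 2 * (s / 4)^-1 ^+ 3 * 16 * nrm (u n) =
    normc (w - z) ^+ 2 * ((s / 4)^-1 ^+ 3 * 16 * nrm (u n)) by ring.
  by rewrite ler_wpM2l// exprn_ge0// normc_ge0.
move=> /le_trans; apply; rewrite expr2 -mulrA [leRHS]mulrC ler_wpM2l ?normc_ge0//.
by rewrite -ler_pdivlMr// ltW.
Qed.

End limit.

Theorem bergman_complete : icomplete H ip.
Proof.
move=> u Hu cu.
have /choice[f Hf] : forall z, exists l, ctends (fun n => u n z) l.
  move=> z; apply: ctends_complete => e e0.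
  have [Oz|nOz] := pselect (Omega z); last first.
    by exists 0%N => n m _ _; have [_ _ ->//] := Hu n; have [_ _ ->//] := Hu m; rewrite subrr normc0.
  have [s s0 sO] := square_sub Oz.
  have hz : square z (s / 4) z by apply: square_center; rewrite divr_ge0// ltW.
  have K0 : 0 < (s / 4)^-1 * 16 by rewrite mulr_gt0// invr_gt0 divr_gt0.
  have e'0 : 0 < e / ((s / 4)^-1 * 16) by rewrite divr_gt0.
  have [N HN] := cu _ e'0; exists N => n m Nn Nm.
  have := bergman_bound s0 sO (subB bergman_subspace (Hu n) (Hu m)) hz.
  move=> /le_lt_trans; apply; have := HN n m Nn Nm.
  by rewrite -L2norm_inorm ltr_pdivlMr// mulrC.
exists f; first split.
- exact: limit_analytic Hu cu Hf.
- exact: limit_L2 Hu cu Hf.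
- move=> z nOz; apply: ctends_unique (Hf z) _.
  by move=> e e0; exists 0%N => n _; have [_ _ ->//] := Hu n; rewrite subrr normc0.
- move=> e e0; have [N HN] := limit_nrm Hu cu Hf e0; exists N => n Nn.
  by rewrite -L2norm_inorm; exact: HN.
Qed.

End bergman_space.

(** * Toeplitz operators: boundedness, adjoints and a Fredholm criterion *)

Section toeplitz_operators.
Variable R : realType.
Variable Omega : set R[i].
Hypotheses (oO : open Omega) (mO : cmset Omega).
Implicit Types (a f g h k : R[i] -> R[i]).

Let H := bergman Omega.
Let ip := L2inner Omega.
Let nrm := L2norm Omega.
Let sH : subspace H := bergman_subspace mO.
Let sip : semi_inner H ip := bergman_semi_inner mO.
Let sL : subspace (L2 Omega) := L2_subspace mO.
Let sipL : semi_inner (L2 Omega) ip := L2_semi_inner mO.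
Let HL : H `<=` L2 Omega := @bergman_L2 R Omega.

(** The bound is required at every point instead of almost everywhere, which allows pointwise
    estimates. Array symbols satisfy it, and it implies [Linfty]. *)
Definition bounded_symbol a (A : R) :=
  cmeasurable Omega a /\ forall z, normc (a z) <= A.

Lemma bounded_symbol_conj a A : bounded_symbol a A -> bounded_symbol (fun z => (a z)^*) A.
Proof. by move=> [ma aA]; split; [exact: cmeasJ|move=> z; rewrite normc_conj]. Qed.

Lemma bounded_symbol_ge0 a A : bounded_symbol a A -> 0 <= A.
Proof. by move=> [_ /(_ 0)]; apply: le_trans; exact: normc_ge0. Qed.

Lemma L2_mul a A f : bounded_symbol a A -> L2 Omega f ->
  L2 Omega (a \* f) /\ nrm (a \* f) <= A * nrm f.
Proof.
move=> ba; have A0 := bounded_symbol_ge0 ba; have [ma aA] := ba.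
move=> Lf; have [mf If] := (L2P f mO).1 Lf.
have maf : cmeasurable Omega (a \* f) by apply: cmeasM.
have le p : sqf (a \* f) p <= A ^+ 2 * sqf f p.
  rewrite /sqf /= normcM exprMn ler_wpM2r ?exprn_ge0 ?normc_ge0//.
  by rewrite ler_pXn2r ?nnegrE ?normc_ge0.
have Laf : L2 Omega (a \* f).
  apply/(L2P _ mO); split => //.
  apply: (@le_integrable _ _ _ _ _ mO _ (fun p => (A ^+ 2)%:E * (EFin \o sqf f) p)%E).
  - by apply/measurable_EFinP; apply: measurable_sqf.
  - move=> p _ /=; rewrite lee_fin !ger0_norm ?sqf_ge0//.
    by rewrite mulr_ge0 ?sqf_ge0 ?exprn_ge0.
  - exact: integrableZl.
split=> //.
rewrite -(@ler_pXn2r _ 2) ?nnegrE ?L2norm_ge0 ?mulr_ge0 ?L2norm_ge0// exprMn.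
rewrite -lee_fin [leRHS]EFinM !sqr_L2norm//.
rewrite /L2normsq -ge0_integralZl ?lee_fin ?exprn_ge0//; last 2 first.
- by apply/measurable_EFinP; apply: measurable_sqf.
- by move=> p _; rewrite lee_fin sqf_ge0.
apply: ge0_le_integral => //.
- by move=> p _; rewrite lee_fin sqf_ge0.
- by apply/measurable_EFinP; apply: measurable_sqf.
- by apply/measurable_EFinP; apply: measurable_funM => //; apply: measurable_sqf.
- by move=> p _; rewrite lee_fin; exact: le.
Qed.

(** [projection], with [L2 Omega] as ambient space and the complete subspace [bergman Omega],
    supplies a witness, so [xget] returns a genuine projection and not its default value. *)
Lemma bergman_projP g : L2 Omega g -> H (bergman_proj Omega g) /\
  forall k, H k -> ip (g - bergman_proj Omega g) k = 0.
Proof.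
move=> Lg; apply: (@xgetPex _ _ [set h | bergman Omega h /\
                  forall k, bergman Omega k -> L2inner Omega (g - h) k = 0]).
have [h Hh Hk] := projection sL sipL HL sH (bergman_complete oO mO) Lg.
by exists h.
Qed.

Lemma toeplitz_mem a A f : bounded_symbol a A -> H f -> H (toeplitz Omega a f).
Proof. by move=> ba Hf; have [] := bergman_projP (L2_mul ba (HL Hf)).1. Qed.

Lemma toeplitz_ip a A f k : bounded_symbol a A -> H f -> H k ->
  ip (toeplitz Omega a f) k = ip (a \* f) k.
Proof.
move=> ba Hf Hk; have Laf := (L2_mul ba (HL Hf)).1.
have [Hp /(_ _ Hk)] := bergman_projP Laf.
rewrite (ipBl sL sipL)//; [|exact: HL|exact: HL].
by move=> /eqP; rewrite subr_eq0 => /eqP ->.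
Qed.

(** Used to prove linearity of Toeplitz operators by pairing with Bergman functions, where
    [toeplitz_ip] removes the projection. *)
Lemma bergman_ext g h : H g -> H h -> (forall k, H k -> ip g k = ip h k) -> g = h.
Proof.
move=> Hg Hh E; have Hd := subB sH Hg Hh.
have : ip (g - h) (g - h) = 0 by rewrite (ipBl sH sip)// E// subrr.
rewrite (ipff sip)// => /complexI/eqP; rewrite expf_eq0/= => /eqP.
rewrite -L2norm_inorm => /(bergman_definite oO mO Hd)/eqP.
by rewrite subr_eq0 => /eqP.
Qed.

Lemma toeplitz_linear a A c f g : bounded_symbol a A -> H f -> H g ->
  toeplitz Omega a (c *: f + g) = c *: toeplitz Omega a f + toeplitz Omega a g.
Proof.
move=> ba Hf Hg; have Hfg := sH.2 c _ _ Hf Hg.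
have [Tf Tg] := (toeplitz_mem ba Hf, toeplitz_mem ba Hg).
apply: bergman_ext; [exact: (toeplitz_mem ba)|exact: sH.2|].
move=> k Hk; rewrite (toeplitz_ip ba)// (ipDl sip)//; last exact: (subZ sH).
rewrite (ipZl sH sip)// !(toeplitz_ip ba)//.
have [[Lf Lg] Lk] := (HL Hf, HL Hg, HL Hk).
have [Laf Lag] := ((L2_mul ba Lf).1, (L2_mul ba Lg).1).
have -> : c * ip (a \* f) k + ip (a \* g) k = ip (c *: (a \* f) + a \* g) k.
  by rewrite (ipDl sipL (subZ sL c Laf) Lag Lk) (ipZl sL sipL).
have -> // : a \* (c *: f + g) = c *: (a \* f) + a \* g.
apply/funext => z; transitivity (a z * (c * f z + g z)) => //.
by rewrite mulrDr mulrCA.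
Qed.

Lemma toeplitz_bound a A f : bounded_symbol a A -> H f ->
  nrm (toeplitz Omega a f) <= A * nrm f.
Proof.
move=> ba Hf; have Tf := toeplitz_mem ba Hf.
have [Laf le] := L2_mul ba (HL Hf).
apply: le_trans le; set t := toeplitz Omega a f in Tf *.
have : nrm t ^+ 2 <= nrm (a \* f) * nrm t.
  have -> : nrm t ^+ 2 = normc (ip t t).
    by rewrite (ipff sip)// -L2norm_inorm normc_real ger0_norm// exprn_ge0// L2norm_ge0.
  rewrite {1}/t (toeplitz_ip ba)//.
  by apply: L2_CauchySchwarz => //; exact: HL.
rewrite expr2; have := L2norm_ge0 Omega t; rewrite -/nrm le_eqVlt => /predU1P[<- _|t0].
  exact: L2norm_ge0.
by rewrite ler_pM2r.
Qed.

Lemma toeplitz_adjoint a A f g : bounded_symbol a A -> H f -> H g ->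
  ip (toeplitz Omega a f) g = ip f (toeplitz Omega (fun z => (a z)^*) g).
Proof.
move=> ba Hf Hg; have ba' := bounded_symbol_conj ba.
rewrite (ipC sip (toeplitz_mem ba' Hg) Hf) (toeplitz_ip ba Hf Hg) (toeplitz_ip ba' Hg Hf).
rewrite -(ipC sipL (L2_mul ba' (HL Hg)).1 (HL Hf)).
apply: eq_cint => p _ /=.
case: (f _) => f1 f2; case: (g _) => g1 g2; case: (a _) => a1 a2.
by apply/eqP; rewrite eq_complex/=; apply/andP; split; apply/eqP; ring.
Qed.

Theorem toeplitz_bounded a A : bounded_symbol a A ->
  bounded_operator H nrm (toeplitz Omega a).
Proof.
move=> ba; split.
- by move=> f; exact: (toeplitz_mem ba).
- by move=> c f g Hf Hg; exact: (toeplitz_linear c ba Hf Hg).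
- by exists A => f; exact: (toeplitz_bound ba).
Qed.

Section shifted.
Variables (a : R[i] -> R[i]) (A : R) (mu : R[i]).
Hypothesis ba : bounded_symbol a A.
Let T f := toeplitz Omega a f - mu *: f.

Lemma shift_mem f : H f -> H (T f).
Proof. by move=> Hf; apply: (subB sH); [exact: (toeplitz_mem ba)|exact: (subZ sH)]. Qed.

Lemma shift_linear c f g : H f -> H g -> T (c *: f + g) = c *: T f + T g.
Proof.
move=> Hf Hg; rewrite /T (toeplitz_linear c ba Hf Hg) !scalerDr scalerN !scalerA [mu * c]mulrC.
by rewrite opprD addrACA.
Qed.

Lemma shift_bound f : H f -> nrm (T f) <= (A + normc mu) * nrm f.
Proof.
move=> Hf; have Tf := toeplitz_mem ba Hf; have mf := subZ sH mu Hf.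
have := nrmB sH sip Tf mf; rewrite (nrmZ sH sip)// -!L2norm_inorm => /le_trans; apply.
by rewrite mulrDl lerD2r (toeplitz_bound ba).
Qed.

End shifted.

(** Lower bounds for the operator and for its adjoint, which has the conjugate symbol, make it
    bijective: kernel and cokernel have dimension 0. *)
Theorem toeplitz_fredholm a A mu C : bounded_symbol a A ->
  (forall f, H f -> nrm f <= C * nrm (toeplitz Omega a f - mu *: f)) ->
  (forall f, H f -> nrm f <= C * nrm (toeplitz Omega (fun z => (a z)^*) f - mu^* *: f)) ->
  fredholm H nrm (fun f => toeplitz Omega a f - mu *: f).
Proof.
move=> ba lb lb'; have ba' := bounded_symbol_conj ba.
have surj : forall g, H g -> exists2 f, H f & toeplitz Omega a f - mu *: f = g.
  apply: (surjective_of_bounded_below sH sip (bergman_complete oO mO) _ (B := fun f => toeplitz Omega (fun z => (a z)^*) f - mu^* *: f) (C := C) (M := A + normc mu)).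
  - by move=> f Hf; rewrite -L2norm_inorm; exact: (bergman_definite oO mO).
  - by move=> f; exact: (shift_mem mu ba).
  - by move=> f; exact: (shift_mem mu^* ba').
  - by move=> c f g Hf Hg; exact: (shift_linear mu ba c Hf Hg).
  - move=> f g Hf Hg.
    rewrite (ipBl sH sip)//; [|exact: (toeplitz_mem ba)|exact: (subZ sH)].
    rewrite (ipBr sH sip)//; [|exact: (toeplitz_mem ba')|exact: (subZ sH)].
    by rewrite (toeplitz_adjoint ba)// (ipZl sH sip)// (ipZr sH sip)// conjCK.
  - by move=> f Hf; rewrite -!L2norm_inorm; exact: (shift_bound mu ba).
  - by move=> f Hf; rewrite -!L2norm_inorm; exact: lb.
  - by move=> f Hf; rewrite -!L2norm_inorm; exact: lb'.
split.
- exists 0%N, (fun=> 0); split; [by case|by move=> c _ []|].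
  move=> f [Hf E]; exists (fun=> 0); rewrite big_ord0.
  apply: (bergman_definite oO mO Hf); apply/le_anti; rewrite L2norm_ge0 andbT.
  have := lb _ Hf; rewrite E.
  have -> : nrm 0 = 0 by rewrite /nrm L2norm_inorm; exact: (nrm0 sH sip).
  by rewrite mulr0.
- by move=> g Hg _; exact: surj.
- exists 0%N, (fun=> 0); split; first by case.
  move=> h Hh; have [f Hf E] := surj _ Hh; exists f, (fun=> 0).
  by rewrite big_ord0 addr0 E.
Qed.

End toeplitz_operators.

(** * The strip as a periodic domain *)

Section translation.
Variable R : realType.
Notation mu := (@lebesgue_measure R).

Definition hshift (t : R) : measurableTypeR R -> measurableTypeR R := fun x => x - t.

Lemma measurable_hshift t : measurable_fun setT (hshift t).
Proof. by apply: measurable_funB. Qed.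

(** Both measures agree on half-open intervals, which determine Lebesgue measure; [area_shift]
    argues in the same way with measurable rectangles. *)
Lemma lebesgue_measure_shift t (A : set R) : measurable A ->
  pushforward mu (hshift t) A = mu A.
Proof.
move=> mA; pose mf := isMeasurableFun.Build _ _ _ _ _ (measurable_hshift t).
pose f : {mfun _ >-> _} := HB.pack (hshift t) mf.
rewrite [LHS](_ : _ = pushforward mu f A)//.
apply/esym/lebesgue_measure_unique => //= _ [[a b]] _ <-.
rewrite /pushforward.
have -> : f @^-1` `]a, b]%classic = `]a + t, b + t]%classic.
  by apply/seteqP; split => x /=; rewrite !in_itv/= /hshift ltrBrDr lerBlDr.
rewrite !lebesgue_measure_itv/= !lte_fin ltrD2r.
by case: ifP => // _; rewrite -!EFinB; congr EFin; ring.
Qed.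

Definition pshift (t : R) (p : measurableTypeR R * measurableTypeR R) :
  measurableTypeR R * measurableTypeR R := (hshift t p.1, p.2).

Lemma measurable_pshift t : measurable_fun setT (pshift t).
Proof.
apply: measurable_fun_pair; last exact: measurable_snd.
exact: (measurableT_comp (measurable_hshift t) measurable_fst).
Qed.

Lemma area_shift t A : measurable A -> pushforward (@area R) (pshift t) A = @area R A.
Proof.
move=> mA; pose mf := isMeasurableFun.Build _ _ _ _ _ (measurable_pshift t).
pose f : {mfun _ >-> _} := HB.pack (pshift t) mf.
rewrite [LHS](_ : _ = pushforward (@area R) f A)//.
apply/esym/product_measure_unique => //= B C mB mC.
rewrite /pushforward.
have -> : f @^-1` (B `*` C) = (hshift t @^-1` B) `*` C by [].
rewrite [LHS]product_measure1E//; last first.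
  by rewrite -(setTI (_ @^-1` _)); exact: measurable_hshift.
by congr (_ * _)%E; exact: (lebesgue_measure_shift t mB).
Qed.

Definition translate (t : R) (f : R[i] -> R[i]) : R[i] -> R[i] := fun z => f (z - t%:C).
Definition translate_set (t : R) (D : set R[i]) : set R[i] := [set z | D (z - t%:C)].

Lemma cplx_pshift t p : cplx (pshift t p) = cplx p - t%:C.
Proof. by rewrite /cplx /pshift /hshift complexB subr0. Qed.

Lemma preimage_translate t D :
  @cplx R @^-1` translate_set t D = pshift t @^-1` (@cplx R @^-1` D).
Proof. by apply/seteqP; split => p; rewrite /= /translate_set /= -cplx_pshift. Qed.

Lemma cmset_translate t D : cmset D -> cmset (translate_set t D).
Proof.
move=> mD; rewrite /cmset preimage_translate -(setTI (_ @^-1` _)).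
exact: measurable_pshift.
Qed.

Lemma cmeasurable_translate t D f : cmset D -> cmeasurable D f ->
  cmeasurable (translate_set t D) (translate t f).
Proof.
move=> mD [fR fI]; rewrite /cmeasurable preimage_translate /translate.
have sub : [set pshift t x | x in pshift t @^-1` (@cplx R @^-1` D)] `<=` @cplx R @^-1` D.
  by move=> _ [p Dp <-].
have mp : measurable_fun (pshift t @^-1` (@cplx R @^-1` D)) (pshift t).
  exact: measurable_funTS (measurable_pshift t).
split; under eq_fun do rewrite -cplx_pshift.
  exact: (measurable_comp mD sub fR mp).
exact: (measurable_comp mD sub fI mp).
Qed.

Lemma L2normsq_translate t D f : cmset D -> cmeasurable D f ->
  L2normsq (translate_set t D) (translate t f) = L2normsq D f.
Proof.
move=> mD mf; rewrite /L2normsq preimage_translate.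
transitivity (\int[@area R]_(p in pshift t @^-1` (@cplx R @^-1` D)) ((fun p => (sqf f p)%:E) \o pshift t) p)%E.
  by apply: eq_integral => p _; rewrite /sqf /= cplx_pshift.
have mg : measurable_fun (@cplx R @^-1` D) (fun p => (sqf f p)%:E).
  by apply/measurable_EFinP; exact: measurable_sqf.
have g0 : {in @cplx R @^-1` D, forall p, 0 <= (sqf f p)%:E}%E.
  by move=> p _; rewrite lee_fin sqf_ge0.
have <- := ge0_integral_pushforward (measurable_pshift t) (@area R) mD mg g0.
apply: eq_measure_integral; first exact: measurable_pshift.
by move=> mp A mA _; first [exact: area_shift|exact/esym/area_shift].
Qed.

Lemma L2_translate t D f : cmset D -> L2 D f -> L2 (translate_set t D) (translate t f).
Proof.
move=> mD [mf H]; split; first exact: cmeasurable_translate.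
by rewrite L2normsq_translate.
Qed.

Lemma L2norm_translate t D f : cmset D -> cmeasurable D f ->
  L2norm (translate_set t D) (translate t f) = L2norm D f.
Proof. by move=> mD mf; rewrite /L2norm L2normsq_translate. Qed.

End translation.

(** * Closures, interiors, connectedness and contractions in the plane *)

Section plane_topology.
Variable R : realType.
Implicit Types (z w : R[i]) (A : set R[i]) (x y a b c d : R).

Lemma closure_complexP A z : closure A z <->
  forall e : R, 0 < e -> exists2 w, A w & normc (w - z) < e.
Proof.
split.
  move=> cA e e0; have /cA[w [Aw Bw]] : nbhs z [set w | normc (w - z) < e].
    by apply/nbhs_complexP; exists e.
  by exists w.
move=> H B /nbhs_complexP[e e0 HB]; have [w Aw wz] := H _ e0.
by exists w; split => //; exact: HB.
Qed.

Lemma interior_complexP A z : interior A z <->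
  exists2 e : R, 0 < e & forall w, normc (w - z) < e -> A w.
Proof. exact: nbhs_complexP. Qed.

Lemma open_complexP A : open A <-> forall z, A z ->
  exists2 e : R, 0 < e & forall w, normc (w - z) < e -> A w.
Proof.
rewrite openE; split => H z Az; first exact/interior_complexP/H.
exact/interior_complexP/H.
Qed.

Lemma normc_lt_ReIm z w (e : R) : normc (w - z) < e ->
  (complex.Re z - e < complex.Re w < complex.Re z + e) /\
  (complex.Im z - e < complex.Im w < complex.Im z + e).
Proof.
move=> we; have := le_lt_trans (le_normr_Re _) we; have := le_lt_trans (le_normr_Im _) we.
rewrite cReD cReN cImD cImN !ltr_norml => /andP[? ?] /andP[? ?].
by split; apply/andP; split; lra.
Qed.

Definition obox a b c d : set R[i] :=
  [set z | a < complex.Re z < b /\ c < complex.Im z < d].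

Lemma obox_open a b c d : open (obox a b c d).
Proof.
apply/open_complexP => z [/andP[h1 h2] /andP[h3 h4]].
pose e := Num.min (Num.min (complex.Re z - a) (b - complex.Re z))
                  (Num.min (complex.Im z - c) (d - complex.Im z)).
have [e1 e2 e3 e4] : [/\ e <= complex.Re z - a, e <= b - complex.Re z,
    e <= complex.Im z - c & e <= d - complex.Im z].
  by split; rewrite !ge_min lexx ?orbT.
exists e; first by rewrite !lt_min !subr_gt0 h1 h2 h3 h4.
move=> w /normc_lt_ReIm[/andP[? ?] /andP[? ?]].
by split; apply/andP; split; lra.
Qed.

Lemma closure_obox a b c d : a < b -> c < d -> closure (obox a b c d) = box a b c d.
Proof.
move=> ab cd; apply/seteqP; split => z.
  move=> /closure_complexP H.
  have L (P Q : R) : (forall e : R, 0 < e -> P < Q + e) -> P <= Q.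
    by move=> h; apply/ler_addgt0Pr => e e0; exact/ltW/h.
  split; apply/andP; split; apply: L => e /H[w [/andP[? ?] /andP[? ?]] /normc_lt_ReIm[/andP[? ?] /andP[? ?]]]; lra.
move=> [/andP[h1 h2] /andP[h3 h4]]; apply/closure_complexP => e e0.
(* The point is moved a small fraction [t] of the way to the centre of the box, which puts it
   strictly inside. *)
pose k : R[i] := ((a + b) / 2 - complex.Re z) +i* ((c + d) / 2 - complex.Im z).
have K0 : 0 < 1 + normc k by rewrite ltr_pwDl// normc_ge0.
pose t := Num.min 1 (e / (1 + normc k) / 2).
have t0 : 0 < t by rewrite lt_min ltr01 !divr_gt0.
have t1 : t <= 1 by rewrite ge_min lexx.
have te : t * (1 + normc k) < e.
  have : t <= e / (1 + normc k) / 2 by rewrite ge_min lexx orbT.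
  have -> : e / (1 + normc k) / 2 = e / 2 / (1 + normc k) by rewrite mulrAC.
  by rewrite ler_pdivlMr//; lra.
exists (z + t%:C * k); last first.
  rewrite addrC addKr normcM normc_real gtr0_norm// (le_lt_trans _ te)//.
  by rewrite ler_wpM2l ?(ltW t0)// lerDr.
have ReE : complex.Re (z + t%:C * k) = complex.Re z + t * ((a + b) / 2 - complex.Re z).
  by rewrite cReD cReM /=; ring.
have ImE : complex.Im (z + t%:C * k) = complex.Im z + t * ((c + d) / 2 - complex.Im z).
  by rewrite cImD cImM /=; ring.
split; rewrite ?ReE ?ImE; apply/andP; split; clear -ab cd h1 h2 h3 h4 t0 t1; nra.
Qed.

Lemma interior_box a b c d : interior (box a b c d) = obox a b c d.
Proof.
apply/seteqP; split => z; last first.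
  move=> oz; apply/interior_complexP.
  have /open_complexP/(_ _ oz)[e e0 H] := @obox_open a b c d.
  exists e => // w /H[/andP[? ?] /andP[? ?]]; by split; apply/andP; split; lra.
move=> /interior_complexP[e e0 H].
have H1 (s : R) : `|s| < e -> box a b c d (z + s%:C).
  by move=> se; apply: H; rewrite addrC addKr normc_real.
have H2 (s : R) : `|s| < e -> box a b c d (z + (0 +i* s)).
  by move=> se; apply: H; rewrite addrC addKr normc_imag.
have e2 : `|e / 2| < e by rewrite gtr0_norm; lra.
have ne2 : `|- (e / 2)| < e by rewrite normrN.
have [/andP[_ p1] _] := H1 _ e2; have [/andP[p2 _] _] := H1 _ ne2.
have [_ /andP[_ p3]] := H2 _ e2; have [_ /andP[p4 _]] := H2 _ ne2.
rewrite !cReD/= in p1 p2; rewrite !cImD/= in p3 p4.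
by split; apply/andP; split; lra.
Qed.

Lemma segment_continuous (z0 z : R[i]) : continuous (fun t : R => z0 + t%:C * (z - z0)).
Proof.
move=> t; apply/cvg_complexP => e e0.
have K0 : 0 < 1 + normc (z - z0) by rewrite ltr_pwDl// normc_ge0.
have e'0 : 0 < e / (1 + normc (z - z0)) by rewrite divr_gt0.
near=> s.
have -> : z0 + s%:C * (z - z0) - (z0 + t%:C * (z - z0)) = (s - t)%:C * (z - z0).
  by rewrite rmorphB/=; ring.
rewrite normcM normc_real.
have : `|s - t| < e / (1 + normc (z - z0)).
  by rewrite distrC; near: s; exact: cvgr_dist_lt.
rewrite ltr_pdivlMr//; apply: le_lt_trans.
by rewrite ler_wpM2l// lerDr.
Unshelve. all: by end_near. Qed.

Definition star_shaped (A : set R[i]) z0 :=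
  forall z (t : R), A z -> 0 <= t <= 1 -> A (z0 + t%:C * (z - z0)).

Lemma star_connected A z0 : A z0 -> star_shaped A z0 -> connected A.
Proof.
move=> Az0 sA.
have -> : A = \bigcup_(z in A) ((fun t : R => z0 + t%:C * (z - z0)) @` `[0, 1]%classic).
  apply/seteqP; split => z.
    by move=> Az; exists z => //; exists 1; [rewrite /= in_itv/= ler01 lexx|rewrite mul1r addrC subrK].
  by move=> [w Aw [t ht <-]]; apply: sA => //; move: ht; rewrite /= in_itv.
apply: bigcup_connected.
  exists z0 => w Aw; exists 0; first by rewrite /= in_itv/= lexx ler01.
  by rewrite mul0r addr0.
move=> w Aw; apply: connected_continuous_connected; first exact: segment_connected.
by apply: continuous_subspaceT; exact: segment_continuous.
Qed.

Definition convex_plane A := forall z w (t : R), A z -> A w -> 0 <= t <= 1 -> A (z + t%:C * (w - z)).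

Lemma convex_connected A : convex_plane A -> connected A.
Proof.
move=> cA; have [[z Az]|nA] := pselect (A !=set0).
  by apply: (star_connected Az) => w t Aw ht; exact: cA.
have -> : A = set0 by apply/seteqP; split => // z Az; case: nA; exists z.
exact: connected0.
Qed.

(** Contraction along straight segments to the base point. The loop is continuous only within
    [[0, 1]], so continuity of the homotopy is checked relative to the unit square. *)
Lemma convex_simply_connected A : convex_plane A -> simply_connected A.
Proof.
move=> cA; split; first exact: convex_connected.
move=> g [gc gA g01].
pose H (p : R * R) := g p.2 + p.1%:C * (g 0 - g p.2).
exists H; split; rewrite /H /=.
- apply/subspace_continuousP => -[s t] [/= hs ht].
  apply/cvg_complexP => e e0.
  have K0 : 0 < 1 + normc (g 0 - g t) by rewrite ltr_pwDl// normc_ge0.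
  have e20 : 0 < e / 2 by rewrite divr_gt0.
  have e'0 : 0 < e / 2 / (1 + normc (g 0 - g t)) by rewrite divr_gt0.
  have [/= A1 A2] : (\forall t' \near nbhs t, `[0, 1]%classic t' -> normc (g t' - g t) < e / 2) /\
     (\forall s' \near nbhs s, `|s - s'| < e / 2 / (1 + normc (g 0 - g t))).
    split; last by apply: cvgr_dist_lt => //; exact: cvg_id.
    by move/subspace_continuousP : gc => /(_ t ht)/cvg_complexP/(_ _ e20).
  have : \forall p \near nbhs (s, t), `|s - p.1| < e / 2 / (1 + normc (g 0 - g t)) /\
      (`[0, 1]%classic p.2 -> normc (g p.2 - g t) < e / 2).
    by exists ([set s' | `|s - s'| < e / 2 / (1 + normc (g 0 - g t))],
       [set t' | `[0, 1]%classic t' -> normc (g t' - g t) < e / 2]) => // -[].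
  apply: filterS => -[s' t'] /= [h1 h2] [/= hs' ht'].
  have {}h2 := h2 ht'.
  have -> : g t' + s'%:C * (g 0 - g t') - (g t + s%:C * (g 0 - g t)) =
     (1 - s')%:C * (g t' - g t) + (s' - s)%:C * (g 0 - g t).
    by rewrite !rmorphB/= rmorph1; ring.
  rewrite (le_lt_trans (le_normcD _ _))// !normcM !normc_real [ltRHS]splitr ltr_leD//.
    apply: le_lt_trans h2; rewrite ler_piMl ?normc_ge0//.
    by move: hs'; rewrite in_itv/= => /andP[? ?]; rewrite ler_norml; apply/andP; split; lra.
  rewrite distrC; move: h1; rewrite ltr_pdivlMr// => /ltW; apply: le_trans.
  by rewrite ler_wpM2l// lerDr.
- by move=> s t hs ht; apply: cA; [exact: gA|apply: gA; rewrite /= in_itv/= lexx ler01|move: hs; rewrite in_itv].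
- by move=> t ht; rewrite mul0r addr0.
- by move=> t ht; rewrite mul1r addrC subrK.
- move=> s hs; rewrite subrr mulr0 addr0; split=> //.
  by rewrite g01 subrr mulr0 addr0.
Qed.

Lemma bounded_complexP A : bounded_set A <-> exists M : R, forall z, A z -> normc z <= M.
Proof.
split.
  move=> /pinfty_ex_gt0[M /gt0_complexE[x x0 ->] H].
  by exists x => z Az; have := H z Az; rewrite /= normC_normc lecR.
move=> [M H]; exists M%:C; split; first by rewrite complex_real.
move=> x Mx z Az; rewrite /= (le_trans _ (ltW Mx))// normC_normc lecR; exact: H.
Qed.

End plane_topology.

(** * The strip, and the unit square with its Lipschitz boundary curve *)

Section strip_domain.
Variable R : realType.
Implicit Types (z w : R[i]) (x y s t : R).

Definition strip : set R[i] := [set z | - 2^-1 < complex.Im z < 2^-1].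
Definition cell : set R[i] := obox (- 2^-1) 2^-1 (- 2^-1) 2^-1.

Lemma strip_open : open strip.
Proof.
apply/open_complexP => z /andP[h1 h2].
exists (Num.min (complex.Im z + 2^-1) (2^-1 - complex.Im z)).
  by rewrite lt_min; apply/andP; split; lra.
move=> w; rewrite lt_min => /andP[/normc_lt_ReIm[_ /andP[h3 h4]] /normc_lt_ReIm[_ /andP[h5 h6]]].
by apply/andP; split; lra.
Qed.

Lemma strip_cmset : cmset strip.
Proof.
rewrite /cmset (_ : _ @^-1` _ = setT `*` `](- 2^-1), 2^-1[%classic).
  exact: measurableX.
by apply/seteqP; split => -[x y]; rewrite /= in_itv/= => // -[].
Qed.

Lemma convex_comb_itv (a b x y t : R) : a < x < b -> a < y < b -> 0 <= t <= 1 ->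
  a < (1 - t) * x + t * y < b.
Proof.
move=> /andP[x1 x2] /andP[y1 y2] /andP[t0 t1].
have P u v : 0 < u -> 0 < v -> 0 < (1 - t) * u + t * v.
  move=> u0 v0; have [->|tn] := eqVneq t 0; first by rewrite mul0r addr0 subr0 mul1r.
  by rewrite ltr_wpDl ?mulr_ge0 ?subr_ge0 ?(ltW u0)// mulr_gt0// lt_neqAle eq_sym tn.
have p1 : 0 < (1 - t) * (x - a) + t * (y - a) by apply: P; rewrite subr_gt0.
have p2 : 0 < (1 - t) * (b - x) + t * (b - y) by apply: P; rewrite subr_gt0.
by apply/andP; split; lra.
Qed.

Lemma strip_convex : convex_plane strip.
Proof.
move=> z w t hz hw ht.
have E : complex.Im (z + t%:C * (w - z)) = (1 - t) * complex.Im z + t * complex.Im w.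
  by rewrite cImD cImM cImD cImN cReD cReN /=; ring.
by rewrite /strip /= E; exact: convex_comb_itv.
Qed.

Lemma cell_convex : convex_plane cell.
Proof.
move=> z w t [z1 z2] [w1 w2] ht.
have E : complex.Im (z + t%:C * (w - z)) = (1 - t) * complex.Im z + t * complex.Im w.
  by rewrite cImD cImM cImD cImN cReD cReN /=; ring.
have E' : complex.Re (z + t%:C * (w - z)) = (1 - t) * complex.Re z + t * complex.Re w.
  by rewrite cReD cReM cImD cImN cReD cReN /=; ring.
by rewrite /cell /obox /= E E'; split; exact: convex_comb_itv.
Qed.

Lemma half_lt : - 2^-1 < 2^-1 :> R. Proof. lra. Qed.

Lemma frontier_cell : frontier cell =
  box (- 2^-1) 2^-1 (- 2^-1) 2^-1 `\` cell.
Proof.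
have hl := half_lt.
rewrite /frontier /cell closure_obox// (_ : interior (obox _ _ _ _) = obox (- 2^-1) 2^-1 (- 2^-1) 2^-1)//.
have /interior_id -> // := @obox_open R (- 2^-1) 2^-1 (- 2^-1) 2^-1.
Qed.

Lemma frontier_cellP x y : frontier cell (x +i* y) <->
  [/\ - 2^-1 <= x <= 2^-1, - 2^-1 <= y <= 2^-1 &
      [\/ x = - 2^-1, x = 2^-1, y = - 2^-1 | y = 2^-1]].
Proof.
rewrite frontier_cell; split.
  move=> [[/andP[h1 h2] /andP[h3 h4]] N]; rewrite /= in h1 h2 h3 h4; split; try by apply/andP.
  apply: contrapT => M; apply: N.
  have n1 : x != - 2^-1 by apply/eqP => e; apply: M; constructor 1.
  have n2 : x != 2^-1 by apply/eqP => e; apply: M; constructor 2.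
  have n3 : y != - 2^-1 by apply/eqP => e; apply: M; constructor 3.
  have n4 : y != 2^-1 by apply/eqP => e; apply: M; constructor 4.
  have l1 : - 2^-1 < x by rewrite lt_neqAle eq_sym n1.
  have l2 : x < 2^-1 by rewrite lt_neqAle n2.
  have l3 : - 2^-1 < y by rewrite lt_neqAle eq_sym n3.
  have l4 : y < 2^-1 by rewrite lt_neqAle n4.
  by split; apply/andP.
move=> [hx hy H]; split; first by split.
move=> [/andP[h1 h2] /andP[h3 h4]]; rewrite /= in h1 h2 h3 h4.
by case: H => e; subst; lra.
Qed.

(** [square_x] and [square_y] run anticlockwise along the boundary from the lower left corner, a
    quarter of [[0, 1]] per side. Each is a tent of slopes 4 and -4 cut off at [- 1/2] and [1/2],
    the second delayed by [1/4]; clamped tents are Lipschitz, which settles continuity at the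
    corners. *)
Definition clamp x : R := Num.max (- 2^-1) (Num.min 2^-1 x).
Definition square_x t := clamp (Num.min (4 * t - 2^-1) (5 / 2 - 4 * t)).
Definition square_y t := clamp (Num.min (4 * t - 3 / 2) (7 / 2 - 4 * t)).

Lemma square_cases t : 0 <= t <= 1 ->
  [\/ [/\ t <= 1 / 4, square_x t = 4 * t - 2^-1 & square_y t = - 2^-1],
      [/\ 1 / 4 <= t <= 1 / 2, square_x t = 2^-1 & square_y t = 4 * t - 3 / 2],
      [/\ 1 / 2 <= t <= 3 / 4, square_x t = 5 / 2 - 4 * t & square_y t = 2^-1] |
      [/\ 3 / 4 <= t, square_x t = - 2^-1 & square_y t = 7 / 2 - 4 * t]].
Proof.
have lo x : x <= - 2^-1 -> clamp x = - 2^-1.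
  by move=> h; rewrite /clamp min_r ?max_l//; lra.
have hi x : 2^-1 <= x -> clamp x = 2^-1.
  by move=> h; rewrite /clamp min_l ?max_r//; lra.
have md x : - 2^-1 <= x -> x <= 2^-1 -> clamp x = x.
  by move=> h h'; rewrite /clamp min_r ?max_r.
move=> /andP[t0 t1]; rewrite /square_x /square_y.
have [h|h] := leP t (1 / 4).
  constructor 1; split=> //; (rewrite min_l; last by lra).
    by apply: md; lra.
  by apply: lo; lra.
have [h'|h'] := leP t (1 / 2).
  constructor 2; split; first by apply/andP; split; lra.
    by apply: hi; have [?|?] := leP (4 * t - 2^-1) (5 / 2 - 4 * t); lra.
  by rewrite min_l; [apply: md; lra|lra].
have [h''|h''] := leP t (3 / 4).
  constructor 3; split; first by apply/andP; split; lra.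
    by rewrite min_r; [apply: md; lra|lra].
  by apply: hi; have [?|?] := leP (4 * t - 3 / 2) (7 / 2 - 4 * t); lra.
constructor 4; split; first by lra.
  by rewrite min_r; [apply: lo; lra|lra].
by rewrite min_r; [apply: md; lra|lra].
Qed.

Lemma clamp_lip x y : `|clamp x - clamp y| <= `|x - y|.
Proof.
have h1 := ler_norm (x - y); have h2 := ler_norm (y - x); rewrite distrC in h2.
have spec u : [\/ u <= - 2^-1 /\ clamp u = - 2^-1, (- 2^-1 <= u <= 2^-1) /\ clamp u = u |
    2^-1 <= u /\ clamp u = 2^-1].
  rewrite /clamp; have [h|h] := leP u (- 2^-1).
    by constructor 1; rewrite min_r ?max_l//; lra.
  have [h'|h'] := leP u 2^-1; first by constructor 2; rewrite max_r ?(ltW h)// (ltW h).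
  by constructor 3; split; [exact: ltW|rewrite max_r//; lra].
case: (spec x) => [[? ->]|[/andP[? ?] ->]|[? ->]];
case: (spec y) => [[? ->]|[/andP[? ?] ->]|[? ->]];
by rewrite ler_norml; apply/andP; split; lra.
Qed.

Lemma tent_lip (p q s t : R) :
  `|Num.min (4 * t - p) (q - 4 * t) - Num.min (4 * s - p) (q - 4 * s)| <= 4 * `|t - s|.
Proof.
have h1 := ler_norm (t - s); have h2 := ler_norm (s - t); rewrite distrC in h2.
case: (leP (4 * t - p) (q - 4 * t)) => ht; case: (leP (4 * s - p) (q - 4 * s)) => hs;
  rewrite ler_norml; apply/andP; split; lra.
Qed.

Lemma jordan_square : jordan_curve (frontier cell).
Proof.
exists (fun t => square_x t +i* square_y t); split.
- apply: continuous_subspaceT => t; apply/cvg_complexP => e e0.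
  near=> s.
  rewrite complexB (le_lt_trans (le_normc_ReIm _))//=.
  have hx : `|square_x s - square_x t| <= 4 * `|s - t|.
    by apply: le_trans (clamp_lip _ _) _; exact: tent_lip.
  have hy : `|square_y s - square_y t| <= 4 * `|s - t|.
    by apply: le_trans (clamp_lip _ _) _; exact: tent_lip.
  have hs : `|s - t| < e / 8.
    by rewrite distrC; near: s; apply: cvgr_dist_lt; [exact: cvg_id|rewrite divr_gt0].
  by lra.
- have h0 : 0 <= (0 : R) <= 1 by rewrite lexx ler01.
  have h1 : 0 <= (1 : R) <= 1 by rewrite lexx ler01.
  case: (square_cases h0) => [[? -> ->]|[/andP[? ?] -> ->]|[/andP[? ?] -> ->]|[? -> ->]];
  case: (square_cases h1) => [[? -> ->]|[/andP[? ?] -> ->]|[/andP[? ?] -> ->]|[? -> ->]];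
  by congr (_ +i* _); lra.
- move=> s t; rewrite !in_itv/= => /andP[s0 s1] /andP[t0 t1] [].
  have hs : 0 <= s <= 1 by rewrite s0 ltW.
  have ht : 0 <= t <= 1 by rewrite t0 ltW.
  case: (square_cases hs) => [[? -> ->]|[/andP[? ?] -> ->]|[/andP[? ?] -> ->]|[? -> ->]];
  case: (square_cases ht) => [[? -> ->]|[/andP[? ?] -> ->]|[/andP[? ?] -> ->]|[? -> ->]]; lra.
- apply/seteqP; split => [[x y] /frontier_cellP[/andP[x1 x2] /andP[y1 y2] H]|_ [t + <-]].
    have P t : 0 <= t <= 1 -> square_x t = x -> square_y t = y ->
      [set square_x t +i* square_y t | t in `[0, 1]%classic] (x +i* y).
      by move=> ht <- <-; exists t => //; rewrite /= in_itv.
    case: H => e.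
    + have ht : 0 <= (7 / 2 - y) / 4 <= 1 by apply/andP; split; lra.
      by apply: (P _ ht); case: (square_cases ht) => [[? ? ?]|[/andP[? ?] ? ?]|[/andP[? ?] ? ?]|[? ? ?]]; lra.
    + have ht : 0 <= (y + 3 / 2) / 4 <= 1 by apply/andP; split; lra.
      by apply: (P _ ht); case: (square_cases ht) => [[? ? ?]|[/andP[? ?] ? ?]|[/andP[? ?] ? ?]|[? ? ?]]; lra.
    + have ht : 0 <= (x + 2^-1) / 4 <= 1 by apply/andP; split; lra.
      by apply: (P _ ht); case: (square_cases ht) => [[? ? ?]|[/andP[? ?] ? ?]|[/andP[? ?] ? ?]|[? ? ?]]; lra.
    + have ht : 0 <= (5 / 2 - x) / 4 <= 1 by apply/andP; split; lra.
      by apply: (P _ ht); case: (square_cases ht) => [[? ? ?]|[/andP[? ?] ? ?]|[/andP[? ?] ? ?]|[? ? ?]]; lra.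
  rewrite /= in_itv/= => ht; apply/frontier_cellP; move: (ht) => /andP[? ?].
  case: (square_cases ht) => [[? -> ->]|[/andP[? ?] -> ->]|[/andP[? ?] -> ->]|[? -> ->]].
  + by split; [apply/andP; split; lra|apply/andP; split; lra|constructor 3].
  + by split; [apply/andP; split; lra|apply/andP; split; lra|constructor 2].
  + by split; [apply/andP; split; lra|apply/andP; split; lra|constructor 4].
  + by split; [apply/andP; split; lra|apply/andP; split; lra|constructor 1].
Unshelve. all: by end_near. Qed.

Definition graph_at (Gamma : set R[i]) (p : R[i]) :=
  exists (u : R[i]) (phi : R -> R) (d h : R),
      [/\ normc u = 1, lipschitz phi, 0 < d, 0 < h &
          forall s t, `|s| < d -> `|t| < h ->
            Gamma (p + u * (s +i* t)) <-> t = phi s].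

(** This symmetry leaves only the bottom side with its left corner to be examined for the graph
    property. *)
Lemma frontier_cell_rot z : frontier cell ('i * z) <-> frontier cell z.
Proof.
case: z => x y.
have -> : 'i * (x +i* y) = (- y) +i* x by apply/eqP; rewrite eq_complex/=; apply/andP; split; apply/eqP; ring.
split => /frontier_cellP[/andP[h1 h2] /andP[h3 h4] H]; apply/frontier_cellP; split;
  try (by apply/andP; split; lra).
  by case: H => e; [constructor 4|constructor 3|constructor 1|constructor 2]; lra.
by case: H => e; [constructor 3|constructor 4|constructor 2|constructor 1]; lra.
Qed.

Lemma graph_at_rot z : graph_at (frontier cell) z -> graph_at (frontier cell) ('i * z).
Proof.
move=> [u [phi [d [h [u1 lphi d0 h0 H]]]]].
exists ('i * u), phi, d, h; split;
  [by rewrite normcM normc_i mul1r|exact: lphi|exact: d0|exact: h0|].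
by move=> s t hs ht; rewrite -mulrA -mulrDr; split => [/frontier_cell_rot/(H _ _ hs ht)|/(H _ _ hs ht)/frontier_cell_rot].
Qed.

Lemma lipschitzP (phi : R -> R) (K : R) : (forall s t, `|phi s - phi t| <= K * `|s - t|) -> lipschitz phi.
Proof.
move=> H; exists K; split; first exact: num_real.
move=> M KM [s t] _ /=; apply: le_trans (H s t) _.
by rewrite ler_wpM2r// ltW.
Qed.

Lemma graph_at_bottom x : - 2^-1 <= x < 2^-1 -> graph_at (frontier cell) (x +i* (- 2^-1)).
Proof.
move=> /andP[x1 x2]; have [e|n] := eqVneq x (- 2^-1); last first.
  have x3 : - 2^-1 < x by rewrite lt_neqAle eq_sym n.
  exists 1, (fun=> 0), (Num.min (x + 2^-1) (2^-1 - x)), 1; split; first exact: normc1.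
  - by apply: (lipschitzP (K := 0)) => s t; rewrite subrr normr0 mul0r.
  - by rewrite lt_min; apply/andP; split; lra.
  - exact: ltr01.
  move=> s t; rewrite lt_min => /andP[]; rewrite !ltr_norml => /andP[? ?] /andP[? ?] /andP[? ?].
  rewrite mul1r (_ : _ + _ = (x + s) +i* (- 2^-1 + t))//.
  split=> [/frontier_cellP[/andP[? ?] /andP[? ?]] [] e|e]; try lra.
  by apply/frontier_cellP; split; [apply/andP; split; lra|apply/andP; split; lra|constructor 3; lra].
(* At the corner the axes are turned by 45 degrees: ['i * u] points along the diagonal into the
   square, and the two sides form the graph of the absolute value. *)
pose k : R := (Num.sqrt 2)^-1.
have s2 : 0 < Num.sqrt 2 :> R by rewrite sqrtr_gt0.
have kk : k * k = 2^-1 by rewrite -invfM -expr2 sqr_sqrtr.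
have k0 : 0 < k by rewrite invr_gt0.
have k1 : k < 1 by rewrite ltNge; apply/negP => h; nra.
exists (k +i* (- k)), (fun s => `|s|), 2^-1, 2^-1; split.
- have e1 : k ^+ 2 + (- k) ^+ 2 = 1 by rewrite sqrrN expr2 kk; lra.
  by rewrite /= e1 sqrtr1.
- by apply: (lipschitzP (K := 1)) => s t; rewrite mul1r ler_dist_dist.
- by rewrite invr_gt0.
- by rewrite invr_gt0.
move=> s t hs ht.
have -> : x +i* - 2^-1 + (k +i* (- k)) * (s +i* t) = (- 2^-1 + k * (s + t)) +i* (- 2^-1 + k * (t - s)).
  by rewrite e; apply/eqP; rewrite eq_complex/=; apply/andP; split; apply/eqP; ring.
move: hs ht; rewrite !ltr_norml => /andP[s1 s2'] /andP[t1 t2].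
have b1 : k * (s + t) < 1 by nra.
have b2 : k * (t - s) < 1 by nra.
have P u : 0 <= k * u -> 0 <= u by rewrite pmulr_rge0.
have Z u : k * u = 0 -> u = 0 by move/eqP; rewrite mulf_eq0 gt_eqF//= => /eqP.
split.
  move=> /frontier_cellP[/andP[h1 h2] /andP[h3 h4] H].
  have p1 : 0 <= s + t by apply: P; lra.
  have p2 : 0 <= t - s by apply: P; lra.
  have : s + t = 0 \/ t - s = 0 by case: H => e'; [left; apply: Z; lra|lra|right; apply: Z; lra|lra].
  by case => e'; [rewrite ler0_norm; lra|rewrite ger0_norm; lra].
move=> te; have [s0|s0] := leP 0 s; apply/frontier_cellP.
  have ts : t = s by rewrite te ger0_norm.
  have e3 : k * (t - s) = 0 by rewrite ts subrr mulr0.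
  have e4 : 0 <= k * (s + t) by rewrite mulr_ge0 ?(ltW k0)// ts addr_ge0.
  by split; [apply/andP; split; lra|apply/andP; split; lra|constructor 3; lra].
have ts : t = - s by rewrite te ltr0_norm.
have e3 : k * (s + t) = 0 by rewrite ts subrr mulr0.
have e4 : 0 <= k * (t - s) by rewrite mulr_ge0 ?(ltW k0)//; lra.
by split; [apply/andP; split; lra|apply/andP; split; lra|constructor 1; lra].
Qed.

(** At most three quarter turns bring any boundary point to the bottom side without its right
    corner, where [graph_at_bottom] applies. *)
Lemma lipschitz_square : lipschitz_curve (frontier cell).
Proof.
split; first exact: jordan_square.
have rot x y : (x +i* y : R[i]) = 'i * (y +i* (- x)).
  by apply/eqP; rewrite eq_complex/=; apply/andP; split; apply/eqP; ring.
move=> [x y] /frontier_cellP[/andP[h1 h2] /andP[h3 h4] H]; rewrite -/(graph_at _ _).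
have B (z : R[i]) : complex.Im z = - 2^-1 -> - 2^-1 <= complex.Re z < 2^-1 -> graph_at (frontier cell) z.
  by case: z => a b /= -> /graph_at_bottom.
have [yb|yb] := eqVneq y (- 2^-1).
  have [xb|xb] := eqVneq x 2^-1.
    by rewrite rot; apply: graph_at_rot; apply: B => /=; rewrite ?xb ?yb// lexx half_lt.
  by apply: B => //=; rewrite h1 lt_neqAle xb.
have [xb|xb] := eqVneq x 2^-1.
  have [yt|yt] := eqVneq y 2^-1.
    by rewrite rot; apply: graph_at_rot; rewrite rot; apply: graph_at_rot; apply: B => /=; rewrite ?xb ?yt// lexx half_lt.
  by rewrite rot; apply: graph_at_rot; apply: B => /=; rewrite ?xb// h3 lt_neqAle yt.
have [yt|yt] := eqVneq y 2^-1.
  have [xl|xl] := eqVneq x (- 2^-1).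
    do 3 (rewrite rot; apply: graph_at_rot); apply: B => /=; rewrite ?xl ?yt ?opprK//.
    by rewrite lexx half_lt.
  do 2 (rewrite rot; apply: graph_at_rot); apply: B => /=; first by rewrite yt.
  have : - 2^-1 < x by rewrite lt_neqAle eq_sym xl.
  by move=> ?; apply/andP; split; lra.
have xl : x = - 2^-1 by case: H => // e; [rewrite e eqxx in xb|rewrite e eqxx in yb|rewrite e eqxx in yt].
do 3 (rewrite rot; apply: graph_at_rot); apply: B => /=; rewrite ?xl ?opprK//.
have : - 2^-1 < y by rewrite lt_neqAle eq_sym yb.
by move=> ?; apply/andP; split; lra.
Qed.

End strip_domain.

(** * The square as a periodic cell whose translates fill the strip *)

Section strip_periodic.
Variable R : realType.
Implicit Types (z w : R[i]) (x y s t : R).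
Local Notation cell := (@cell R).
Local Notation strip := (@strip R).

Let hl := half_lt R.

Lemma closure_cell : closure cell = box (- 2^-1) 2^-1 (- 2^-1) 2^-1.
Proof. exact: closure_obox. Qed.

(** A point off the closed square is joined to infinity by the ray of its multiples [s * z],
    [1 <= s], which avoids the square because the square is star-shaped at 0. For points of the
    square the component is empty, hence bounded. *)
Lemma outer_cell : outer_component cell = ~` box (- 2^-1) 2^-1 (- 2^-1) 2^-1.
Proof.
rewrite /outer_component closure_cell; set E := ~` _.
apply/seteqP; split => z /=.
  move=> H; apply: contrapT => nE; apply: H; apply/bounded_complexP; exists 0 => w.
  by rewrite /connected_component /= => -[C [Cz CE _]]; case: nE; exact: CE.
move=> Ez /bounded_complexP[M HM].
pose A := [set s%:C * z | s in [set s : R | 1 <= s]].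
have zA : A z by exists 1 => /=; rewrite ?lexx// mul1r.
have AE : A `<=` E.
  move=> _ [s /= s1 <-] [/andP[h1 h2] /andP[h3 h4]]; apply: Ez.
  have k0 : 0 < s by rewrite (lt_le_trans ltr01).
  have e1 : complex.Re (s%:C * z) = s * complex.Re z by rewrite cReM /=; ring.
  have e2 : complex.Im (s%:C * z) = s * complex.Im z by rewrite cImM /=; ring.
  rewrite e1 in h1 h2; rewrite e2 in h3 h4.
  have P u : s * u <= 2^-1 -> u <= 2^-1.
    by move=> h; rewrite leNgt; apply/negP => g; nra.
  have Q u : - 2^-1 <= s * u -> - 2^-1 <= u.
    by move=> h; rewrite leNgt; apply/negP => g; nra.
  by split; apply/andP; split; auto.
have cA : connected A.
  apply: (star_connected zA) => _ t [s /= s1 <-] /andP[t0 t1].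
  exists (1 + t * (s - 1)) => /=; first by rewrite lerDl mulr_ge0 ?subr_ge0.
  by rewrite rmorphD rmorphM rmorphB rmorph1/=; ring.
have n0 : 0 < normc z.
  rewrite normc_gt0; apply/eqP => z0; apply: Ez; rewrite z0.
  by split; apply/andP; split => /=; lra.
have inA w : A w -> connected_component E z w by move=> Aw; exists A.
have M0 : 0 <= M by apply: le_trans (HM z (inA z zA)); exact: normc_ge0.
pose s := M / normc z + 1.
have s1 : 1 <= s by rewrite lerDr divr_ge0 ?normc_ge0.
have := HM (s%:C * z); rewrite normcM normc_real ger0_norm; last by lra.
have -> : s * normc z = M + normc z by rewrite mulrDl mul1r divfK ?gt_eqF.
rewrite gerDl leNgt n0 => H; suff : false by []; apply: H.
by apply: inA; exists s.
Qed.

Lemma box_compl_frontier : frontier (~` box (- 2^-1) 2^-1 (- 2^-1) 2^-1) = frontier cell.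
Proof.
rewrite frontier_cell (_ : cell = interior (box (- 2^-1) 2^-1 (- 2^-1) 2^-1)); last first.
  by rewrite interior_box.
have cl : closed (box (- 2^-1) 2^-1 (- 2^-1) 2^-1 : set R[i]).
  by rewrite -closure_cell; exact: closed_closure.
rewrite /frontier closure_setC interiorC setDE setCK -((closure_id _).1 cl).
by rewrite setIC.
Qed.

Lemma caratheodory_cell : caratheodory_domain cell.
Proof.
split.
- split; last exact/convex_connected/cell_convex.
    by exists 0; split; apply/andP; split => /=; lra.
  exact: obox_open.
- apply/bounded_complexP; exists 1 => -[x y] [/andP[h1 h2] /andP[h3 h4]].
  rewrite /= in h1 h2 h3 h4; rewrite (le_trans (le_normc_ReIm _))//=.
  have : `|x| <= 2^-1 by rewrite ler_norml; apply/andP; split; lra.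
  have : `|y| <= 2^-1 by rewrite ler_norml; apply/andP; split; lra.
  lra.
- by rewrite outer_cell box_compl_frontier.
Qed.

Lemma periodic_cell_square : periodic_cell cell.
Proof.
have [d _ _] := caratheodory_cell.
split => //; [exact: lipschitz_square|exact: caratheodory_cell|].
(* The cell lies over [(- 1/2, 1/2)], which fixes the horizontal shift; the common segments are the
   whole vertical sides. *)
exists (- 2^-1), 1, (- 2^-1), 2^-1; split => //.
- move=> z [/andP[h1 h2] /andP[h3 h4]]; split; apply/andP; split; lra.
- apply/seteqP; split => [[x y] [/frontier_cellP[h1 h2 H] /= ->]|_ [y hy <-]].
    by exists y => //; rewrite /= in_itv.
  split => //; apply/frontier_cellP; split; [apply/andP; split; lra| |by constructor 1].
  by move: hy; rewrite /= in_itv.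
- have e : - 2^-1 + 1 = 2^-1 :> R by lra.
  rewrite e; apply/seteqP; split => [[x y] [/frontier_cellP[h1 h2 H] /= ->]|_ [y hy <-]].
    by exists y => //; rewrite /= in_itv.
  split => //; apply/frontier_cellP; split; [apply/andP; split; lra| |by constructor 2].
  by move: hy; rewrite /= in_itv.
Qed.

Lemma cell_shift (m : int) : [set z + m%:~R | z in cell] =
  obox (- 2^-1 + m%:~R) (2^-1 + m%:~R) (- 2^-1) 2^-1.
Proof.
have E : (m%:~R : R[i]) = (m%:~R : R)%:C by rewrite rmorph_int.
rewrite E; apply/seteqP; split.
  move=> _ [[x y] [/andP[h1 h2] /andP[h3 h4]] <-]; rewrite /= in h1 h2 h3 h4.
  by split; apply/andP; split => /=; rewrite ?addr0 ?ltrD2r.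
move=> [x y] [/andP[h1 h2] /andP[h3 h4]]; rewrite /= in h1 h2 h3 h4.
exists ((x - m%:~R) +i* y); last by apply/eqP; rewrite eq_complex/= subrK addr0 !eqxx.
by split; apply/andP; split => /=; lra.
Qed.

Lemma strip_periodic : periodic_domain strip.
Proof.
exists cell; first exact: periodic_cell_square.
have -> : \bigcup_(m in [set: int]) closure [set z + m%:~R | z in cell] =
    [set z : R[i] | - 2^-1 <= complex.Im z <= 2^-1].
  apply/seteqP; split => [z [m _]|z hz].
    by rewrite cell_shift closure_obox//; [case|lra].
  (* Rounding to a nearest integer leaves [Re z] at distance at most [1/2] from the centre of the
     translated cell. *)
  exists (Num.floor (complex.Re z + 2^-1)) => //.
  rewrite cell_shift closure_obox//; last by lra.
  split => //.
  have := Num.Theory.floor_le_tmp (complex.Re z + 2^-1).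
  have := Num.Theory.floorD1_gt (complex.Re z + 2^-1).
  rewrite intrD1; move: (_%:~R) => v ? ?; apply/andP; split; lra.
apply/seteqP; split => z.
  move=> /andP[h1 h2]; apply/interior_complexP.
  have /open_complexP/(_ z)[|e e0 H] := @strip_open R; first by apply/andP.
  by exists e => // w /H/andP[? ?]; apply/andP; split; exact: ltW.
move=> /interior_complexP[e e0 H].
have e2 : `|e / 2| < e by rewrite gtr0_norm; lra.
have ne2 : `|- (e / 2)| < e by rewrite normrN.
have H2 (s : R) : `|s| < e -> - 2^-1 <= complex.Im z + s <= 2^-1.
  move=> se; have := H (z + (0 +i* s)); rewrite addrC addKr normc_imag => /(_ se).
  by rewrite /= cImD addrC.
have /andP[_ p1] := H2 _ e2; have /andP[p2 _] := H2 _ ne2.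
by apply/andP; split; lra.
Qed.

End strip_periodic.

(** * Extremal functions on small squares *)

Section exhaustion.
Variable R : realType.
Implicit Types (D E : set R[i]) (f g : R[i] -> R[i]) (L : R).

Lemma measurable_sqfE D f : cmeasurable D f ->
  measurable_fun (@cplx R @^-1` D) (fun p => (sqf f p)%:E).
Proof. by move=> mf; apply/measurable_EFinP; exact: measurable_sqf. Qed.

Lemma L2normsq_setU D E f : cmset D -> cmset E -> [disjoint D & E] -> cmeasurable (D `|` E) f ->
  L2normsq (D `|` E) f = (L2normsq D f + L2normsq E f)%E.
Proof.
move=> mD mE /disj_setPS DE mf; rewrite /L2normsq preimage_setU ge0_integral_setU//.
- by rewrite -preimage_setU; exact: measurable_sqfE.
- by move=> p _; rewrite lee_fin sqf_ge0.
- by apply/disj_setPS => p [Dp Ep]; apply: (DE (cplx p)).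
Qed.

Lemma sum_L2norm_le (F : nat -> set R[i]) D f n : cmset D -> (forall k, cmset (F k)) ->
  (forall k, F k `<=` D) -> trivIset setT F -> L2 D f ->
  \sum_(k < n) L2norm (F k) f ^+ 2 <= L2norm D f ^+ 2.
Proof.
move=> mD mF FD tF Lf.
have LF k : L2 (F k) f by apply: (L2S mD).
have tF' : trivIset setT (fun k => @cplx R @^-1` F k).
  by move=> i j _ _ [p [p1 p2]]; apply: tF => //; exists (cplx p).
have mU : cmset (\bigcup_k F k).
  by rewrite /cmset preimage_bigcup; apply: bigcup_measurable => k _; exact: mF.
have UD : \bigcup_k F k `<=` D by move=> z [k _]; exact: FD.
rewrite -lee_fin sqr_L2norm// -sumEFin.
apply: (@le_trans _ _ (L2normsq (\bigcup_k F k) f)); last first.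
  by apply: L2normsqS => //; case: Lf.
rewrite [leRHS]/L2normsq preimage_bigcup ge0_integral_bigcup//.
- apply: le_trans (nneseries_lim_ge n _); last by move=> k _ _; exact: L2normsq_ge0.
  by rewrite big_mkord; apply: lee_sum => k _; rewrite sqr_L2norm.
- rewrite -preimage_bigcup; apply: measurable_sqfE.
  by apply: (cmeasS mD) => [p|]; [exact: UD|case: Lf].
- by move=> p _; rewrite lee_fin sqf_ge0.
Qed.

Lemma L2norm_sqr_setU D E f : cmset D -> cmset E -> D `&` E = set0 -> L2 (D `|` E) f ->
  L2norm (D `|` E) f ^+ 2 = L2norm D f ^+ 2 + L2norm E f ^+ 2.
Proof.
move=> mD mE DE Lf; have mU : cmset (D `|` E) by rewrite /cmset preimage_setU; exact: measurableU.
have LD : L2 D f by apply: (L2S mU) => //; exact: subsetUl.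
have LE : L2 E f by apply: (L2S mU) => //; exact: subsetUr.
apply: EFin_inj; rewrite EFinD !sqr_L2norm// L2normsq_setU//; last by case: Lf.
by apply/disj_setPS; rewrite DE.
Qed.

Definition substrip L : set R[i] := [set z | strip z /\ `|complex.Re z| < L].

Lemma substrip_cmset L : cmset (substrip L).
Proof.
rewrite /cmset (_ : _ @^-1` _ = `](- L), L[%classic `*` `](- 2^-1), 2^-1[%classic).
  exact: measurableX.
apply/seteqP; split => -[x y]; rewrite /= !in_itv/= => -[].
  by move=> h1 h2; split => //; rewrite -ltr_norml.
by move=> h1 h2; split => //=; rewrite ltr_norml.
Qed.

Lemma substrip_sub L : substrip L `<=` @strip R. Proof. by move=> z []. Qed.

Lemma substrip_bigcup : \bigcup_n substrip n%:R = @strip R.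
Proof.
apply/seteqP; split=> [z [n _ []]//|z sz].
exists (Num.bound `|complex.Re z|) => //; split=> //.
exact/archi_boundP/normr_ge0.
Qed.

Lemma L2normsq_substrip f : cmeasurable (@strip R) f ->
  L2normsq (substrip n%:R) f @[n --> \oo] --> L2normsq (@strip R) f.
Proof.
move=> mf; rewrite -[X in _ --> L2normsq X _]substrip_bigcup [X in _ --> X]/L2normsq preimage_bigcup.
apply: (@ge0_nondecreasing_set_cvg_integral _ _ _ (fun n => @cplx R @^-1` substrip n%:R)).
- apply/nondecreasing_seqP => n; rewrite subsetEset => p [sp h]; split=> //.
  by apply: lt_le_trans h _; rewrite ler_nat.
- by move=> n; exact: substrip_cmset.
- move=> n; apply: measurable_sqfE; apply: cmeasS mf; first exact: strip_cmset.
  by move=> p; exact: substrip_sub.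
- by move=> n p _; rewrite lee_fin sqf_ge0.
Qed.

(** Monotone convergence over the truncated strips, together with the splitting of the squared norm
    between a truncation and its complement. *)
Lemma L2_strip_tail f e : L2 (@strip R) f -> 0 < e ->
  exists2 L, 1 <= L & L2norm (@strip R `\` substrip L) f < e.
Proof.
move=> Lf e0; have mf : cmeasurable (@strip R) f by case: Lf.
have ms := @strip_cmset R.
have Ls n : L2 (substrip n%:R) f.
  by apply: (L2S ms) => //; [exact: substrip_cmset|exact: substrip_sub].
have := L2normsq_substrip mf; rewrite -sqr_L2norm//.
under eq_fun do rewrite -sqr_L2norm//.
move/fine_cvgP => [_ /cvgrPdist_lt /(_ (e ^+ 2))].
rewrite exprn_gt0// => /(_ isT) [n _ /(_ n.+1 (leqnSn n))]/= h.
(* [n.+1] in place of [n] secures [1 <= L], which later makes room for a square of half-side [1/4]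
   in each slab. *)
exists n.+1%:R; first by rewrite ler1n.
have mD : cmset (@strip R `\` substrip n.+1%:R).
  by apply: measurableD; [exact: strip_cmset|exact: substrip_cmset].
have sU : substrip n.+1%:R `|` (@strip R `\` substrip n.+1%:R) = @strip R.
  by rewrite setDUK//; exact: substrip_sub.
have := L2norm_sqr_setU (@substrip_cmset n.+1%:R) mD.
rewrite setDIK sU => /(_ f erefl Lf) E.
rewrite -(@ltr_pXn2r _ 2) ?nnegrE ?L2norm_ge0// ?ltW//.
move: h; rewrite E ger0_norm; last by rewrite addrAC subrr add0r exprn_ge0 ?L2norm_ge0.
by rewrite addrAC subrr add0r.
Qed.
End exhaustion.

(** * A Bergman function of the strip that does not vanish at 0 *)

Section seed_function.
Variable R : realType.
Local Notation strip := (@strip R).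
Implicit Types (z : R[i]) (x y : R).

(** The pole [- 'i] lies below the strip, and the decay [1 / |Re z|] is enough for square
    integrability in a domain of finite width. This function is the source of the lower bound for
    [gain]. *)
Definition seed z : R[i] := if z \in strip then (z + 'i)^-1 else 0.

Lemma seedE z : strip z -> seed z = (z + 'i)^-1.
Proof. by rewrite /seed => /mem_set ->. Qed.

Let Im_i : complex.Im ('i : R[i]) = 1. Proof. by []. Qed.
Let Re_i : complex.Re ('i : R[i]) = 0. Proof. by []. Qed.

Lemma stripDi_neq0 z : strip z -> z + 'i != 0.
Proof.
move=> /andP[h _]; apply/negP => /eqP/(congr1 (@complex.Im R)).
by rewrite cImD Im_i/=; lra.
Qed.

Lemma seed_sqr z : strip z ->
  normc (seed z) ^+ 2 = (complex.Re z ^+ 2 + (complex.Im z + 1) ^+ 2)^-1.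
Proof.
by move=> /seedE ->; rewrite normcV exprVn sqr_normc cReD cImD Im_i Re_i addr0.
Qed.

Lemma seed_analytic : analytic_on strip seed.
Proof.
move=> z sz; apply: (@near_eq_derivable _ _ _ (fun w => (w - (- 'i))^-1)).
  have : nbhs z strip by apply: open_nbhs_nbhs; split=> //; exact: strip_open.
  by apply: filterS => w /seedE ->; rewrite opprK.
by apply: derivable_inv_sub; rewrite -subr_eq0 opprK; exact: stripDi_neq0.
Qed.

Let n2 (p : measurableTypeR R * measurableTypeR R) := p.1 ^+ 2 + (p.2 + 1) ^+ 2.

Let n2_gt0 p : strip (cplx p) -> 0 < n2 p.
Proof. by move=> /andP[/= h _]; rewrite /n2; nra. Qed.

Let mn2V : measurable_fun (@cplx R @^-1` strip) (fun p => (n2 p)^-1).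
Proof.
have m1 : measurable_fun [set: measurableTypeR R * measurableTypeR R] (fun p => p.1).
  exact: measurable_fst.
have m2 : measurable_fun [set: measurableTypeR R * measurableTypeR R] (fun p => p.2).
  exact: measurable_snd.
have mn : measurable_fun setT n2.
  apply: measurable_funD; apply: measurable_funX => //.
  by apply: measurable_funD => //.
(* The inverse is rewritten through [expR] and [ln], which are measurable on the whole line. *)
apply: (@eq_measurable_fun _ _ _ _ _ (fun p => expR (- ln (n2 p)))).
  by move=> p; rewrite inE => /n2_gt0 n0; rewrite -lnV ?posrE// lnK// posrE invr_gt0.
apply: (@measurable_funS _ _ _ _ setT) => //.
have m : measurable_fun setT (fun p => - ln (n2 p)).
  have ml := measurableT_comp (@measurable_ln R) mn.
  exact: measurableT_comp ml.
exact: measurableT_comp m.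
Qed.

Lemma seed_cmeasurable : cmeasurable strip seed.
Proof.
have m1 : measurable_fun (@cplx R @^-1` strip) (fun p : measurableTypeR R * measurableTypeR R => p.1).
  exact: measurable_funTS measurable_fst.
have m2 : measurable_fun (@cplx R @^-1` strip) (fun p : measurableTypeR R * measurableTypeR R => p.2).
  exact: measurable_funTS measurable_snd.
split.
  apply: (@eq_measurable_fun _ _ _ _ _ (fun p : measurableTypeR R * measurableTypeR R => (p.1 : R) * (n2 p)^-1)); last exact: measurable_funM.
  by move=> [x y]; rewrite inE => /seedE ->; rewrite /= addr0.
apply: (@eq_measurable_fun _ _ _ _ _ (fun p : measurableTypeR R * measurableTypeR R => (- ((p.2 : R) + 1)) * (n2 p)^-1)); last first.
  apply: measurable_funM => //.
  have ml : measurable_fun (@cplx R @^-1` strip) (fun p : measurableTypeR R * measurableTypeR R => (p.2 : R) + 1).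
    exact: measurable_funD.
  exact: measurableT_comp ml.
by move=> [x y]; rewrite inE => /seedE ->; rewrite /= addr0 mulNr.
Qed.

(** Dyadic induction: on the shell from [2 ^+ n] to [2 ^+ n.+1] the squared modulus is at most
    [4 ^- n] and the area at most [4 * 2 ^+ n], so the shell adds at most [4 / 2 ^+ n], exactly the
    increment of the bound. *)
Lemma seed_dyadic n : (L2normsq (substrip (2 ^+ n)) seed <= (16 - 8 * (2 ^+ n)^-1)%:E)%E.
Proof.
have ssub := @substrip_sub R; have mss := @substrip_cmset R.
have ms := @strip_cmset R.
have mseed D : D `<=` strip -> cmeasurable D seed.
  by move=> Ds; apply: cmeasS seed_cmeasurable => // p; exact: Ds.
have bnd D (L k : R) : cmset D -> D `<=` strip -> 0 <= L -> 0 <= k -> D `<=` [set z | `|complex.Re z| <= L] ->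
    (forall z, D z -> normc (seed z) ^+ 2 <= k) -> (L2normsq D seed <= (k * (2 * L))%:E)%E.
  move=> mD Ds L0 k0 DL Dk.
  have mB : cmset (box (- L) L (- 2^-1) 2^-1) by exact: cmset_box.
  have DB : @cplx R @^-1` D `<=` @cplx R @^-1` box (- L) L (- 2^-1) 2^-1.
    move=> p Dp; have /andP[s1 s2] := Ds _ Dp; have := DL _ Dp.
    by rewrite /= ler_norml => h; split=> //; rewrite !ltW.
  apply: (@le_trans _ _ (\int[@area R]_(p in @cplx R @^-1` D) k%:E)%E).
    apply: ge0_le_integral => //.
    - by move=> p _; rewrite lee_fin sqf_ge0.
    - by apply: measurable_sqfE; exact: mseed.
    - by move=> p Dp; rewrite lee_fin; exact: Dk.
  rewrite (integral_cst _ mD) EFinM lee_wpmul2l ?lee_fin//.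
  apply: (@le_trans _ _ (@area R (@cplx R @^-1` box (- L) L (- 2^-1) 2^-1))).
    by apply: le_measure => //; rewrite inE.
  by rewrite area_box ?lee_fin; lra.
elim: n => [|n IHn].
  rewrite expr0 invr1 (_ : _ - _ = 4 * (2 * 1)); last by lra.
  apply: bnd => //; first by move=> z [_ /ltW].
  move=> z [sz _]; rewrite seed_sqr//; case/andP: sz => h1 h2.
  rewrite -[leRHS]invrK lef_pV2 ?posrE; [|nra|lra].
  by have := sqr_ge0 (complex.Re z); nra.
pose D := substrip (2 ^+ n.+1) `\` substrip (2 ^+ n) : set R[i].
have mD : cmset D by apply: measurableD; exact: mss.
have p0 : 0 < 2 ^+ n :> R by rewrite exprn_gt0.
have UE : substrip (2 ^+ n.+1) = substrip (2 ^+ n) `|` D.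
  rewrite setDUK// => z [sz h]; split=> //; apply: lt_trans h _.
  by rewrite ltr_eXn2l// ltr1n.
rewrite UE L2normsq_setU//; last first.
- by apply: mseed; rewrite -UE.
- by apply/disj_setPS => z [h [_ /(_ h)]].
apply: (@le_trans _ _ ((16 - 8 * (2 ^+ n)^-1)%:E + ((2 ^+ n)^-1 ^+ 2 * (2 * 2 ^+ n.+1))%:E)%E).
  apply: leeD => //; apply: bnd => //.
  - by move=> z [/ssub].
  - by move=> z [[_ /ltW]].
  - move=> z [[sz _] h]; rewrite seed_sqr//; case/andP: (sz) => h1 h2.
    have h3 : 2 ^+ n <= `|complex.Re z| by rewrite leNgt; apply/negP => h3; exact: h.
    rewrite [leRHS]exprVn lef_pV2 ?posrE ?exprn_gt0//; last first.
      by have := sqr_ge0 (complex.Re z); nra.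
    rewrite -(real_normK (num_real (complex.Re z))).
    have := sqr_ge0 (complex.Im z + 1); nra.
have E (t : R) : 0 < t -> 16 - 8 * t^-1 + t^-1 ^+ 2 * (2 * (2 * t)) = 16 - 8 * (2 * t)^-1.
  by move=> t0; field; rewrite gt_eqF.
by rewrite -EFinD (exprS 2 n) E.
Qed.

Lemma seed_bergman : bergman strip seed.
Proof.
split; first exact: seed_analytic; last first.
  by move=> z sz; rewrite /seed ifF//; apply/negbTE/negP => /set_mem.
split; first exact: seed_cmeasurable.
apply: (@le_lt_trans _ _ 16%:E); last exact: ltry.
have h := L2normsq_substrip seed_cmeasurable.
rewrite -(cvg_lim _ h)//; apply: lime_le; first by apply/cvg_ex; eexists; exact: h.
near=> n; apply: (@le_trans _ _ (L2normsq (substrip (2 ^+ n)) seed)).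
  apply: L2normsqS; [exact: substrip_cmset|exact: substrip_cmset| |].
    move=> z [sz hz]; split=> //; apply: lt_trans hz _.
    by rewrite -natrX ltr_nat ltn_expl.
  by apply: cmeasS seed_cmeasurable; [exact: strip_cmset|move=> p; exact: substrip_sub].
apply: le_trans (seed_dyadic n) _; rewrite lee_fin gerBl mulr_ge0// invr_ge0 exprn_ge0//.
Unshelve. all: by end_near. Qed.

Lemma seed0_neq0 : seed 0 != 0.
Proof.
have s0 : strip 0 by apply/andP; split => /=; lra.
by rewrite seedE// invr_eq0 stripDi_neq0.
Qed.
End seed_function.

Section boxes.
Variable R : realType.
Implicit Types (f g : R[i] -> R[i]) (a b c d k : R).

Lemma cint_box_near (F : measurableTypeR R * measurableTypeR R -> R[i]) (l : R[i]) a b c d k :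
  a <= b -> c <= d -> cintegrable (@area R) (@cplx R @^-1` box a b c d) F ->
  (forall p, box a b c d (cplx p) -> normc (F p - l) <= k) ->
  normc (cint (@area R) (@cplx R @^-1` box a b c d) F - ((b - a) * (d - c))%:C * l) <=
    (b - a) * (d - c) * k.
Proof.
move=> ab cd iF Fl; set D := _ @^-1` _; set ar := (b - a) * (d - c).
have mD : measurable D by exact: cmset_box.
have aD : @area R D = ar%:E by exact: area_box.
have icl (l' : R[i]) : cintegrable (@area R) D (fun=> l').
  apply: (eq_cintegrable mD) (L2_cintegrableM mD (L2_cst_box l' ab cd).1 (L2_cst_box 1 ab cd).1).
  by move=> p _; rewrite rmorph1 mulr1.
have cl := icl l; have icst : (@area R).-integrable D (EFin \o (fun=> k)) := (icl k%:C).1.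
have E : cint (@area R) D (fun=> l) = ar%:C * l.
  rewrite /cint /Rintegral !(integral_cst _ mD) aD/=.
  by case: (l) => u v; apply/eqP; rewrite eq_complex/=; apply/andP; split; apply/eqP; ring.
rewrite -E -cintB//; apply: le_trans (normc_cint mD (cintegrableB mD iF cl)) _.
have -> : ar * k = \int[@area R]_(x in D) k.
  by rewrite /Rintegral (integral_cst _ mD) aD/= mulrC.
apply: le_Rintegral => //; exact: cintegrable_norm (cintegrableB mD iF cl).
Qed.

Lemma L2norm_box_le f a b c d k : a <= b -> c <= d -> 0 <= k -> L2 (box a b c d) f ->
  (forall z, box a b c d z -> normc (f z) <= k) ->
  L2norm (box a b c d) f ^+ 2 <= k ^+ 2 * ((b - a) * (d - c)).
Proof.
move=> ab cd k0 Lf fk; have mD := @cmset_box R a b c d.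
rewrite -lee_fin sqr_L2norm// EFinM -area_box// -(integral_cst _ mD).
apply: ge0_le_integral => //.
- by move=> p _; rewrite lee_fin sqf_ge0.
- by apply: measurable_sqfE; case: Lf.
- by move=> p Dp; rewrite lee_fin ler_pXn2r ?nnegrE ?normc_ge0//; exact: fk.
Qed.

Lemma L2norm_box_ge f a b c d k : a <= b -> c <= d -> 0 <= k -> L2 (box a b c d) f ->
  (forall z, box a b c d z -> k <= normc (f z)) ->
  k ^+ 2 * ((b - a) * (d - c)) <= L2norm (box a b c d) f ^+ 2.
Proof.
move=> ab cd k0 Lf fk; have mD := @cmset_box R a b c d.
rewrite -lee_fin sqr_L2norm// EFinM -area_box// -(integral_cst _ mD).
apply: ge0_le_integral => //.
- by move=> p _; rewrite lee_fin exprn_ge0.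
- by apply: measurable_sqfE; case: Lf.
- by move=> p Dp; rewrite lee_fin ler_pXn2r ?nnegrE ?normc_ge0//; exact: fk.
Qed.
End boxes.

(** * The extremal problem: concentration of Bergman functions on a small square *)

Section extremal.
Variable R : realType.
Local Notation strip := (@strip R).
Local Notation H := (bergman strip).
Local Notation nrm := (L2norm strip).
Implicit Types (f g v : R[i] -> R[i]) (z w : R[i]) (x t rho : R).

Let os := @strip_open R.
Let ms := @strip_cmset R.
Let sH : subspace H := bergman_subspace ms.
Let sip : semi_inner H (L2inner strip) := bergman_semi_inner ms.
Let sq_mset z s : cmset (square z s). Proof. exact: cmset_box. Qed.

Lemma translate_set_square x s : translate_set x (square 0 s) = square x%:C s.
Proof.
apply/seteqP; split=> -[a b] [/= /andP[h1 h2] /andP[h3 h4]].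
  by split; apply/andP; split => /=; lra.
by split; apply/andP; split => /=; lra.
Qed.

Lemma translate_set_strip x : translate_set x strip = strip.
Proof.
by apply/seteqP; split=> -[a b] /= /andP[/= h1 h2]; apply/andP; split => /=; lra.
Qed.

Lemma translateK x f : translate (- x) (translate x f) = f.
Proof. by apply/funext => z; rewrite /translate rmorphN/= opprK addrK. Qed.

Lemma translate_bergman x f : H f -> H (translate x f).
Proof.
move=> [af Lf f0]; split.
- move=> z sz; have /af/derivableE[L HL] : translate_set x strip z.
    by rewrite translate_set_strip.
  apply/derivableE; exists L => e /HL[d d0 Hd]; exists d => // w wz.
  have := Hd (w - x%:C); rewrite /translate.
  by rewrite (_ : w - x%:C - (z - x%:C) = w - z); [apply|ring].
- by rewrite -(translate_set_strip x); exact: L2_translate.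
- move=> z sz; apply: f0 => h; apply: sz.
  by rewrite -(translate_set_strip x).
Qed.

Lemma nrm_translate x f : H f -> nrm (translate x f) = nrm f.
Proof.
by move=> [_ [mf _] _]; rewrite -{1}(translate_set_strip x) L2norm_translate.
Qed.

Lemma square_strip x s : s < 2^-1 -> square x%:C s `<=` strip.
Proof. by move=> s2 z [_ /andP[/= h1 h2]]; apply/andP; split; lra. Qed.

Lemma squareS z s t : s <= t -> square z s `<=` square z t.
Proof. by move=> st w [/andP[h1 h2] /andP[h3 h4]]; split; apply/andP; split; lra. Qed.

Lemma bergman_L2_square x s f : s < 2^-1 -> H f -> L2 (square x%:C s) f.
Proof. by move=> s2 /bergman_L2; apply: L2S => //; exact: square_strip. Qed.

Local Notation Q x := (square x%:C 4^-1).

Let q4 : 4^-1 < 2^-1 :> R. Proof. lra. Qed.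

(** This is [local_bound] with [s = 1/4], where the constant is [16 * 16]. The norm on the right is
    local, over a square of half-side [1/4]; along the array these squares are disjoint, so such
    bounds can be squared and summed over [m]. *)
Lemma bergman_square_bound f x z : H f -> square x%:C 16^-1 z -> normc (f z) <= 256 * L2norm (Q x) f.
Proof.
move=> Hf hz.
have h : normc (f z) <= (4^-1 / 4)^-1 * (16 * L2norm (Q x) f).
  apply: local_bound.
  - lra.
  - by move=> w /(square_strip q4); case: Hf => + _ _; apply.
  - exact: bergman_L2_square.
  - by rewrite (_ : 4^-1 / 4 = 16^-1)//; lra.
by apply: le_trans h _; rewrite (_ : 4^-1 / 4 = 16^-1); [rewrite invrK; lra|lra].
Qed.

(** The constant is [2 * 16 ^+ 2 * 16], where [2 * rho] bounds the distance to the centre. *)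
Lemma bergman_square_dist f x z rho : H f -> rho <= 16^-1 -> square x%:C rho z ->
  normc (f z - f x%:C) <= 8192 * rho * L2norm (Q x) f.
Proof.
move=> Hf r16 hz.
have r0 : 0 <= rho by case: hz => /andP[h1 h2] _; lra.
have e16 : 4^-1 / 4 = 16^-1 :> R by lra.
have h : normc (f z - f x%:C) <= normc (z - x%:C) * (4^-1 / 4)^-1 ^+ 2 * (16 * L2norm (Q x) f).
  apply: local_bound_dist.
  - lra.
  - by move=> w /(square_strip q4); case: Hf => + _ _; apply.
  - exact: bergman_L2_square.
  - by rewrite e16; exact: squareS hz.
  - by rewrite e16; apply: square_center; lra.
have nz : normc (z - x%:C) <= 2 * rho.
  apply: le_trans (le_normc_ReIm _) _; case: hz => /andP[/= h1 h2] /andP[/= h3 h4].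
  rewrite cReD cImD cReN cImN /= oppr0 addr0.
  have : `|complex.Re z - x| <= rho by rewrite ler_norml; apply/andP; split; lra.
  have : `|complex.Im z| <= rho by rewrite ler_norml; apply/andP; split; lra.
  lra.
move: h; rewrite e16 invrK => h; apply: le_trans h _.
rewrite (_ : 8192 * rho * _ = 2 * rho * 16 ^+ 2 * (16 * L2norm (Q x) f)); last by ring.
by rewrite !ler_wpM2r ?mulr_ge0 ?L2norm_ge0.
Qed.

(** Its supremum [gain rho], the number [S] of the overview, is the norm of the Toeplitz operator
    whose symbol is the indicator of the square. *)
Definition gain_set rho := [set L2norm (square 0 rho) f ^+ 2 | f in [set f | H f /\ nrm f <= 1]].
Definition gain rho := sup (gain_set rho).

Section gain.
Variable rho : R.
Hypotheses (rho0 : 0 < rho) (rho16 : rho <= 16^-1).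
Let r2 : rho < 2^-1. Proof. by apply: le_lt_trans rho16 _; lra. Qed.
Let L0 : square 0 rho = square 0%:C rho. Proof. by []. Qed.

Let box_le (y : R) : y - rho <= y + rho. Proof. have := rho0; lra. Qed.

Lemma bergman_square_le f x : H f ->
  L2norm (square x%:C rho) f ^+ 2 <= (256 * L2norm (Q x) f) ^+ 2 * (4 * rho ^+ 2).
Proof.
move=> Hf.
have -> : 4 * rho ^+ 2 = (complex.Re x%:C + rho - (complex.Re x%:C - rho)) * (complex.Im x%:C + rho - (complex.Im x%:C - rho)) by ring.
apply: L2norm_box_le; [exact: box_le|exact: box_le| |exact: bergman_L2_square|].
  exact: mulr_ge0 (ler0n _ _) (L2norm_ge0 _ _).
by move=> z hz; apply: bergman_square_bound => //; exact: squareS hz.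
Qed.

Let Q_le f x : H f -> L2norm (Q x) f <= nrm f.
Proof. by move=> /bergman_L2; apply: L2normS => //; exact: square_strip. Qed.

Lemma gain_ub : ubound (gain_set rho) (2 ^+ 16 * (4 * rho ^+ 2)).
Proof.
move=> _ [f [Hf f1] <-]; rewrite L0; apply: le_trans (bergman_square_le 0 Hf) _.
apply: ler_wpM2r; first by rewrite mulr_ge0// sqr_ge0.
rewrite (_ : 2 ^+ 16 = 256 ^+ 2); last by ring.
apply: lerXn2r; [exact: mulr_ge0 (ler0n _ _) (L2norm_ge0 _ _)|exact: ler0n|].
by have := Q_le 0 Hf; lra.
Qed.

Lemma gain_has_sup : has_sup (gain_set rho).
Proof.
split; last by eexists; exact: gain_ub.
exists (L2norm (square 0 rho) 0 ^+ 2); exists 0 => //; split; first exact: sub0.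
by rewrite L2norm_inorm (nrm0 sH sip).
Qed.

Lemma gain_le : gain rho <= 2 ^+ 16 * (4 * rho ^+ 2).
Proof. by apply: ge_sup; [case: gain_has_sup|exact: gain_ub]. Qed.

(** Translation reduces to a square centred at 0, where homogeneity applies; a function of norm 0
    cannot be normalised, but then both sides vanish. *)
Lemma L2norm_square_gain f x : H f -> L2norm (square x%:C rho) f ^+ 2 <= gain rho * nrm f ^+ 2.
Proof.
wlog -> : f x / x = 0.
  move=> h Hf; have Hg := translate_bergman (- x) Hf.
  have := h _ _ erefl Hg; rewrite nrm_translate//; apply: le_trans.
  rewrite -(translate_set_square x) -{1}(translateK (- x) f) opprK.
  have mg : cmeasurable (square 0 rho) (translate (- x) f).
    by have [] : L2 (square 0%:C rho) (translate (- x) f) by exact: bergman_L2_square.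
  by rewrite L2norm_translate.
move=> Hf; have [n0|n0] := eqVneq (nrm f) 0.
  rewrite n0 expr0n/= mulr0.
  have := L2normS ms (@sq_mset 0%:C rho) (@square_strip 0 rho r2) (bergman_L2 Hf).
  by rewrite n0 => h; rewrite (_ : L2norm _ _ = 0) ?expr0n//; apply/eqP; rewrite eq_le h L2norm_ge0.
have n1 : 0 < nrm f by rewrite lt_neqAle eq_sym n0 L2norm_ge0.
pose g := (nrm f)^-1%:C *: f.
have Hg : H g by exact: (subZ sH).
have gn : nrm g = 1.
  by rewrite L2norm_inorm (nrmZ sH sip)// -L2norm_inorm normc_real ger0_norm ?mulVf// invr_ge0 ltW.
have gs : L2norm (square 0%:C rho) g = (nrm f)^-1 * L2norm (square 0%:C rho) f.
  rewrite !L2norm_inorm (nrmZ (L2_subspace (@sq_mset 0%:C rho)) (L2_semi_inner (@sq_mset 0%:C rho)))//.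
    by rewrite normc_real L2norm_inorm ger0_norm// invr_ge0 inorm_ge0.
  exact: bergman_L2_square.
have : L2norm (square 0%:C rho) g ^+ 2 <= gain rho.
  by apply: ub_le_sup; [exact: gain_has_sup.2|exists g => //; split; rewrite ?gn].
by rewrite gs exprMn exprVn mulrC ler_pdivrMr ?exprn_gt0.
Qed.

Lemma gain_approx e : 0 < e -> exists v, [/\ H v, nrm v <= 1 & gain rho - e < L2norm (square 0 rho) v ^+ 2].
Proof. by move=> /sup_adherent/(_ gain_has_sup)[_ [v [Hv v1] <-] h]; exists v. Qed.
End gain.

(** Take for [v] the normalised seed and for [c] half of [normc (v 0)]. The oscillation of [v] on
    the square is at most [c / 4], so its modulus stays above [c] there. The point is that [c] does
    not depend on [rho]. *)
Lemma gain_ge : exists2 c : R, 0 < c & forall rho, 0 < rho -> rho <= 16^-1 -> 8192 * rho <= c / 4 ->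
  c ^+ 2 * (4 * rho ^+ 2) <= gain rho.
Proof.
have Hs := seed_bergman R; have s0 := seed0_neq0 R.
have n0 : 0 < nrm (@seed R).
  rewrite lt_neqAle L2norm_ge0 andbT; apply/negP => /eqP/esym/(bergman_definite os ms Hs) h.
  by move: s0; rewrite h => /eqP; apply.
pose v := (nrm (@seed R))^-1%:C *: @seed R.
have Hv : H v by exact: (subZ sH).
have vn : nrm v = 1.
  by rewrite L2norm_inorm (nrmZ sH sip)// -L2norm_inorm normc_real ger0_norm ?mulVf ?gt_eqF// invr_ge0 ltW.
have v0 : 0 < normc (v 0).
  rewrite normc_gt0 (_ : v 0 = (nrm (@seed R))^-1%:C * seed 0)// mulf_neq0//.
  by rewrite fmorphV invr_eq0 -[0]/(0%:C) (inj_eq (@complexI R)) gt_eqF.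
exists (normc (v 0) / 2); first by rewrite divr_gt0.
move=> rho r0 r16 rc.
apply: le_trans (ub_le_sup (gain_has_sup r0 r16).2 _); last by exists v => //; split; rewrite ?vn.
have -> : 4 * rho ^+ 2 = (complex.Re 0 + rho - (complex.Re 0 - rho)) * (complex.Im 0 + rho - (complex.Im 0 - rho)) :> R by ring.
apply: L2norm_box_ge; [lra|lra|by rewrite divr_ge0 ?normc_ge0| |].
  by apply: (@bergman_L2_square 0) => //; lra.
move=> z hz; have := @bergman_square_dist v 0 z rho Hv r16 hz.
have := le_normc_dist (v 0) (v 0 - v z); rewrite opprB addrCA subrr addr0 normcB.
have : L2norm (Q 0) v <= 1.
  by rewrite -[leRHS]vn; exact: (L2normS ms (@sq_mset 0%:C 4^-1) (@square_strip 0 4^-1 q4) (bergman_L2 Hv)).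
have := L2norm_ge0 (Q 0) v.
have := normc_ge0 (v z); nra.
Qed.
End extremal.

(** * Translated near-maximisers in disjoint slabs *)

Section packing.
Variable R : realType.
Local Notation strip := (@strip R).
Local Notation H := (bergman strip).

Let ms := @strip_cmset R.

(** Half-open, so that adjacent slabs are disjoint. *)
Definition slab (a b : R) : set R[i] := [set z | strip z /\ a <= complex.Re z < b].

Lemma slab_cmset a b : cmset (slab a b).
Proof.
rewrite /cmset (_ : _ @^-1` _ = `[a, b[%classic `*` `](- 2^-1), 2^-1[%classic).
  exact: measurableX.
by apply/seteqP; split => -[x y]; rewrite /= !in_itv/= => -[].
Qed.

(* w m is a near-maximiser of f |-> (L2norm (square x_m rho) f)^2 on the unit
   ball, and the slabs V m are so wide that the part of w m outside V m is
   negligible; this makes the family w almost orthogonal. *)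
Record packing (rho : R) (th : nat -> R) (x : nat -> R) (V : nat -> set R[i])
    (w : nat -> R[i] -> R[i]) : Prop := Packing {
  packing_disjoint : trivIset setT V;
  packing_sub : forall m, V m `<=` strip;
  packing_cmset : forall m, cmset (V m);
  packing_square : forall m, square (x m)%:C 4^-1 `<=` V m;
  packing_mem : forall m, H (w m);
  packing_norm : forall m, L2norm strip (w m) <= 1;
  packing_gain : forall m,
    gain rho * (1 - th m ^+ 2) <= L2norm (square (x m)%:C rho) (w m) ^+ 2;
  packing_tail : forall m, L2norm (strip `\` V m) (w m) <= th m }.

(** Each near-maximiser is found at 0, and its tail decides a half-width [L m]; slabs of width
    [2 * L m] are then laid side by side from 0 to the right, and each function is translated to the
    middle of its slab. *)
Lemma packing_exists (rho : R) (th : nat -> R) : 0 < rho -> rho <= 16^-1 ->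
  0 < gain rho -> (forall m, 0 < th m) ->
  exists x V w, packing rho th x V w.
Proof.
move=> r0 r16 g0 th0.
have /choice[v Hv] (m : nat) : exists v, [/\ H v, L2norm strip v <= 1 &
    gain rho - gain rho * th m ^+ 2 < L2norm (square 0 rho) v ^+ 2].
  by apply: gain_approx => //; rewrite mulr_gt0// exprn_gt0.
have /choice[L HL] (m : nat) : exists L, 1 <= L /\ L2norm (strip `\` substrip L) (v m) < th m.
  have [Hvm _ _] := Hv m; have [L L1 HL] := L2_strip_tail (bergman_L2 Hvm) (th0 m).
  by exists L.
pose P m := \sum_(i < m) (2 * L i).
have PS m : P m.+1 = P m + 2 * L m by rewrite /P big_ord_recr.
have Pmono i j : (i <= j)%N -> P i <= P j.
  elim: j => [|j IH]; first by rewrite leqn0 => /eqP ->.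
  rewrite leq_eqVlt ltnS => /orP[/eqP -> //|/IH h]; rewrite PS.
  by have [] := HL j; lra.
pose x m := P m + L m; pose V m := slab (P m) (P m.+1).
have disj i j z : (i < j)%N -> V i z -> V j z -> False.
  by move=> ij [_ /andP[_ h1]] [_ /andP[h2 _]]; have := Pmono _ _ ij; lra.
exists x, V, (fun m => translate (x m) (v m)); split.
- move=> i j _ _ [z [Vi Vj]]; apply/eqP/negP => /negP; rewrite neq_lt => /orP[|] h.
    exact: (disj i j z).
  exact: (disj j i z).
- by move=> m z [].
- by move=> m; exact: slab_cmset.
- move=> m z hz; split; first by apply: square_strip hz; lra.
  case: hz => /andP[/= h1 h2] _; rewrite PS; have [L1 _] := HL m.
  by apply/andP; split; move: h1 h2; rewrite /x; lra.
- by move=> m; have [Hvm _ _] := Hv m; exact: translate_bergman.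
- by move=> m; have [Hvm h _] := Hv m; rewrite nrm_translate.
- move=> m; have [Hvm _ /ltW h] := Hv m.
  rewrite mulrBr mulr1 -translate_set_square L2norm_translate//; first exact: cmset_box.
  have [] // : L2 (square 0%:C rho) (v m).
  by apply: bergman_L2_square => //; lra.
- move=> m; have [Hvm _ _] := Hv m; have [L1 /ltW] := HL m; apply: le_trans.
  have mT : cmset (strip `\` substrip (L m)) by apply: measurableD => //; exact: substrip_cmset.
  have LT : L2 (strip `\` substrip (L m)) (v m).
    by apply: (L2S ms mT) (bergman_L2 Hvm) => z [].
  rewrite -(L2norm_translate (x m) mT); last by case: LT.
  apply: L2normS; first exact: cmset_translate.
  + by apply: measurableD; [exact: ms|exact: slab_cmset].
  + move=> z [sz nV]; split; first by have : translate_set (x m) strip z by rewrite translate_set_strip.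
    move=> [_]; rewrite cReD cReN /= ltr_norml => /andP[h1 h2]; apply: nV; split=> //.
    by rewrite PS; apply/andP; split; move: h1 h2; rewrite /x; lra.
  + exact: L2_translate.
Qed.
End packing.

(** * The symbol and its almost eigenvectors *)

Section piecewise_constant.
Variable R : realType.
Implicit Types (K : nat -> set R[i]) (c : nat -> R[i]) (z : R[i]) (D : set R[i]) (f g : R[i] -> R[i]).

(** Classical choice picks an index whose set contains [z]; [piecewiseE] shows that for disjoint
    sets the choice is immaterial. *)
Definition piecewise K c z : R[i] :=
  if pselect (exists m, K m z) is left h then c (sval (cid h)) else 0.

Lemma piecewiseE K c m z : trivIset setT K -> K m z -> piecewise K c z = c m.
Proof.
move=> tK Kz; rewrite /piecewise; case: pselect => [h|]; last by case; exists m.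
by case: (cid h) => j /= Kj; congr c; apply: tK => //; exists z.
Qed.

Lemma piecewise0 K c z : (forall m, ~ K m z) -> piecewise K c z = 0.
Proof. by move=> nK; rewrite /piecewise; case: pselect => // -[m Km]; case: (nK m Km). Qed.

Lemma piecewise_conj K c z : (piecewise K c z)^* = piecewise K (fun m => (c m)^*) z.
Proof. by rewrite /piecewise; case: pselect => // _; rewrite rmorph0. Qed.

Lemma normc_piecewise K c (A : R) z : (forall m, normc (c m) <= A) -> normc (piecewise K c z) <= A.
Proof.
move=> cA; rewrite /piecewise; case: pselect => // _.
by rewrite normc0 (le_trans (normc_ge0 (c 0%N))).
Qed.

Lemma piecewise_cmeasurable K c D : trivIset setT K -> (forall m, cmset (K m)) ->
  cmset D -> (forall m, K m `<=` D) -> cmeasurable D (piecewise K c).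
Proof.
move=> tK mK mD KD; pose U := \bigcup_m (@cplx R @^-1` K m).
have mU : measurable U by apply: bigcup_measurable => m _; exact: mK.
rewrite /cmeasurable; have -> : @cplx R @^-1` D = U `|` (@cplx R @^-1` D `\` U).
  by rewrite setDUK// => p [m _] /KD.
have mDU : measurable (@cplx R @^-1` D `\` U) by apply: measurableD.
suff M (phi : R[i] -> R) : measurable_fun (U `|` (@cplx R @^-1` D `\` U))
    (fun p => phi (piecewise K c (cplx p))) by split; exact: M.
apply: (iffRL (measurable_funU _ mU mDU)); split.
  apply: (iffRL (@measurable_fun_bigcup _ _ _ _ (fun m => @cplx R @^-1` K m) _ mK)) => m.
  apply: (@eq_measurable_fun _ _ _ _ _ (fun=> phi (c m))); last exact: measurable_cst.
  by move=> p; rewrite inE => Kp; rewrite (piecewiseE _ tK Kp).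
apply: (@eq_measurable_fun _ _ _ _ _ (fun=> phi 0)); last exact: measurable_cst.
by move=> p; rewrite inE => -[_ nU]; rewrite piecewise0// => m Km; apply: nU; exists m.
Qed.

Lemma L2inner_setU (D E : set R[i]) f g : cmset D -> cmset E -> D `&` E = set0 ->
  L2 (D `|` E) f -> L2 (D `|` E) g ->
  L2inner (D `|` E) f g = L2inner D f g + L2inner E f g.
Proof.
move=> mD mE DE Lf Lg.
have mU : cmset (D `|` E) by rewrite /cmset preimage_setU; exact: measurableU.
have dis : [disjoint @cplx R @^-1` D & @cplx R @^-1` E].
  by apply/disj_setPS => p DEp; have : (D `&` E) (cplx p) := DEp; rewrite DE.
apply: (cint_setU mD mE _ dis).
by rewrite -preimage_setU; exact: L2_cintegrableM.
Qed.

Lemma L2inner_split D E f g : cmset D -> cmset E -> E `<=` D -> L2 D f -> L2 D g ->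
  L2inner D f g = L2inner E f g + L2inner (D `\` E) f g.
Proof.
move=> mD mE ED Lf Lg; have mDE : cmset (D `\` E) by exact: measurableD.
rewrite -{1}(setDUK ED) L2inner_setU ?setDIK//; rewrite ?setDUK//.
Qed.

Lemma L2inner_eqZ D (c : R[i]) f g h : cmset D -> L2 D g -> L2 D h ->
  (forall z, D z -> f z = c * g z) -> L2inner D f h = c * L2inner D g h.
Proof.
move=> mD Lg Lh fg; rewrite /L2inner -/(cint _ _ _) -[in RHS]/(cint _ _ _).
rewrite -cintZ//; last exact: L2_cintegrableM.
by apply: eq_cint => p Dp; rewrite fg// mulrA.
Qed.
End piecewise_constant.

(** * The array symbol and its almost eigenvectors *)

Section array_estimates.
Variable R : realType.
Local Notation strip := (@strip R).
Local Notation H := (bergman strip).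
Local Notation nrm := (L2norm strip).
Local Notation ip := (L2inner strip).
Implicit Types (f g h : R[i] -> R[i]) (m : nat).

Let os := @strip_open R.
Let ms := @strip_cmset R.
Let sH : subspace H := bergman_subspace ms.
Let sip : semi_inner H ip := bergman_semi_inner ms.

Variables (rho : R) (th : nat -> R) (x : nat -> R) (V : nat -> set R[i]) (w : nat -> R[i] -> R[i]).
Hypotheses (rho0 : 0 < rho) (rho16 : rho <= 16^-1).
Hypothesis pack : packing rho th x V w.
Hypothesis th0 : forall m, 0 <= th m.
Local Notation S := (gain rho).
Hypothesis S0 : 0 < S.
Local Notation K := (fun m => square (x m)%:C rho).
Local Notation Q := (fun m => square (x m)%:C 4^-1).

Let r2 : rho < 2^-1. Proof. by apply: le_lt_trans rho16 _; lra. Qed.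

Lemma array_KQ m : K m `<=` Q m.
Proof. by apply: squareS; apply: le_trans rho16 _; lra. Qed.

Lemma array_KV m : K m `<=` V m.
Proof. by move=> z /array_KQ; exact: (packing_square pack). Qed.

Let Ks m : K m `<=` strip. Proof. exact: square_strip. Qed.
Let Vs m : V m `<=` strip. Proof. exact: (packing_sub pack). Qed.
Let mK m : cmset (K m). Proof. exact: cmset_box. Qed.
Let mV m : cmset (V m). Proof. exact: (packing_cmset pack). Qed.
Let mVc m : cmset (strip `\` V m). Proof. by apply: measurableD; [exact: ms|exact: mV]. Qed.
Let sVc m : strip `\` V m `<=` strip. Proof. by move=> z []. Qed.
Let Hw m : H (w m). Proof. exact: (packing_mem pack). Qed.
Let Lw m : L2 strip (w m). Proof. exact: bergman_L2 (Hw m). Qed.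
Let w1 m : nrm (w m) <= 1. Proof. exact: (packing_norm pack). Qed.

Lemma array_trivI : trivIset setT K.
Proof.
move=> i j _ _ [z [Ki Kj]]; apply: (packing_disjoint pack) => //.
by exists z; split; exact: array_KV.
Qed.

Lemma array_trivIQ : trivIset setT Q.
Proof.
move=> i j _ _ [z [Ki Kj]]; apply: (packing_disjoint pack) => //.
by exists z; split; exact: (packing_square pack).
Qed.

Lemma array_localization g m : L2 strip g ->
  normc (ip g (w m) - L2inner (V m) g (w m)) <= L2norm (strip `\` V m) g * th m.
Proof.
move=> Lg; rewrite (L2inner_split ms (mV m) (@Vs m) Lg (Lw m)) addrAC subrr add0r.
have LG := L2S ms (mVc m) (@sVc m) Lg; have LW := L2S ms (mVc m) (@sVc m) (Lw m).
apply: le_trans (L2_CauchySchwarz (mVc m) LG LW) _.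
by rewrite ler_wpM2l ?L2norm_ge0//; exact: (packing_tail pack).
Qed.

(** Outside [V m] the function [w m] has norm at most [th m]. As the slabs are disjoint and [th] is
    square summable, squaring and summing over [m] yields an approximate Bessel inequality. *)
Lemma array_bessel g m : L2 strip g -> normc (ip g (w m)) <= L2norm (V m) g + th m * nrm g.
Proof.
move=> Lg; have h := array_localization m Lg.
have LG := L2S ms (mV m) (@Vs m) Lg; have LW := L2S ms (mV m) (@Vs m) (Lw m).
have h2 := L2_CauchySchwarz (mV m) LG LW.
have h3 := le_normc_dist (ip g (w m)) (L2inner (V m) g (w m)).
have h4 : L2norm (V m) (w m) <= 1 by apply: le_trans (w1 m); exact: L2normS.
have h5 : L2norm (strip `\` V m) g <= nrm g by apply: L2normS.
have := L2norm_ge0 (V m) g; have := L2norm_ge0 (V m) (w m).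
have := L2norm_ge0 (strip `\` V m) g; have := th0 m; nra.
Qed.

Let q m f g := S%:C * ip f g - L2inner (K m) f g.

Let LK m f : H f -> L2 (K m) f. Proof. exact: bergman_L2_square. Qed.

Let qff m f : H f -> complex.Re (q m f f) = S * nrm f ^+ 2 - L2norm (K m) f ^+ 2.
Proof.
move=> Hf; rewrite /q (ipff sip Hf) -L2norm_inorm (ipff (L2_semi_inner (mK m)) (LK m Hf)) -L2norm_inorm.
by rewrite cReD cReN -rmorphM.
Qed.

Let q_semi_inner m : semi_inner H (q m).
Proof.
have sK := L2_subspace (mK m); have siK := L2_semi_inner (mK m).
split.
- move=> c f g h Hf Hg Hh; rewrite /q.
  case: sip => -> // _ _; case: siK => ->; [|exact: LK|exact: LK|exact: LK] => _ _.
  by rewrite mulrDr mulrBr mulrCA opprD addrACA.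
- move=> f g Hf Hg; rewrite /q (ipC sip Hf Hg) (ipC siK (LK m Hf) (LK m Hg)).
  have E : (S%:C)^* = S%:C by apply/eqP; rewrite eq_complex/= oppr0 !eqxx.
  by rewrite rmorphB rmorphM/= E.
- move=> f Hf; rewrite qff// subr_ge0; exact: L2norm_square_gain.
Qed.

(* The form S <f, g> - <f, g>_K is positive, and it nearly vanishes at the
   near-maximiser w m; so it is nearly degenerate in the direction w m. *)
Lemma array_eigen f m : H f ->
  normc (S%:C * ip f (w m) - L2inner (K m) f (w m)) <= S * th m * nrm f.
Proof.
move=> Hf; apply: le_trans (CauchySchwarz sH (q_semi_inner m) Hf (Hw m)) _.
have i1 : inorm (q m) f <= Num.sqrt S * nrm f.
  rewrite -(@ler_pXn2r _ 2) ?nnegrE ?inorm_ge0 ?mulr_ge0 ?sqrtr_ge0 ?L2norm_ge0//.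
  have q0 : 0 <= complex.Re (q m f f) by case: (q_semi_inner m) => _ _; exact.
  rewrite /inorm sqr_sqrtr// exprMn sqr_sqrtr ?(ltW S0)// qff//.
  by rewrite gerBl sqr_ge0.
have i2 : inorm (q m) (w m) <= Num.sqrt S * th m.
  rewrite -(@ler_pXn2r _ 2) ?nnegrE ?inorm_ge0 ?mulr_ge0 ?sqrtr_ge0 ?th0//.
  have q0 : 0 <= complex.Re (q m (w m) (w m)) by case: (q_semi_inner m) => _ _; exact.
  rewrite /inorm sqr_sqrtr// exprMn sqr_sqrtr ?(ltW S0)// qff//.
  have := packing_gain pack m; have : nrm (w m) ^+ 2 <= 1 by rewrite expr_le1// L2norm_ge0.
  by have := S0; nra.
apply: le_trans (ler_pM (inorm_ge0 _ _) (inorm_ge0 _ _) i1 i2) _.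
have E := sqr_sqrtr (ltW S0).
by rewrite mulrACA -expr2 E mulrA mulrAC.
Qed.

(** The mass of [w m] on its square is at least [S * (1 - th m ^+ 2)] and at most
    [S * nrm (w m) ^+ 2], so the squared norm is at least [3/4]. *)
Lemma array_norm_ge m : th m <= 2^-1 -> 2^-1 <= nrm (w m).
Proof.
move=> t2; have := L2norm_square_gain rho0 rho16 (x m) (Hw m).
move=> /(le_trans (packing_gain pack m)); rewrite ler_pM2l ?S0// => h.
have := th0 m; have := L2norm_ge0 strip (w m).
move: (nrm _) (th m) h t2 => u t; nra.
Qed.

Variables (l : nat -> R[i]) (Lam : R).
Hypothesis lL : forall m, normc (l m) <= Lam.
Local Notation a := (piecewise K (fun m => l m / S%:C)).
Local Notation T := (toeplitz strip a).

Let Lam0 : 0 <= Lam. Proof. exact: le_trans (normc_ge0 (l 0%N)) (lL 0%N). Qed.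

Lemma array_coef m : normc (l m / S%:C) <= Lam / S.
Proof.
rewrite normcM normcV normc_real (gtr0_norm S0) ler_wpM2r// invr_ge0; exact: ltW.
Qed.

Lemma array_symbol : bounded_symbol strip a (Lam / S).
Proof.
split; last by move=> z; apply: normc_piecewise => m; exact: array_coef.
by apply: piecewise_cmeasurable => //; exact: array_trivI.
Qed.

Let LSf f : L2 strip f -> L2 strip (a \* f) /\ nrm (a \* f) <= Lam / S * nrm f.
Proof. exact: (L2_mul ms array_symbol). Qed.

Let a_V m z : V m z -> ~ K m z -> a z = 0.
Proof.
move=> Vz nK; rewrite piecewise0// => j Kj; have Vj := array_KV Kj.
have e : j = m by apply: (packing_disjoint pack) => //; exists z.
by apply: nK; rewrite -e.
Qed.

(** The slab [V m] meets no square of the array but [K m], and there the symbol is constant. *)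
Lemma array_window f m : H f ->
  L2inner (V m) (a \* f) (w m) = l m / S%:C * L2inner (K m) f (w m).
Proof.
move=> Hf; have Lf := bergman_L2 Hf; have [Laf _] := LSf Lf.
have VL g : L2 strip g -> L2 (V m) g by exact: (L2S ms (mV m) (@Vs m)).
rewrite (L2inner_split (mV m) (mK m) (@array_KV m) (VL _ Laf) (VL _ (Lw m))).
have mVK : cmset (V m `\` K m) by apply: measurableD; [exact: mV|exact: mK].
have VKL g : L2 strip g -> L2 (V m `\` K m) g.
  by apply: (L2S ms mVK) => z [Vz _]; exact: Vs Vz.
rewrite (@L2inner_eqZ _ _ (l m / S%:C) _ f)//; [|exact: LK|exact: LK|]; last first.
  by move=> z Kz; rewrite /= (piecewiseE _ array_trivI Kz).
rewrite (@L2inner_eqZ _ (V m `\` K m) 0 _ f)//; [|exact: VKL|exact: VKL|]; last first.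
  by move=> z [Vz nK]; rewrite /= (a_V Vz nK).
by rewrite mul0r addr0.
Qed.

(** Restricting the pairing to [V m] costs [th m] times the bound [Lam / S] of the symbol. There the
    symbol acts as the scalar [l m / S] on [K m], and [array_eigen] replaces the pairing over [K m]
    by [S] times the full one, at the cost [Lam * th m]. *)
Lemma array_almost_eigen f m : H f ->
  normc (ip (T f) (w m) - l m * ip f (w m)) <= (Lam + Lam / S) * th m * nrm f.
Proof.
move=> Hf; have Lf := bergman_L2 Hf; have [Laf naf] := LSf Lf.
rewrite (toeplitz_ip os ms array_symbol Hf (Hw m)).
have h1 := array_localization m Laf; rewrite array_window// in h1.
have h2 := array_eigen m Hf.
set A := ip (a \* f) (w m) in h1 *; set B := L2inner (K m) f (w m) in h1 h2.
set C := ip f (w m) in h2 *.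
have S0' : S%:C != 0 by rewrite -[0]/(0%:C) (inj_eq (@complexI R)) gt_eqF.
have -> : A - l m * C = (A - l m / S%:C * B) - l m / S%:C * (S%:C * C - B) by field.
apply: le_trans (le_normcB _ _) _; rewrite normcM.
have h3 : L2norm (strip `\` V m) (a \* f) <= Lam / S * nrm f.
  by apply: le_trans naf; apply: L2normS.
have h4 : normc (A - l m / S%:C * B) <= Lam / S * nrm f * th m.
  by apply: le_trans h1 _; rewrite ler_wpM2r.
have h5 := ler_pM (normc_ge0 _) (normc_ge0 _) (array_coef m) h2.
apply: le_trans (lerD h4 h5) _.
rewrite [leRHS](_ : _ = Lam / S * nrm f * th m + Lam / S * (S * th m * nrm f))//.
by field; rewrite gt_eqF.
Qed.

End array_estimates.

(** * The mass of a function on a square, controlled by its pairing with [w m] *)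

Section array_mass.
Variable R : realType.
Local Notation strip := (@strip R).
Local Notation H := (bergman strip).
Local Notation nrm := (L2norm strip).
Local Notation ip := (L2inner strip).
Implicit Types (f g h : R[i] -> R[i]) (m : nat).

Let os := @strip_open R.
Let ms := @strip_cmset R.
Let sH : subspace H := bergman_subspace ms.
Let sip : semi_inner H ip := bergman_semi_inner ms.

Variables (rho : R) (th : nat -> R) (x : nat -> R) (V : nat -> set R[i]) (w : nat -> R[i] -> R[i]).
Hypotheses (rho0 : 0 < rho) (rho16 : rho <= 16^-1).
Hypothesis pack : packing rho th x V w.
Hypotheses (th0 : forall m, 0 <= th m) (th2 : forall m, th m <= 2^-1).
Local Notation S := (gain rho).
Hypothesis S0 : 0 < S.
Local Notation K := (fun m => square (x m)%:C rho).
Local Notation Q := (fun m => square (x m)%:C 4^-1).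
Variable c : R.
Hypotheses (c0 : 0 < c) (rhoc : 8192 * rho <= c / 4) (Sc : c ^+ 2 * (4 * rho ^+ 2) <= S).

Let r2 : rho < 2^-1. Proof. by apply: le_lt_trans rho16 _; lra. Qed.
Let kap := 4 * rho ^+ 2.
Let kap0 : 0 < kap. Proof. by rewrite mulr_gt0// exprn_gt0. Qed.
Let kapE m : (complex.Re (x m)%:C + rho - (complex.Re (x m)%:C - rho)) *
  (complex.Im (x m)%:C + rho - (complex.Im (x m)%:C - rho)) = kap.
Proof. by rewrite /kap; ring. Qed.
Let box_le (y : R) : y - rho <= y + rho. Proof. have := rho0; lra. Qed.
Let mK m : cmset (K m). Proof. exact: cmset_box. Qed.
Let Hw m : H (w m). Proof. exact: (packing_mem pack). Qed.
Let LK m f : H f -> L2 (K m) f. Proof. exact: bergman_L2_square. Qed.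
Let K16 m : K m `<=` square (x m)%:C 16^-1. Proof. exact: squareS. Qed.
Let Kx m : K m (x m)%:C. Proof. by apply: square_center; exact: ltW. Qed.

Let Q_le f m : H f -> L2norm (Q m) f <= nrm f.
Proof.
move=> /bergman_L2; apply: L2normS => //; first exact: cmset_box.
by apply: square_strip; lra.
Qed.

Let w_bound m z : K m z -> normc (w m z) <= 256.
Proof.
move=> Kz; apply: le_trans (bergman_square_bound (Hw m) (K16 Kz)) _.
have := Q_le m (Hw m); have := packing_norm pack m; lra.
Qed.

Let w_dist m z : K m z -> normc (w m z - w m (x m)%:C) <= 8192 * rho.
Proof.
move=> Kz; apply: le_trans (bergman_square_dist (Hw m) rho16 Kz) _.
apply: ler_piMr; first exact: mulr_ge0 (ler0n _ _) (ltW rho0).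
exact: le_trans (Q_le m (Hw m)) (packing_norm pack m).
Qed.

(** The mass of [w m] on the square is at least [3/4 * c ^+ 2] times the area, and its oscillation
    is at most [c / 4]. A central value below [c / 2] would keep the function below [3/4 * c], and
    [9/16] is less than [3/4]. *)
Lemma packing_center m : c / 2 <= normc (w m (x m)%:C).
Proof.
have [D [D0 Dc wD]] : exists D, [/\ 0 <= D, D <= c / 4 &
    forall z, K m z -> normc (w m z - w m (x m)%:C) <= D].
  exists (8192 * rho); split; [exact: mulr_ge0 (ler0n _ _) (ltW rho0)|exact: rhoc|].
  exact: w_dist.
set W := normc _; have W0 : 0 <= W := normc_ge0 _.
have h : L2norm (K m) (w m) ^+ 2 <= (W + D) ^+ 2 * kap.
  rewrite -(kapE m); apply: L2norm_box_le; [exact: box_le|exact: box_le| |exact: LK|].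
    exact: addr_ge0.
  move=> z Kz; have := wD _ Kz; have := le_normc_dist (w m z) (w m (x m)%:C).
  by rewrite -/W; lra.
have g := packing_gain pack m.
have t1 : th m ^+ 2 <= 1 / 4 by have := th0 m; have := th2 m; nra.
have h1 : c ^+ 2 * kap * (3 / 4) <= (W + D) ^+ 2 * kap.
  apply: le_trans (le_trans g h); apply: ler_pM; [|lra|exact: Sc|lra].
  by rewrite mulr_ge0 ?sqr_ge0// ltW.
have h2 : c ^+ 2 * (3 / 4) <= (W + D) ^+ 2.
  by rewrite -(ler_pM2r kap0) mulrAC.
rewrite leNgt; apply/negP => Wc.
have h3 : W + D < 3 / 4 * c by lra.
have h4 : 0 <= W + D by lra.
have := c0; nra.
Qed.

(** [al] is [2 ^+ 16], the bound of [S] per unit area, divided by [c / 2]. [be] is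
    [2 * 256 * 8192 = 2 ^+ 22], from the products of bounds and oscillations, divided by [c / 2],
    plus [8192] for the oscillation of [f] itself. *)
Let al := 2 ^+ 17 / c.
Let be := 2 ^+ 23 / c + 2 ^+ 13.

(** On the small square [f] and [w m] are nearly constant, so their pairing over it is close to the
    area times the product of the central values, the second conjugated; it is also close to
    [S * ip f (w m)]. As [w m] is bounded below at the centre, this controls [f] there, hence on the
    square. *)
Lemma array_mass f m : H f ->
  L2norm (K m) f ^+ 2 <= kap *
   (al * (normc (ip f (w m)) + th m * nrm f) + be * rho * L2norm (Q m) f) ^+ 2.
Proof.
move=> Hf; set F := L2norm (Q m) f; set C := normc (ip f (w m)); set N := nrm f.
have F0 : 0 <= F := L2norm_ge0 _ _.
set fx := f (x m)%:C; set W := w m (x m)%:C.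
have f_bound z : K m z -> normc (f z) <= 256 * F.
  by move=> Kz; exact: (bergman_square_bound Hf (K16 Kz)).
have f_dist z : K m z -> normc (f z - fx) <= 8192 * rho * F.
  by move=> Kz; exact: (bergman_square_dist Hf rho16 Kz).
have near : normc (L2inner (K m) f (w m) - kap%:C * (fx * W^*)) <= kap * (2 ^+ 22 * rho * F).
  rewrite -(kapE m); apply: cint_box_near; [exact: box_le|exact: box_le| |].
    exact: (L2_cintegrableM (mK m) (LK m Hf) (LK m (Hw m))).
  move=> p Kp; set fz := f _; set wz := w m _.
  have -> : fz * wz^* - fx * W^* = (fz - fx) * wz^* + fx * (wz - W)^*.
    by rewrite rmorphB/=; ring.
  apply: le_trans (le_normcD _ _) _; rewrite !normcM !normc_conj.
  have h1 := ler_pM (normc_ge0 _) (normc_ge0 _) (f_dist _ Kp) (w_bound Kp).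
  have h2 := ler_pM (normc_ge0 _) (normc_ge0 _) (f_bound _ (@Kx m)) (w_dist Kp).
  apply: le_trans (lerD h1 h2) _.
  by rewrite le_eqVlt; apply/orP; left; apply/eqP; ring.
have eig := array_eigen rho0 rho16 pack th0 S0 m Hf.
set B := L2inner (K m) f (w m) in near eig.
have SB : normc B <= S * (C + th m * N).
  have := le_normc_dist B (S%:C * ip f (w m)).
  rewrite normcB normcM normc_real (gtr0_norm S0) -/C => h.
  have E : S * (C + th m * N) = S * th m * N + S * C by ring.
  by rewrite E; move: eig; rewrite -/N; lra.
have SB' : normc B <= kap * (2 ^+ 16 * (C + th m * N)).
  apply: le_trans SB _; rewrite mulrA [kap * _]mulrC; apply: ler_wpM2r.
    by rewrite addr_ge0 ?normc_ge0// mulr_ge0 ?th0 ?L2norm_ge0.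
  exact: gain_le.
have fW : normc fx * (c / 2) <= 2 ^+ 16 * (C + th m * N) + 2 ^+ 22 * rho * F.
  apply: (@le_trans _ _ (normc fx * normc W)).
    by rewrite ler_wpM2l ?normc_ge0//; exact: packing_center.
  rewrite -(ler_pM2l kap0) mulrDr.
  apply: le_trans (lerD SB' near).
  have := le_normc_dist (kap%:C * (fx * W^*)) B.
  rewrite normcB !normcM normc_conj normc_real (gtr0_norm kap0); lra.
have fxb : normc fx <= al * (C + th m * N) + 2 ^+ 23 / c * rho * F.
  have c20 : 0 < c / 2 by rewrite divr_gt0.
  rewrite -(ler_pM2r c20); apply: le_trans fW _.
  by rewrite /al le_eqVlt; apply/orP; left; apply/eqP; field; rewrite gt_eqF.
rewrite mulrC -(kapE m); apply: L2norm_box_le; [exact: box_le|exact: box_le| |exact: LK|].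
  have p0 n : 0 <= 2 ^+ n / c by exact: divr_ge0 (exprn_ge0 _ (ler0n _ _)) (ltW c0).
  apply: addr_ge0.
    apply: mulr_ge0 (p0 _) (addr_ge0 (normc_ge0 _) (mulr_ge0 (th0 m) (L2norm_ge0 _ _))).
  apply: mulr_ge0 F0; apply: mulr_ge0 (ltW rho0).
  exact: addr_ge0 (p0 _) (exprn_ge0 _ (ler0n _ _)).
move=> z Kz; have := le_normc_dist (f z) fx; have := f_dist _ Kz => h1 h2.
have -> : be * rho * F = 2 ^+ 23 / c * rho * F + 8192 * rho * F by rewrite /be; ring.
move: h1 h2 fxb; move: (8192 * rho * F) (2 ^+ 23 / c * rho * F) => y1 y2; lra.
Qed.

Variables (Lam : R) (k : R).
Hypothesis Lam0 : 0 <= Lam.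

(** Since [S >= c ^+ 2 * kap], coefficient times area is at most [Lam / c ^+ 2], whatever [rho]. The
    factor 3 comes from squaring a sum of three terms, and the surviving [rho ^+ 2] is what is made
    small. *)
Lemma array_weighted_mass f m : H f -> 0 <= k -> k <= Lam / S ->
  k * L2norm (K m) f ^+ 2 <=
    (3 * Lam * al ^+ 2 / c ^+ 2) * (normc (ip f (w m)) ^+ 2 + th m ^+ 2 * nrm f ^+ 2) +
    (3 * Lam * be ^+ 2 / c ^+ 2) * rho ^+ 2 * L2norm (Q m) f ^+ 2.
Proof.
move=> Hf k0 kL; have h := array_mass m Hf.
set C := normc _ in h *; set N := nrm f in h *; set F := L2norm (Q m) f in h *.
set Y := _ + _ in h.
have kk : k * kap <= Lam / c ^+ 2.
  apply: le_trans (ler_wpM2r (ltW kap0) kL) _.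
  rewrite mulrAC ler_pdivrMr// -mulrA ler_wpM2l// mulrC ler_pdivlMr ?exprn_gt0//.
  by rewrite mulrC; exact: Sc.
apply: le_trans (ler_wpM2l k0 h) _; rewrite mulrA.
apply: le_trans (ler_wpM2r (sqr_ge0 _) kk) _.
have Y3 : Y ^+ 2 <= 3 * (al ^+ 2 * (C ^+ 2 + th m ^+ 2 * N ^+ 2) + be ^+ 2 * rho ^+ 2 * F ^+ 2).
  rewrite (_ : Y = al * C + al * (th m * N) + be * rho * F); last by rewrite /Y; ring.
  rewrite (_ : 3 * _ = 3 * ((al * C) ^+ 2 + (al * (th m * N)) ^+ 2 + (be * rho * F) ^+ 2)); last by ring.
  move: (al * C) (al * (th m * N)) (be * rho * F) => u v t.
  have := sqr_ge0 (u - v); have := sqr_ge0 (v - t); have := sqr_ge0 (u - t); nra.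
apply: le_trans (ler_wpM2l _ Y3) _; first by rewrite divr_ge0// sqr_ge0.
rewrite le_eqVlt; apply/orP; left; apply/eqP; field; rewrite gt_eqF//.
Qed.
End array_mass.

Section form_bound.
Variable R : realType.
Implicit Types (f : R[i] -> R[i]).

(** The integrand vanishes off the disjoint sets [K m], so the integral of its modulus is a series
    of nonnegative terms, and a bound on the partial sums suffices. *)
Lemma piecewise_form_bound (K : nat -> set R[i]) (c : nat -> R[i]) (A B : R) D f :
  cmset D -> trivIset setT K -> (forall m, cmset (K m)) -> (forall m, K m `<=` D) ->
  bounded_symbol D (piecewise K c) A -> L2 D f ->
  (forall n, \sum_(m < n) normc (c m) * L2norm (K m) f ^+ 2 <= B) ->
  normc (L2inner D (piecewise K c \* f) f) <= B.
Proof.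
move=> mD tK mK KD ba Lf cB; have [Laf _] := L2_mul mD ba Lf.
have icM := L2_cintegrableM mD Laf Lf.
apply: le_trans (normc_cint mD icM) _.
set a := piecewise K c.
pose g p := (normc (a (cplx p)) * sqf f p)%:E.
have g0 p : (0 <= g p)%E by rewrite lee_fin mulr_ge0 ?normc_ge0 ?sqf_ge0.
have mg : measurable_fun (@cplx R @^-1` D) g.
  apply/measurable_EFinP; apply: measurable_funM.
    by apply: measurable_normc; case: ba.
  by apply: measurable_sqf; case: Lf.
suff gB : (\int[@area R]_(p in @cplx R @^-1` D) g p <= B%:E)%E.
  have E : (\int[@area R]_(p in @cplx R @^-1` D) (normc ((a \* f) (cplx p) * (f (cplx p))^*))%:E =
      \int[@area R]_(p in @cplx R @^-1` D) g p)%E.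
    by apply: eq_integral => p _; rewrite /g /sqf /= !normcM normc_conj mulrA.
  rewrite /Rintegral E -lee_fin fineK//.
  rewrite ge0_fin_numE; last by apply: integral_ge0.
  exact: le_lt_trans gB (ltry _).
have tK' : trivIset setT (fun k => @cplx R @^-1` K k).
  by move=> i j _ _ [p [p1 p2]]; apply: tK => //; exists (cplx p).
pose U := \bigcup_m (@cplx R @^-1` K m).
have mU : measurable U by apply: bigcup_measurable => m _; exact: mK.
have mDU : measurable (@cplx R @^-1` D `\` U) by apply: measurableD.
have UD : U `<=` @cplx R @^-1` D by move=> p [m _] /KD.
have DE : @cplx R @^-1` D = U `|` (@cplx R @^-1` D `\` U) by rewrite setDUK.
rewrite [X in (integral _ X _)]DE ge0_integral_setU//; last 2 first.
- by rewrite -DE.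
- by apply/disj_setPS; rewrite setDIK.
rewrite [X in (_ + X)%E]integral0_eq ?adde0; last first.
  by move=> p [_ nU]; rewrite /g /a piecewise0 ?normc0 ?mul0r// => m Km; apply: nU; exists m.
rewrite ge0_integral_bigcup//; last exact: measurable_funS mg.
apply: lime_le; first by apply: is_cvg_nneseries => m _ _; exact: integral_ge0.
apply: nearW => n; rewrite big_mkord.
apply: (@le_trans _ _ (\sum_(m < n) (normc (c m) * L2norm (K m) f ^+ 2)%:E)%E); last first.
  by rewrite sumEFin lee_fin.
apply: lee_sum => m _.
have LK : L2 (K m) f by apply: (L2S mD).
rewrite EFinM sqr_L2norm// -ge0_integralZl//; last 3 first.
- by apply: measurable_sqfE; case: LK.
- by move=> p _; rewrite lee_fin sqf_ge0.
- by rewrite lee_fin normc_ge0.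
rewrite le_eqVlt; apply/orP; left; apply/eqP; apply: eq_integral => p; rewrite inE => Kp.
by rewrite /g /a (piecewiseE _ tK Kp) EFinM.
Unshelve. exact: mK.
Qed.

(** If [N] exceeded the claimed multiple of [G], then [G <= N] and
    [(k + 1) * G * N <= de / 8 * N ^+ 2], so the right-hand side of the hypothesis would be at most
    [de / 4 * N ^+ 2]. *)
Lemma absorb_le (N G de k : R) : 0 < de -> 0 <= N -> 0 <= G -> 0 <= k ->
  de / 2 * N ^+ 2 <= k * G ^+ 2 + de / 8 * N ^+ 2 + G * N -> N <= (8 * (k + 1) / de + 1) * G.
Proof.
move=> de0 N0 G0 k0 h; set X := _ + 1; rewrite leNgt; apply/negP => XG.
have X1 : 1 <= X.
  by rewrite /X lerDr; apply: divr_ge0 (ltW de0); apply: mulr_ge0 => //; exact: addr_ge0.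
have XX : 8 * (k + 1) <= de * X.
  have -> : de * X = 8 * (k + 1) + de by rewrite /X; field; rewrite gt_eqF.
  by rewrite lerDl ltW.
have XG0 : 0 <= X * G by rewrite mulr_ge0// (le_trans ler01).
have Np : 0 < N by exact: le_lt_trans XG.
have h1 : 8 * (k + 1) * (G * N) <= de * N ^+ 2.
  apply: (@le_trans _ _ (de * X * (G * N))); first by rewrite ler_wpM2r// mulr_ge0.
  by rewrite -mulrA ler_pM2l// mulrA expr2 ler_wpM2r// ltW.
have GN : G <= N.
  by apply: le_trans (ltW XG); rewrite ler_peMl.
have h2 : k * G ^+ 2 <= k * (G * N) by rewrite ler_wpM2l// expr2 ler_wpM2l.
have : 0 < de * N ^+ 2 by rewrite mulr_gt0 ?exprn_gt0.
have := mulr_ge0 G0 N0; have := mulr_ge0 k0 (mulr_ge0 G0 N0).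
have e2 : de / 8 * N ^+ 2 = 8^-1 * (de * N ^+ 2) by ring.
have e3 : 8 * (k + 1) * (G * N) = 8 * (k * (G * N)) + 8 * (G * N) by ring.
move: h h1 h2; rewrite (_ : de / 2 * N ^+ 2 = 2^-1 * (de * N ^+ 2)) ?e2 ?e3; last by ring.
move: (k * (G * N)) (G * N) (k * G ^+ 2) (de * N ^+ 2) => y1 y2 y3 y4 *; lra.
Qed.
End form_bound.

(** * Invertibility away from the prescribed values and from 0 *)

Section array_fredholm.
Variable R : realType.
Local Notation strip := (@strip R).
Local Notation H := (bergman strip).
Local Notation nrm := (L2norm strip).
Local Notation ip := (L2inner strip).
Implicit Types (f g h : R[i] -> R[i]) (m n : nat).

Let os := @strip_open R.
Let ms := @strip_cmset R.
Let sH : subspace H := bergman_subspace ms.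
Let sip : semi_inner H ip := bergman_semi_inner ms.

Variables (rho : R) (th : nat -> R) (x : nat -> R) (V : nat -> set R[i]) (w : nat -> R[i] -> R[i]).
Hypotheses (rho0 : 0 < rho) (rho16 : rho <= 16^-1).
Hypothesis pack : packing rho th x V w.
Hypotheses (th0 : forall m, 0 <= th m) (th2 : forall m, th m <= 2^-1).
Local Notation S := (gain rho).
Hypothesis S0 : 0 < S.
Local Notation K := (fun m => square (x m)%:C rho).
Local Notation Q := (fun m => square (x m)%:C 4^-1).
Variable c : R.
Hypotheses (c0 : 0 < c) (rhoc : 8192 * rho <= c / 4) (Sc : c ^+ 2 * (4 * rho ^+ 2) <= S).
Variable tau : R.
Hypotheses (thtau : forall n, \sum_(m < n) th m ^+ 2 <= tau) (tau1 : tau <= 1).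
Variable Lam : R.
Hypothesis Lam0 : 0 <= Lam.

Local Notation sym l := (piecewise K (fun m => l m / S%:C)).
Let E := 3 * Lam * (2 ^+ 17 / c) ^+ 2 / c ^+ 2.
Let F := 3 * Lam * (2 ^+ 23 / c + 2 ^+ 13) ^+ 2 / c ^+ 2.
Let B := Lam + Lam / S.

Let E0 : 0 <= E := divr_ge0 (mulr_ge0 (mulr_ge0 (ler0n _ 3) Lam0) (sqr_ge0 _)) (sqr_ge0 _).
Let F0 : 0 <= F := divr_ge0 (mulr_ge0 (mulr_ge0 (ler0n _ 3) Lam0) (sqr_ge0 _)) (sqr_ge0 _).

Variables (e de : R).
Hypotheses (e0 : 0 < e) (de0 : 0 < de).
Hypothesis small : E / e ^+ 2 * (2 * B ^+ 2 * tau) + E * tau + F * rho ^+ 2 <= de / 8.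
Local Notation X := (8 * (8 * E / e ^+ 2 + 1) / de + 1).

(** Let [g] be the image of [f]. As [mu] stays away from [l m], pairing with [w m] bounds the
    numbers [ip f (w m)] in terms of [g]; then [ip (T f) f], which sees [f] mainly through these
    numbers, is small up to [g]. Finally [mu * nrm f ^+ 2] is [ip (T f) f - ip g f], and [mu] is not
    small. *)
Lemma array_lower (l : nat -> R[i]) mu f : (forall m, normc (l m) <= Lam) ->
  de / 2 <= normc mu -> (forall m, e <= normc (mu - l m)) -> H f ->
  nrm f <= X * nrm (toeplitz strip (sym l) f - mu *: f).
Proof.
move=> lL mude mul Hf; set T := toeplitz strip (sym l).
have ba := array_symbol rho16 pack S0 lL.
have HT : H (T f) := toeplitz_mem os ms ba Hf.
have Hmu : H (mu *: f) := subZ sH mu Hf.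
set g := _ - _; have Hg : H g := subB sH HT Hmu.
have Lf := bergman_L2 Hf; have Lg := bergman_L2 Hg.
set N := nrm f; set G := nrm g.
have N0 : 0 <= N := L2norm_ge0 _ _; have G0 : 0 <= G := L2norm_ge0 _ _.
have Hw m : H (w m) := packing_mem pack m.
pose C m := normc (ip f (w m)).
(* Uses [(u + v + t) ^+ 2 <= 4 * u ^+ 2 + 4 * v ^+ 2 + 2 * t ^+ 2]. The first square is summed over
   the disjoint slabs; the other two carry [th m ^+ 2]. *)
have step m : e ^+ 2 * C m ^+ 2 <=
    4 * L2norm (V m) g ^+ 2 + (4 * G ^+ 2 + 2 * B ^+ 2 * N ^+ 2) * th m ^+ 2.
  have h1 := array_bessel pack th0 m Lg; rewrite -/G in h1.
  have h2 := array_almost_eigen rho0 rho16 pack th0 S0 lL m Hf; rewrite -/B -/N in h2.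
  have h3 : (mu - l m) * ip f (w m) = (ip (T f) (w m) - l m * ip f (w m)) - ip g (w m).
    by rewrite /g (ipBl sH sip)// (ipZl sH sip)//; ring.
  have h4 : e * C m <= L2norm (V m) g + th m * G + B * th m * N.
    apply: (@le_trans _ _ (normc (mu - l m) * C m)).
      by rewrite ler_wpM2r ?normc_ge0.
    rewrite /C -normcM h3; apply: le_trans (le_normcB _ _) _.
    by rewrite addrC; exact: lerD.
  have C0 : 0 <= C m by exact: normc_ge0.
  have h5 : 0 <= e * C m by rewrite mulr_ge0// ltW.
  rewrite -exprMn.
  apply: (@le_trans _ _ ((L2norm (V m) g + th m * G + B * th m * N) ^+ 2)).
    by rewrite ler_pXn2r// nnegrE// (le_trans h5).
  rewrite (_ : (4 * G ^+ 2 + _) * _ = 4 * (th m * G) ^+ 2 + 2 * (B * th m * N) ^+ 2); last by ring.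
  move: (L2norm _ _) (th m * G) (B * th m * N) => u v t.
  have := sqr_ge0 (u - v); have := sqr_ge0 (u + v - t); nra.
have sumC n : \sum_(m < n) C m ^+ 2 <= (8 * G ^+ 2 + 2 * B ^+ 2 * tau * N ^+ 2) / e ^+ 2.
  rewrite ler_pdivlMr ?exprn_gt0// mulrC mulr_sumr.
  apply: le_trans (ler_sum _ (fun (m : 'I_n) _ => step m)) _.
  rewrite big_split/= -!mulr_sumr.
  have := sum_L2norm_le n ms (packing_cmset pack) (packing_sub pack) (packing_disjoint pack) Lg.
  rewrite -/G => h1; have h2 := thtau n.
  have h3 : (4 * G ^+ 2 + 2 * B ^+ 2 * N ^+ 2) * \sum_(m < n) th m ^+ 2 <=
            (4 * G ^+ 2 + 2 * B ^+ 2 * N ^+ 2) * tau.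
    apply: ler_wpM2l h2; apply: addr_ge0 (mulr_ge0 (ler0n _ 4) (sqr_ge0 G)) _.
    exact: mulr_ge0 (mulr_ge0 (ler0n _ 2) (sqr_ge0 B)) (sqr_ge0 N).
  have h4 : G ^+ 2 * tau <= G ^+ 2 by rewrite ler_piMr ?sqr_ge0.
  move: h1 h3; set s1 := \sum_(_ < _) _; set s2 := \sum_(_ < _) _.
  move=> h1 h3; apply: le_trans (lerD (ler_wpM2l (ler0n _ 4) h1) h3) _.
  rewrite (_ : (4 * G ^+ 2 + _) * tau = 4 * (G ^+ 2 * tau) + 2 * B ^+ 2 * tau * N ^+ 2); last by ring.
  move: (2 * B ^+ 2 * tau * N ^+ 2) => y.
  move: (G ^+ 2 * tau) (G ^+ 2) h4 => u v h4; lra.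
have form : normc (ip (T f) f) <= 8 * E / e ^+ 2 * G ^+ 2 + de / 8 * N ^+ 2.
  rewrite (toeplitz_ip os ms ba Hf Hf).
  apply: (piecewise_form_bound ms _ _ _ ba Lf).
  - exact: (array_trivI rho16 pack).
  - by move=> m; exact: cmset_box.
  - by move=> m; apply: square_strip; apply: le_lt_trans rho16 _; lra.
  move=> n; have key m : normc (l m / S%:C) * L2norm (K m) f ^+ 2 <=
      E * (C m ^+ 2 + th m ^+ 2 * N ^+ 2) + F * rho ^+ 2 * L2norm (Q m) f ^+ 2.
    have kL := array_coef S0 lL m.
    have := array_weighted_mass rho0 rho16 pack th0 th2 S0 c0 rhoc Sc Lam0 m Hf (normc_ge0 _) kL.
    exact.
  apply: le_trans (ler_sum _ (fun (m : 'I_n) _ => key m)) _.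
  rewrite big_split/= -!mulr_sumr big_split/= -mulr_suml.
  have h1 : \sum_(m < n) L2norm (Q m) f ^+ 2 <= N ^+ 2.
    have Qs m : Q m `<=` strip by apply: square_strip; lra.
    apply: (sum_L2norm_le n ms _ Qs (array_trivIQ pack) Lf) => m; exact: cmset_box.
  have h2 : F * rho ^+ 2 * \sum_(m < n) L2norm (Q m) f ^+ 2 <= F * rho ^+ 2 * N ^+ 2.
    by rewrite ler_wpM2l// mulr_ge0// sqr_ge0.
  have h3 : (\sum_(m < n) th m ^+ 2) * N ^+ 2 <= tau * N ^+ 2.
    by rewrite ler_wpM2r ?sqr_ge0.
  have h4 := ler_wpM2l E0 (lerD (sumC n) h3).
  apply: le_trans (lerD h4 h2) _.
  (* [small] gathers every term proportional to [N ^+ 2] and keeps their sum below [de / 8], a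
     quarter of the [de / 2] supplied by [mu]. *)
  have h5 := ler_wpM2r (sqr_ge0 N) small.
  rewrite [leLHS](_ : _ = 8 * E / e ^+ 2 * G ^+ 2 +
    (E / e ^+ 2 * (2 * B ^+ 2 * tau) + E * tau + F * rho ^+ 2) * N ^+ 2).
    by rewrite lerD2l.
  move: (E) (F) (B) => E' F' B'; field; rewrite gt_eqF//.
apply: absorb_le => //; first by rewrite divr_ge0 ?sqr_ge0// mulr_ge0.
rewrite -/N -/G.
have ipg : (mu * (N ^+ 2)%:C) = ip (T f) f - ip g f.
  rewrite /g (ipBl sH sip)// (ipZl sH sip)// (ipff sip Hf) -L2norm_inorm -/N; ring.
have h1 : normc (ip g f) <= G * N := L2_CauchySchwarz ms Lg Lf.
have h2 : normc mu * N ^+ 2 <= normc (ip (T f) f) + normc (ip g f).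
  have <- : normc (mu * (N ^+ 2)%:C) = normc mu * N ^+ 2.
    by rewrite normcM normc_real ger0_norm// sqr_ge0.
  by rewrite ipg; exact: le_normcB.
have h3 : de / 2 * N ^+ 2 <= normc mu * N ^+ 2 by rewrite ler_wpM2r ?sqr_ge0.
apply: le_trans h3 (le_trans h2 _); exact: lerD.
Qed.

(** The conjugate symbol is the array symbol of the conjugate constants, with the same bounds and
    distances, so [array_lower] also applies to the adjoint at [mu^*]. *)
Theorem array_fredholm (l : nat -> R[i]) mu : (forall m, normc (l m) <= Lam) ->
  de / 2 <= normc mu -> (forall m, e <= normc (mu - l m)) ->
  fredholm H nrm (fun f => toeplitz strip (sym l) f - mu *: f).
Proof.
move=> lL mude mul.
apply: (toeplitz_fredholm os ms (array_symbol rho16 pack S0 lL) (C := X)).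
  by move=> f; exact: array_lower.
move=> f Hf.
have -> : (fun z => (sym l z)^*) = sym (fun m => (l m)^*).
  apply/funext => z; rewrite piecewise_conj; congr (piecewise _ _ z); apply/funext => m.
  rewrite rmorphM fmorphV/=; congr (_ / _).
  by apply/eqP; rewrite eq_complex/= oppr0 !eqxx.
apply: array_lower => //.
- by move=> m; rewrite normc_conj.
- by rewrite normc_conj.
- by move=> m; rewrite -rmorphB normc_conj.
Qed.
End array_fredholm.

(** * Values that recur infinitely often belong to the essential spectrum *)

Section array_spectrum.
Variable R : realType.
Local Notation strip := (@strip R).
Local Notation H := (bergman strip).
Local Notation nrm := (L2norm strip).
Local Notation ip := (L2inner strip).
Implicit Types (f g h : R[i] -> R[i]) (m n : nat).

Lemma summable_small (u : nat -> R) (B r : R) : (forall n, 0 <= u n) ->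
  (forall n, \sum_(m < n) u m <= B) -> 0 < r -> exists M, forall n, (M <= n)%N -> u n < r.
Proof.
move=> u0 uB r0.
have cu : cvgn (series u).
  apply: nondecreasing_is_cvgn; first by apply: nondecreasing_series => n _ _; exact: u0.
  by exists B => _ [n _ <-]; rewrite /series /= big_mkord.
have /cvgrPdist_lt/(_ _ r0)[M _ HM] := cvg_series_cvg_0 cu.
by exists M => n /HM; rewrite /= sub0r normrN ger0_norm.
Qed.

Let os := @strip_open R.
Let ms := @strip_cmset R.
Let sH : subspace H := bergman_subspace ms.
Let sip : semi_inner H ip := bergman_semi_inner ms.

Variables (rho : R) (th : nat -> R) (x : nat -> R) (V : nat -> set R[i]) (w : nat -> R[i] -> R[i]).
Hypotheses (rho0 : 0 < rho) (rho16 : rho <= 16^-1).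
Hypothesis pack : packing rho th x V w.
Hypotheses (th0 : forall m, 0 <= th m) (th2 : forall m, th m <= 2^-1).
Local Notation S := (gain rho).
Hypothesis S0 : 0 < S.
Local Notation K := (fun m => square (x m)%:C rho).
Variable tau : R.
Hypothesis thtau : forall n, \sum_(m < n) th m ^+ 2 <= tau.
Variables (l : nat -> R[i]) (Lam : R).
Hypothesis lL : forall m, normc (l m) <= Lam.
Local Notation a := (piecewise K (fun m => l m / S%:C)).

Let sqr_small (u : nat -> R) (B r : R) : (forall n, 0 <= u n) ->
  (forall n, \sum_(m < n) u m ^+ 2 <= B) -> 0 < r -> exists M, forall n, (M <= n)%N -> u n < r.
Proof.
move=> u0 uB r0; have r20 : 0 < r ^+ 2 by rewrite exprn_gt0.
have [M HM] := summable_small (fun n => sqr_ge0 (u n)) uB r20.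
by exists M => n /HM; rewrite ltr_pXn2r// ?nnegrE ?(ltW r0).
Qed.

Let th_small r : 0 < r -> exists M, forall n, (M <= n)%N -> th n < r.
Proof. exact: sqr_small. Qed.

(** Both terms of [array_bessel] tend to 0: the local norms over disjoint slabs are square summable,
    and so is [th]. *)
Lemma array_weak_null f r : H f -> 0 < r ->
  exists M, forall n, (M <= n)%N -> normc (ip f (w n)) < r.
Proof.
move=> Hf r0; have Lf := bergman_L2 Hf; have r2 : 0 < r / 2 by rewrite divr_gt0.
have N1 : 0 < nrm f + 1 by rewrite ltr_wpDl// L2norm_ge0.
have [M1 H1] := sqr_small (fun n => L2norm_ge0 (V n) f) (fun n =>
  sum_L2norm_le n ms (packing_cmset pack) (packing_sub pack) (packing_disjoint pack) Lf) r2.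
have r3 : 0 < r / 2 / (nrm f + 1) by rewrite divr_gt0.
have [M2 H2] := th_small r3.
exists (maxn M1 M2) => n; rewrite geq_max => /andP[n1 n2].
apply: le_lt_trans (array_bessel pack th0 n Lf) _.
have h1 := H1 _ n1; have h2 := H2 _ n2.
have h3 : th n * nrm f <= r / 2.
  apply: (@le_trans _ _ (th n * (nrm f + 1))); first by rewrite ler_wpM2l// lerDl.
  by rewrite -ler_pdivlMr// ltW.
by rewrite (splitr r) ltr_leD.
Qed.

(** What fails is the finite codimension of the range: the [w (phi k)] are weakly null, of norm at
    least [1/2] and almost orthogonal to the range of the shifted operator. The bound [k <= phi k]
    sends the indices to infinity. *)
Theorem array_not_fredholm mu (phi : nat -> nat) : (forall k, (k <= phi k)%N) ->
  (forall k, l (phi k) = mu) ->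
  ~ fredholm H nrm (fun f => toeplitz strip a f - mu *: f).
Proof.
move=> phik lphi [_ _ [k [e [He cof]]]].
have ba := array_symbol rho16 pack S0 lL.
have Lam0 : 0 <= Lam := le_trans (normc_ge0 (l 0%N)) (lL 0%N).
(* The extra 1 keeps the factor positive, so that it can be divided out even when [Lam = 0]. *)
have B0 : 0 < Lam + Lam / S + 1.
  by rewrite ltr_wpDl// addr_ge0// divr_ge0// ltW.
apply: (not_cofinite_range sH sip (bergman_complete os ms)
   (T := fun f => toeplitz strip a f - mu *: f) (e := e) (w := fun k => w (phi k))
   (sig := fun k => (Lam + Lam / S + 1) * th (phi k))) cof => //.
- by move=> n; exact: (packing_mem pack).
- move=> n; rewrite -L2norm_inorm; exact: (array_norm_ge rho0 rho16 pack).
- move=> n f Hf; have HT := toeplitz_mem os ms ba Hf.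
  rewrite (ipBl sH sip)//; [|exact: subZ|exact: (packing_mem pack)].
  rewrite (ipZl sH sip)//; last exact: (packing_mem pack).
  rewrite -(lphi n) -L2norm_inorm.
  apply: le_trans (array_almost_eigen rho0 rho16 pack th0 S0 lL (phi n) Hf) _.
  rewrite ler_wpM2r ?L2norm_ge0// ler_wpM2r// lerDl//.
- by move=> f Hf; apply: (subB sH); [exact: toeplitz_mem ba Hf|exact: subZ].
- move=> r r0; have r1 : 0 < r / (Lam + Lam / S + 1) by rewrite divr_gt0.
  have [M HM] := th_small r1; exists M => n Mn.
  by rewrite mulrC -ltr_pdivlMr//; apply: HM; exact: leq_trans Mn (phik n).
- move=> f Hf r r0; have [M HM] := array_weak_null Hf r0; exists M => n Mn.
  by apply: HM; exact: leq_trans Mn (phik n).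
Qed.
End array_spectrum.

(** * Choice of the constants and conclusion *)

Section array_construction.
Variable R : realType.
Local Notation strip := (@strip R).
Local Notation H := (bergman strip).
Local Notation nrm := (L2norm strip).

Lemma exists_square_summable (tau : R) : 0 < tau -> exists th : nat -> R,
  [/\ forall m, 0 < th m, forall m, th m <= 2^-1 & forall n, \sum_(m < n) th m ^+ 2 <= tau].
Proof.
move=> tau0; pose t := Num.min 2^-1 (tau / 2).
have t0 : 0 < t by rewrite lt_min; apply/andP; split; [lra|exact: divr_gt0].
have t2 : t <= 2^-1 by rewrite ge_min lexx.
have tt : t <= tau / 2 by rewrite ge_min lexx orbT.
have p0 m : 0 < (2 ^+ m)^-1 :> R by rewrite invr_gt0 exprn_gt0.
have p1 m : (2 ^+ m)^-1 <= 1 :> R by rewrite invf_le1 ?exprn_gt0// exprn_ege1// ler1n.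
exists (fun m => t * (2 ^+ m)^-1); split.
- by move=> m; rewrite mulr_gt0.
- by move=> m; apply: le_trans t2; rewrite ler_piMr// ltW.
(* The terms are [t ^+ 2 * 4 ^- m]. The bound chosen here is cruder than the geometric sum, but its
   increments [t ^+ 2 * 2 ^- m] dominate them, which makes the induction immediate. *)
move=> n; apply: (@le_trans _ _ (t ^+ 2 * (2 - 2 * (2 ^+ n)^-1))); last first.
  by have := p0 n; nra.
elim: n => [|n IH]; first by rewrite big_ord0 expr0 invr1 mulr1 subrr mulr0.
rewrite big_ord_recr/=; apply: le_trans (lerD IH (lexx _)) _.
rewrite exprMn (exprS 2 n) invfM; move: ((2 ^+ n)^-1) (p0 n) (p1 n) => p ? ?.
by rewrite -mulrDr ler_wpM2l ?sqr_ge0//; nra.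
Qed.

(** The order of the choices avoids a circle: [c] from the seed; [rho] so small that [F * rho ^+ 2]
    takes at most [de / 16]; then [S = gain rho] and hence [B] and [A]; then [tau] so that [A * tau]
    takes the other [de / 16]; last [th] and the packing. *)
Theorem array_operator (Lam e de : R) (l : nat -> R[i]) : 0 < e -> 0 < de ->
  (forall m, normc (l m) <= Lam) ->
  exists (a : R[i] -> R[i]) (A : R), [/\ bounded_symbol strip a A,
    forall mu, de / 2 <= normc mu -> (forall m, e <= normc (mu - l m)) ->
      fredholm H nrm (fun f => toeplitz strip a f - mu *: f) &
    forall mu (phi : nat -> nat), (forall k, (k <= phi k)%N) -> (forall k, l (phi k) = mu) ->
      ~ fredholm H nrm (fun f => toeplitz strip a f - mu *: f)].
Proof.
move=> e0 de0 lL; have Lam0 : 0 <= Lam := le_trans (normc_ge0 (l 0%N)) (lL 0%N).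
have [c c0 Hc] := gain_ge R.
pose E := 3 * Lam * (2 ^+ 17 / c) ^+ 2 / c ^+ 2.
pose F := 3 * Lam * (2 ^+ 23 / c + 2 ^+ 13) ^+ 2 / c ^+ 2.
have E0 : 0 <= E := divr_ge0 (mulr_ge0 (mulr_ge0 (ler0n _ 3) Lam0) (sqr_ge0 _)) (sqr_ge0 _).
have F0 : 0 <= F := divr_ge0 (mulr_ge0 (mulr_ge0 (ler0n _ 3) Lam0) (sqr_ge0 _)) (sqr_ge0 _).
have [rho [rho0 rho16 rhoc rhoF]] : exists rho, [/\ 0 < rho, rho <= 16^-1,
    8192 * rho <= c / 4 & F * rho ^+ 2 <= de / 16].
  have q0 : 0 < de / 16 / (F + 1).
    by rewrite !divr_gt0// ltr_wpDl.
  have p8 : 0 < 8192 :> R by rewrite ltr0n.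
  have c8 : 0 < c / 4 / 8192 by apply: divr_gt0 p8; exact: divr_gt0.
  pose rho := Num.min 16^-1 (Num.min (c / 4 / 8192) (de / 16 / (F + 1))).
  have r0 : 0 < rho by rewrite !lt_min c8 q0 !andbT invr_gt0.
  have r16 : rho <= 16^-1 by rewrite /rho ge_min lexx.
  have rc : rho <= c / 4 / 8192 by rewrite /rho !ge_min lexx orbT.
  have rF : rho <= de / 16 / (F + 1) by rewrite /rho !ge_min lexx !orbT.
  exists rho; split; [exact: r0|exact: r16| |].
    by rewrite mulrC -(ler_pdivlMr _ _ p8).
  move: rF; rewrite ler_pdivlMr ?ltr_wpDl// => rF.
  have r1 : rho <= 1 by apply: le_trans r16 _; rewrite invf_le1// ler1n.
  apply: le_trans rF; rewrite mulrC; apply: (@le_trans _ _ (rho * F)).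
    by rewrite ler_wpM2r// expr2 ler_piMl// ltW.
  by rewrite ler_wpM2l ?(ltW r0)// lerDl.
have Sc := Hc _ rho0 rho16 rhoc.
have S0 : 0 < gain rho by apply: lt_le_trans Sc; rewrite !mulr_gt0 ?exprn_gt0.
pose B := Lam + Lam / gain rho.
pose A := E / e ^+ 2 * (2 * B ^+ 2) + E.
have A0 : 0 <= A.
  apply: addr_ge0 (E0).
  exact: mulr_ge0 (divr_ge0 E0 (sqr_ge0 _)) (mulr_ge0 (ler0n _ 2) (sqr_ge0 _)).
have q0 : 0 < de / 16 / (A + 1) by rewrite !divr_gt0// ltr_wpDl.
pose tau := Num.min 1 (de / 16 / (A + 1)).
have tau0 : 0 < tau by rewrite lt_min ltr01.
have tau1 : tau <= 1 by rewrite ge_min lexx.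
have tauA : A * tau <= de / 16.
  have : tau <= de / 16 / (A + 1) by rewrite /tau ge_min lexx orbT.
  by rewrite ler_pdivlMr ?ltr_wpDl//; apply: le_trans; rewrite mulrC ler_wpM2l ?(ltW tau0)// lerDl.
have small : E / e ^+ 2 * (2 * B ^+ 2 * tau) + E * tau + F * rho ^+ 2 <= de / 8.
  rewrite (_ : E / e ^+ 2 * (2 * B ^+ 2 * tau) + E * tau = A * tau); last by rewrite /A; ring.
  by rewrite (_ : de / 8 = de / 16 + de / 16); [exact: lerD|field].
have [th [th0 th2 thtau]] := exists_square_summable tau0.
have th0' m : 0 <= th m := ltW (th0 m).
have [x [V [w pack]]] := packing_exists rho0 rho16 S0 th0.
exists (piecewise (fun m => square (x m)%:C rho) (fun m => l m / (gain rho)%:C)), (Lam / gain rho).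
split; first exact: (array_symbol rho16 pack S0 lL).
- move=> mu mude mul.
  exact: (array_fredholm rho0 rho16 pack th0' th2 S0 c0 rhoc Sc thtau tau1 Lam0 e0 de0 small lL mude mul).
- move=> mu phi phik lphi.
  exact: (array_not_fredholm rho0 rho16 pack th0' th2 S0 thtau lL phik lphi).
Qed.
End array_construction.

(* The eigenvalue written lambda_n (n >= 1) on paper is lam n.-1. *)
Theorem theorem5p2 (R : realType) (b : R[i] -> R) (r : R) (lam : nat -> R[i])
    (N : nat) (delta : R)
    (b_Linfty : Linfty (disc 0 1) (fun z => (b z)%:C))
    (r_lt1 : r < 1)
    (b_support : ess_support (disc 0 1) (fun z => (b z)%:C) `<=` disc 0 r)
    (lam_eigenvalues :
      eigenvalue_enumeration (bergman (disc 0 1))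
        (toeplitz (disc 0 1) (fun z => (b z)%:C)) lam)
    (N_gt0 : (0 < N)%N) (delta_gt0 : 0 < delta)
    (gap : normc (lam N) + 2 * delta < normc (lam N.-1)) :
  \forall e \near (0 : R)^'+,
    exists (Pi : set R[i]) (a : R[i] -> R[i]),
      let G := \bigcup_(n in `I_N) disc (lam n) e in
      let S := toeplitz_ess_spectrum Pi a in
      [/\ simply_connected Pi /\ periodic_domain Pi,
          Linfty Pi a,
          bounded_operator (bergman Pi) (L2norm Pi) (toeplitz Pi a),
          forall n, (n < N)%N -> S `&` disc (lam n) e !=set0
        & (delta%:E <= set_dist (S `&` G) (S `\` G))%E].
Proof.
have [lam_mono _] := lam_eigenvalues.
(* Numbered from 0, the last eigenvalue before the gap is [lam N.-1]; monotonicity passes its lower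
   bound to all earlier ones. *)
have lam_gt n : (n < N)%N -> 2 * delta < normc (lam n).
  move=> nN; have : normc (lam N.-1) <= normc (lam n) by apply: lam_mono; rewrite -ltnS prednK.
  by have := normc_ge0 (lam N); lra.
(* Small enough means [e <= delta / 2], which is what the final distance estimate consumes. *)
near=> e.
have e0 : 0 < e by near: e; exact: nbhs_right_gt.
have e2 : e <= delta / 2 by near: e; apply: nbhs_right_le; rewrite divr_gt0.
pose l m := lam (m %% N)%N.
have lL m : normc (l m) <= normc (lam 0%N) by exact: lam_mono.
have [a [A [ba fred nfred]]] := array_operator e0 delta_gt0 lL.
exists (@strip R), a; have os := @strip_open R; have ms := @strip_cmset R.
split.
- split; last exact: strip_periodic.
  exact: (convex_simply_connected (@strip_convex R)).
- by split; [case: ba|exists A; apply: aeW => p _; case: ba].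
- exact: (toeplitz_bounded os ms ba).
- move=> n nN; exists (lam n); split; last by rewrite /disc /= subrr normc0.
  (* These indices are congruent to [n] modulo [N], so [l] takes the value [lam n] at all of them;
     [0 < N] gives [k <= n + N * k]. *)
  apply: (nfred _ (fun k => n + N * k)%N) => k.
    by apply: leq_trans (leq_addl _ _); exact: leq_pmull.
  by rewrite /l mulnC addnC modnMDl modn_small.
(* A point of the discs has modulus above [2 * delta - e >= 3/2 * delta], while a point of the
   essential spectrum off the discs has modulus at most [delta / 2]. An infimum over no pairs is
   [+oo], so an empty set is covered by the same argument. *)
- apply: le_ereal_inf_tmp => _ [[s t] [[_ [n nN sn]] [St nGt]] <-]; rewrite lee_fin/=.
  have ht : normc t <= delta / 2.
    rewrite leNgt; apply/negP => td; apply: St; apply: fred; first exact: ltW.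
    move=> m; rewrite leNgt; apply/negP => tm; apply: nGt.
    by exists (m %% N)%N => //=; rewrite ltn_mod.
  have h1 := le_normc_dist s t; have h2 := lam_gt n nN.
  have := le_normc_dist (lam n) (lam n - s); rewrite opprB addrCA subrr addr0.
  by move: sn; rewrite /disc /= normcB; lra.
Unshelve. all: by end_near. Qed.
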